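(* Let $\mathfrak X_0$ be an integral normal scheme which is flat of finite type over $\mathrm{Spec}\,\mathbb Z$ and let $\mathcal E$ be an admissible class of characters (with values in $\mathbb C^\times$) with $\mathcal E\supset\mathcal E_f$. Then the spaces $$X=\check{\mathfrak X}(\mathbb C)_{\mathcal E}\times_{\mathbb Q_0^{>0}}\mathbb R^{>0}\quad\text{and}\quad X_0=\check{\mathfrak X}_0(\mathbb C)_{\mathcal E}\times_{\mathbb Q_0^{>0}}\mathbb R^{>0}$$ are connected.
   Context: Let $K_0$ be the function field of $\mathfrak X_0$, $K$ an algebraic closure, $\pi:\mathfrak X\to\mathfrak X_0$ the normalization of $\mathfrak X_0$ in $K$, $G=\mathrm{Aut}_{K_0}(K)$, acting on $\mathfrak X$ from the right over $\mathfrak X_0$ (with induced isomorphisms $\sigma:\kappa(x^\sigma)\to\kappa(x)$). $\mathcal N_0$ is the submonoid of the multiplicative monoid of positive integers generated by a set $\mathrm{char}\,\mathcal N_0$ of primes containing the set $\mathrm{char}\,\mathfrak X_0$ of positive residue characteristics of $\mathfrak X_0$; $\mathbb Q_0^{>0}\subset\mathbb Q^{>0}$ is the subgroup generated by $\mathcal N_0$. $\dot{\mathfrak X}(\mathbb C)$ is the set of pairs $(x,\bar P^\times)$, $x\in\mathfrak X$, $\bar P^\times:\kappa(x)^\times\to\mathbb C^\times$ a group homomorphism, with $(x,\bar P^\times)^\sigma=(x^\sigma,\bar P^\times\circ\sigma)$ for $\sigma\in G$ and injective maps $F_\nu(x,\bar P^\times)=(x,\bar P^\times\circ(\ )^\nu)$.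 A class $\mathcal E$ of characters $\chi:\kappa^\times\to\mathbb C^\times$ on algebraically closed fields $\kappa$ is admissible if it is invariant under isomorphisms $\tau:\kappa'\to\kappa$ of fields ($\chi\in\mathcal E\Leftrightarrow\chi\circ\tau\in\mathcal E$), if $\chi\in\mathcal E\Leftrightarrow\chi^\nu\in\mathcal E$ for all $\nu\in\mathcal N_0$, and if for every $\chi\in\mathcal E$ the group $\ker(\chi)_{\mathrm{tors}}$ is finite of order in $\mathcal N_0$. $\mathcal E_f$ is the class of characters $\chi$ with $\ker\chi$ finite and $|\ker\chi|\in\mathcal N_0$. $\dot{\mathfrak X}(\mathbb C)_{\mathcal E}=\{(x,\bar P^\times)\in\dot{\mathfrak X}(\mathbb C)\mid\bar P^\times\in\mathcal E\}$; $\check{\mathfrak X}(\mathbb C)=\mathrm{colim}_{\mathcal N_0}\dot{\mathfrak X}(\mathbb C)$ and $\check{\mathfrak X}(\mathbb C)_{\mathcal E}=\mathrm{colim}_{\mathcal N_0}\dot{\mathfrak X}(\mathbb C)_{\mathcal E}\subset\check{\mathfrak X}(\mathbb C)$ (over $\mathcal N_0$ ordered by divisibility, transition map from index $\nu$ to $\nu\mu$ being $F_\mu$), on which the $F_\nu$ become bijective and give a $\mathbb Q_0^{>0}$-action; $\check{\mathfrak X}_0(\mathbb C)_{\mathcal E}=\check{\mathfrak X}(\mathbb C)_{\mathcal E}/G$. For a space $M$ with $\mathbb Q_0^{>0}$-action $q\mapsto F_q$, $M\times_{\mathbb Q_0^{>0}}\mathbb R^{>0}$ is the quotient of $M\times\mathbb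 R^{>0}$ by $(m,u)q=(F_q(m),q^{-1}u)$ with the quotient topology. Topologies: if $\mathfrak X_0=\mathrm{Spec}\,R_0$ is affine, $\mathfrak X=\mathrm{Spec}\,R$, identify $(x,\bar P^\times)$, $x$ corresponding to the prime $\mathfrak p$, with the multiplicative map $P:R\to\mathbb C$, $P(r)=\bar P^\times(r\bmod\mathfrak p)$ for $r\notin\mathfrak p$ and $P(r)=0$ for $r\in\mathfrak p$, and give $\dot{\mathfrak X}(\mathbb C)$ the topology of pointwise convergence. In general $O\subset\dot{\mathfrak X}(\mathbb C)$ is open iff its intersection with $\{(x,\bar P^\times)\mid x\in\pi^{-1}(\mathfrak X_0')\}$ is open there for every affine open $\mathfrak X_0'\subset\mathfrak X_0$. $\check{\mathfrak X}(\mathbb C)$ has the inductive limit topology ($Z$ is open iff $F_\nu(Z)\cap\dot{\mathfrak X}(\mathbb C)$ is open in $\dot{\mathfrak X}(\mathbb C)$ for all $\nu\in\mathcal N_0$), subsets the subspace topology, and quotients by $G$ the quotient topology. *)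

(* Defs.v *)
From HB Require Import structures.
From mathcomp Require Import all_boot all_order all_algebra.
From mathcomp Require Import all_classical all_reals all_analysis.
From mathcomp.real_closed Require Import complex.
From Stdlib Require Import Relation_Operators.

Set Implicit Arguments.
Unset Strict Implicit.
Unset Printing Implicit Defensive.
Import Order.TTheory GRing.Theory Num.Theory.
Import numFieldNormedType.Exports.
Local Open Scope classical_set_scope.
Local Open Scope ring_scope.
Local Open Scope quotient_scope.

Definition subring (A : pzRingType) (S : set A) : Prop :=
  [/\ S 1, forall a b, S a -> S b -> S (a - b)
    & forall a b, S a -> S b -> S (a * b)].

(* [A] is meant to be a subring of [K]. *)
Definition integral_over (K : fieldType) (A : set K) (z : K) : Prop :=
  exists p : {poly K}, [/\ p \is monic, forall i, A p`_i & root p z].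

(* [p] is a prime ideal of the subring [S]. *)
Definition prime_ideal_of (A : comPzRingType) (S p : set A) : Prop :=
  [/\ p `<=` S, p 0, forall a b, p a -> p b -> p (a + b),
      forall a b, S a -> p b -> p (a * b)
    & ~ p 1 /\ forall a b, S a -> S b -> p (a * b) -> p a \/ p b].

(* A point of [Spec S], for a subring [S] of the field [K]. *)
Record spec_point (K : fieldType) := SpecPoint {
  sp_ring : set K;
  sp_ideal : set K;
  sp_subring : subring sp_ring;
  sp_prime : prime_ideal_of sp_ring sp_ideal }.

(* The residue field at a point [p] of [Spec S] is constructed as the quotient
   of the local ring [S_p], realized inside [K], by its maximal ideal. *)
Section Residue.
Variables (K : fieldType) (x : spec_point K).
Let S := sp_ring x.
Let p := sp_ideal x.

Definition in_local (z : K) : bool :=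
  `[< exists a b, [/\ S a, S b, ~ p b & z = a / b] >].

Definition in_maximal (z : K) : bool :=
  `[< exists a b, [/\ p a, S b, ~ p b & z = a / b] >].

Lemma den_neq0 b : ~ p b -> b != 0.
Proof.
by move=> npb; apply/eqP => b0; apply: npb; rewrite b0; have [] := sp_prime x.
Qed.

Lemma denM b c : S b -> S c -> ~ p b -> ~ p c -> S (b * c) /\ ~ p (b * c).
Proof.
move=> Sb Sc pb pc; have [_ _ SM] := sp_subring x.
have [_ _ _ _ [_ pr]] := sp_prime x.
by split; [exact: SM | case/pr].
Qed.

Lemma in_local_subring : subring_closed in_local.
Proof.
have [S1 SB SM] := sp_subring x; have [pS p0 pD pM [np1 pr]] := sp_prime x.
split.
- by apply/asboolP; exists 1, 1; split => //; rewrite divr1.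
- move=> _ _ /asboolP [a [b [Sa Sb pb ->]]] /asboolP [c [d [Sc Sd pd ->]]].
  have [Sbd pbd] := denM Sb Sd pb pd.
  apply/asboolP; exists (a * d - c * b), (b * d); split => //.
    by apply: SB; apply: SM.
  by rewrite -mulNr addf_div ?den_neq0 // mulNr.
- move=> _ _ /asboolP [a [b [Sa Sb pb ->]]] /asboolP [c [d [Sc Sd pd ->]]].
  have [Sbd pbd] := denM Sb Sd pb pd.
  apply/asboolP; exists (a * c), (b * d).
  by split; rewrite ?mulf_div //; apply: SM.
Qed.

HB.instance Definition _ :=
  GRing.isSubringClosed.Build K in_local in_local_subring.

Record localization :=
  Local { local_val :> K; local_valP : in_local local_val }.

HB.instance Definition _ := [isSub for local_val].
HB.instance Definition _ := [Choice of localization by <:].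
HB.instance Definition _ := [SubChoice_isSubComNzRing of localization by <:].

Definition maximal : {pred localization} := fun z => in_maximal (val z).

Lemma maximal_idealr : idealr_closed maximal.
Proof.
have [S1 SB SM] := sp_subring x; have [pS p0 pD pM [np1 pr]] := sp_prime x.
split.
- by apply/asboolP; exists 0, 1; split => //; rewrite rmorph0 mul0r.
- apply/asboolP => -[a [b [pa Sb pb /esym]]]; rewrite rmorph1 => e.
  by apply: pb; move/divr1_eq: e => <-.
- move=> [z Lz] u v; have /asboolP [a [b [Sa Sb pb ez]]] := Lz.
  move=> /asboolP [c [d [pc Sd pd eu]]] /asboolP [e [f [pe Sf pf ev]]].
  have [Sbd pbd] := denM Sb Sd pb pd.
  have [Sbdf pbdf] := denM Sbd Sf pbd pf.
  apply/asboolP; exists (a * c * f + e * (b * d)), (b * d * f); split => //.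
    apply: pD; first by rewrite mulrC; apply: (pM _ _ Sf); apply: pM.
    by rewrite mulrC; apply: pM.
  by rewrite rmorphD rmorphM /= ez eu ev mulf_div addf_div ?den_neq0.
Qed.

HB.instance Definition _ :=
  isIdealr.Build (localization : nzRingType) maximal maximal_idealr.

Definition residue : Type := {ideal_quot (maximal : idealr localization)}.
HB.instance Definition _ := GRing.ComNzRing.on residue.

HB.instance Definition _ := NzRingQuotient.on residue.
Definition to_residue (z : localization) : residue := \pi_residue z.

Lemma to_residue_eq0 (z : localization) : (to_residue z == 0) = in_maximal z.
Proof.
have -> : 0 = \pi_residue 0 :> residue by rewrite rmorph0.
rewrite /to_residue -(Quotient.idealrBE (maximal : idealr localization)).
by rewrite subr0.
Qed.

Definition residue_inv (c : residue) : residue :=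
  if c == 0 then 0 else xget 0 [set d | d * c = 1].

Lemma residue_mulVf (c : residue) : c != 0 -> residue_inv c * c = 1.
Proof.
move=> c0; rewrite /residue_inv (negbTE c0).
suff [d cd] : exists d, d * c = 1.
  by apply: (@xgetPex _ 0 [set d | d * c = 1]); exists d.
have [S1 SB SM] := sp_subring x; have [pS p0 pD pM [np1 pr]] := sp_prime x.
have [z cz] : exists z, c = to_residue z.
  by exists (repr c); rewrite /to_residue reprK.
move: c0; rewrite cz to_residue_eq0 => /asboolP npz.
have /asboolP [a [b [Sa Sb pb ez]]] := local_valP z.
have npa : ~ p a by move=> pa; apply: npz; exists a, b.
have Lw : in_local (b / a) by apply/asboolP; exists b, a.
exists (to_residue (Local Lw)).
rewrite /to_residue -rmorphM.
rewrite -[1](rmorph1 (\pi_residue : {rmorphism localization -> residue})).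
congr (\pi_residue _); apply: val_inj; rewrite rmorphM rmorph1 /= ez.
by rewrite mulf_div [b * a]mulrC divff // mulf_neq0 ?den_neq0.
Qed.

Lemma residue_inv0 : residue_inv 0 = 0.
Proof. by rewrite /residue_inv eqxx. Qed.

HB.instance Definition _ :=
  GRing.ComNzRing_isField.Build residue residue_mulVf residue_inv0.

(* The image of [z] in the residue field; the value 0 outside [S_p] is junk. *)
Definition reduce (z : K) : residue :=
  if insub z is Some w then to_residue w else 0.

End Residue.

Section IntegralClosure.
Variables (K : fieldType) (A : set K) (subA : subring A).

Let in_A (z : K) : bool := `[< A z >].
Let in_A_subring : subring_closed in_A.
Proof.
have [A1 AB AM] := subA; split; first exact/asboolP.
- by move=> a b /asboolP Aa /asboolP Ab; apply/asboolP; exact: AB.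
- by move=> a b /asboolP Aa /asboolP Ab; apply/asboolP; exact: AM.
Qed.
HB.instance Definition _ := GRing.isSubringClosed.Build K in_A in_A_subring.
Record subring_type := SubringType { subring_val :> K; _ : in_A subring_val }.
HB.instance Definition _ := [isSub for subring_val].
HB.instance Definition _ := [Choice of subring_type by <:].
HB.instance Definition _ := [SubChoice_isSubComNzRing of subring_type by <:].
Let inj : {rmorphism subring_type -> K} := \val.

Lemma integral_overE z : integral_over A z <-> integralOver inj z.
Proof.
split=> [[p [mp Ap pz]]|[q mq qz]].
  have Aip i : in_A p`_i by apply/asboolP.
  pose q := \poly_(i < size p) (SubringType (Aip i)).
  have pq : map_poly inj q = p.
    apply/polyP => i; rewrite coef_map coef_poly; case: ltnP => // le_pi.
    by rewrite nth_default //; exact: (rmorph0 inj).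
  exists q; last by rewrite pq.
  rewrite monicE; apply/eqP/val_inj; rewrite rmorph1.
  by rewrite -(monicP mp) -pq (lead_coef_map_inj (f := inj)) //; exact: val_inj.
exists (map_poly inj q); split => //; first exact: monic_map.
by move=> i; rewrite coef_map; case: (q`_i) => /= w /asboolP.
Qed.

Lemma integral_closure_subring : subring (integral_over A).
Proof.
split.
- by apply/integral_overE; exact: integral1.
- move=> a b /integral_overE ? /integral_overE ?.
  by apply/integral_overE; exact: integral_sub.
- move=> a b /integral_overE ? /integral_overE ?.
  by apply/integral_overE; exact: integral_mul.
Qed.
End IntegralClosure.

(* If [sigma] maps [S_y] to [S_x] and [p_y] is the preimage of [p_x], it
   induces a homomorphism from the residue field at [y] to the one at [x]. *)
Section ResidueMap.
Variables (K : fieldType) (x y : spec_point K) (sigma : {rmorphism K -> K}).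
Hypothesis ring_xy : forall z, sp_ring y z -> sp_ring x (sigma z).
Hypothesis ideal_xy :
  forall z, sp_ring y z -> (sp_ideal y z <-> sp_ideal x (sigma z)).

Lemma in_local_map (z : localization y) : in_local x (sigma (local_val z)).
Proof.
have /asboolP [a [b [Sa Sb pb ->]]] := local_valP z.
apply/asboolP; exists (sigma a), (sigma b); split; rewrite ?fmorph_div //.
- exact: ring_xy.
- exact: ring_xy.
- by move/(ideal_xy Sb).
Qed.

Lemma in_maximal_map (z : localization y) :
  in_maximal y z -> in_maximal x (sigma (local_val z)).
Proof.
have [pS _ _ _ _] := sp_prime y.
move=> /asboolP [a [b [pa Sb pb ->]]].
apply/asboolP; exists (sigma a), (sigma b); split; rewrite ?fmorph_div //.
- by apply/(ideal_xy (pS _ pa)).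
- exact: ring_xy.
- by move/(ideal_xy Sb).
Qed.

Definition local_map (z : localization y) : localization x :=
  Local (in_local_map z).

Lemma local_mapB : {morph local_map : a b / a - b}.
Proof. by move=> a b; apply: val_inj; rewrite rmorphB /= !rmorphB. Qed.

Lemma local_mapM : {morph local_map : a b / a * b}.
Proof. by move=> a b; apply: val_inj; rewrite rmorphM /= !rmorphM. Qed.

Lemma local_map1 : local_map 1 = 1.
Proof. by apply: val_inj; rewrite rmorph1 /= rmorph1. Qed.

Definition residue_map (c : residue y) : residue x :=
  to_residue (local_map (repr c)).

Lemma residue_mapE (z : localization y) :
  residue_map (to_residue z) = to_residue (local_map z).
Proof.
apply/eqP; rewrite -subr_eq0 /residue_map.
rewrite {2}/to_residue -rmorphB -local_mapB to_residue_eq0.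
apply: in_maximal_map; rewrite -to_residue_eq0 /to_residue rmorphB subr_eq0.
apply/eqP; exact: (reprK (to_residue z)).
Qed.

Lemma residue_map_sub : zmod_morphism residue_map.
Proof.
move=> c d; rewrite -[c]reprK -[d]reprK -rmorphB !residue_mapE.
by rewrite local_mapB /to_residue rmorphB.
Qed.

Lemma residue_map_mul : monoid_morphism residue_map.
Proof.
split.
  rewrite -[1](rmorph1 (\pi_(residue y))) residue_mapE local_map1.
  by rewrite /to_residue rmorph1.
move=> c d; rewrite -[c]reprK -[d]reprK -rmorphM !residue_mapE.
by rewrite local_mapM /to_residue rmorphM.
Qed.

HB.instance Definition _ :=
  GRing.isZmodMorphism.Build (residue y) (residue x) residue_map
    residue_map_sub.
HB.instance Definition _ :=
  GRing.isMonoidMorphism.Build (residue y) (residue x) residue_map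
    residue_map_mul.
End ResidueMap.

(* A sheaf of commutative rings on a topological space.  [sections U] is only
   meaningful for open [U]; its values on other sets are never used. *)
Record ringed_space := RingedSpace {
  rs_space :> topologicalType;
  sections : set rs_space -> comPzRingType;
  restr : forall U V : set rs_space,
    U `<=` V -> {rmorphism sections V -> sections U};
  restr_id : forall (U : set rs_space) (UU : U `<=` U) (s : sections U),
    open U -> restr UU s = s;
  restr_comp : forall (U V W : set rs_space) (UV : U `<=` V) (VW : V `<=` W)
      (UW : U `<=` W) (s : sections W),
    open U -> open V -> open W -> restr UV (restr VW s) = restr UW s;
  sheaf_locality : forall (I : Type) (V : I -> set rs_space)
      (U : set rs_space) (VU : forall i, V i `<=` U) (s t : sections U),
    (forall i, open (V i)) -> U = \bigcup_i V i ->
    (forall i, restr (VU i) s = restr (VU i) t) -> s = t;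
  sheaf_gluing : forall (I : Type) (V : I -> set rs_space)
      (U : set rs_space) (VU : forall i, V i `<=` U)
      (s : forall i, sections (V i)),
    (forall i, open (V i)) -> U = \bigcup_i V i ->
    (forall i j, restr (@subIsetl _ (V i) (V j)) (s i) =
                 restr (@subIsetr _ (V i) (V j)) (s j)) ->
    exists t : sections U, forall i, restr (VU i) t = s i }.

Definition prime_ideal (A : comPzRingType) (p : set A) : Prop :=
  prime_ideal_of [set: A] p.

(* [r] exhibits [B] as the localization of [A] at the powers of [f]. *)
Definition is_localization_at (A B : comPzRingType) (r : {rmorphism A -> B})
    (f : A) : Prop :=
  [/\ exists g, r f * g = 1,
      forall b, exists n a, b * r f ^+ n = r a
    & forall a, r a = 0 -> exists n, f ^+ n * a = 0].

(* [(U, O|U)] is isomorphic to [Spec A] as a ringed space.  One may take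
   [A = O(U)]; the isomorphism is then given by a bijection [phi] from [U] to
   the prime ideals of [A] that is a homeomorphism (the sets [D(f)] form a
   basis of the topology of [U]) and under which [O(D(f))] is [A_f]. *)
Definition affine_open (X : ringed_space) (U : set X) : Prop :=
  open U /\
  exists phi : X -> set (sections U),
    let D f := [set x | U x /\ ~ phi x f] in
    [/\ forall x, U x -> prime_ideal (phi x),
        forall x y, U x -> U y -> phi x = phi y -> x = y,
        forall p, prime_ideal p -> exists2 x, U x & phi x = p,
        forall V, V `<=` U ->
          (open V <-> exists S : set (sections U), V = \bigcup_(f in S) D f)
      & forall f (DU : D f `<=` U), is_localization_at (restr DU) f].

Record scheme := Scheme {
  scheme_rs :> ringed_space;
  scheme_affine : forall x : scheme_rs, exists2 U, affine_open U & U x }.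

Definition integral_scheme (X : scheme) : Prop :=
  [set: X] !=set0 /\
  forall U : set X, open U -> U !=set0 ->
    (1 : sections U) <> 0 /\
    forall s t : sections U, s * t = 0 -> s = 0 \/ t = 0.

(* The element [\sum_i n_i (x) m_i] of the tensor product over Z vanishes iff
   every biadditive map kills it, by the universal property. *)
Definition tensor_eq0 (N M : zmodType) (s : seq (N * M)) : Prop :=
  forall (P : zmodType) (b : N -> M -> P),
    (forall m, zmod_morphism (b^~ m)) -> (forall n, zmod_morphism (b n)) ->
    \sum_(t <- s) b t.1 t.2 = 0.

Definition flat_over_Z (M : zmodType) : Prop :=
  forall (N N' : zmodType) (f : {additive N -> N'}), injective f ->
  forall s : seq (N * M),
    tensor_eq0 [seq (f t.1, t.2) | t <- s] -> tensor_eq0 s.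

Definition flat_scheme (X : scheme) : Prop :=
  forall U : set X, affine_open U -> flat_over_Z (sections U).

Definition finite_type_over_Z (A : pzRingType) : Prop :=
  exists s : seq A,
    forall S : set A, subring S -> {subset s <= S} -> S = [set: A].

Definition finite_type_scheme (X : scheme) : Prop :=
  exists (n : nat) (V : 'I_n -> set X),
    [/\ forall i, affine_open (V i), \bigcup_i V i = [set: X]
      & forall i, finite_type_over_Z (sections (V i))].

(* The function field: the colimit of [sections U] over the nonempty open
   [U], i.e. the stalk at the generic point. *)
Record function_field (X : scheme) := FunctionField {
  ff_sort :> fieldType;
  germ : forall U : set X, open U -> U !=set0 ->
    {rmorphism sections U -> ff_sort};
  germ_restr : forall (U V : set X) (oU : open U) (oV : open V)
      (nU : U !=set0) (nV : V !=set0) (UV : U `<=` V) (s : sections V),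
    germ oU nU (restr UV s) = germ oV nV s;
  germ_surj : forall f : ff_sort, exists (U : set X) (oU : open U)
    (nU : U !=set0) (s : sections U), f = germ oU nU s;
  germ_eq0 : forall (U : set X) (oU : open U) (nU : U !=set0) (s : sections U),
    germ oU nU s = 0 -> exists (V : set X) (VU : V `<=` U),
      [/\ open V, V !=set0 & restr VU s = 0] }.

Section FunctionField.
Variables (X : scheme) (K0 : function_field X).

(* [O_(X,x)] and its maximal ideal, inside the function field. *)
Definition local_ring (x : X) : set K0 :=
  [set f | exists (U : set X) (oU : open U) (nU : U !=set0) (s : sections U),
     U x /\ f = germ K0 oU nU s].

Definition local_ring_ideal (x : X) : set K0 :=
  [set f | local_ring x f /\ ~ exists2 g, local_ring x g & f * g = 1].

Definition normal_scheme : Prop :=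
  forall (x : X) (f : K0), integral_over (local_ring x) f -> local_ring x f.

(* The residue field at [x] has characteristic [p] iff [p] lies in the maximal
   ideal of the local ring at [x]. *)
Definition residue_characteristics : set nat :=
  [set p | prime p /\ exists x, local_ring_ideal x p%:R].

Lemma local_ring_subring x : subring (local_ring x).
Proof.
have nX : [set: X] !=set0 by exists x.
have H (op : K0 -> K0 -> K0)
    (o : forall U, sections U -> sections U -> sections U) :
    (forall (U : set X) (oU : open U) (nU : U !=set0) s t,
      germ K0 oU nU (o U s t) = op (germ K0 oU nU s) (germ K0 oU nU t)) ->
    forall a b, local_ring x a -> local_ring x b -> local_ring x (op a b).
  move=> go a b [U [oU [nU [s [Ux ->]]]]] [V [oV [nV [t [Vx ->]]]]].
  have oW := openI oU oV; have nW : (U `&` V) !=set0 by exists x.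
  exists (U `&` V), oW, nW,
    (o _ (restr (@subIsetl _ U V) s) (restr (@subIsetr _ U V) t)).
  by rewrite go !(germ_restr K0 oW _ nW).
split.
- by exists setT, openT, nX, 1; rewrite rmorph1.
- apply: (H _ (fun U s t => s - t)) => *; exact: rmorphB.
- apply: (H _ (fun U s t => s * t)) => *; exact: rmorphM.
Qed.

End FunctionField.
Arguments local_ring {X} K0 x.
Arguments local_ring_ideal {X} K0 x.

Section Normalization.
Variables (X : scheme) (K0 : function_field X).
Variables (K : fieldType) (iota : {rmorphism K0 -> K}).

(* The normalization of [X] in [K] is the relative spectrum over [X] of the
   integral closure of [O_X] in the constant sheaf [K]: over an affine open [U]
   it is [Spec] of [normalization_ring U], the integral closure of [O(U)] in
   [K].  The stalk at [x] of this sheaf of algebras is [normalization_stalk x],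
   the integral closure of [O_(X,x)] in [K], so the points above [x] are the
   primes of [normalization_stalk x] lying over the maximal ideal of
   [O_(X,x)]. *)
Definition normalization_ring (U : set X) : set K :=
  integral_over [set z | exists (oU : open U) (nU : U !=set0) (s : sections U),
    z = iota (germ K0 oU nU s)].

Definition normalization_stalk (x : X) : set K :=
  integral_over (iota @` local_ring K0 x).

Record point := Point {
  base : X;
  pt_ideal : set K;
  pt_prime : prime_ideal_of (normalization_stalk base) pt_ideal;
  pt_over : forall f, local_ring K0 base f ->
    (pt_ideal (iota f) <-> local_ring_ideal K0 base f) }.

Lemma normalization_stalk_subring x : subring (normalization_stalk x).
Proof.
apply: integral_closure_subring; have [L1 LB LM] := local_ring_subring K0 x.
split; first by exists 1; rewrite ?rmorph1.
- move=> _ _ [a Oa <-] [b Ob <-].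
  by exists (a - b); [exact: LB | rewrite rmorphB].
- move=> _ _ [a Oa <-] [b Ob <-].
  by exists (a * b); [exact: LM | rewrite rmorphM].
Qed.

Definition spec_pt (x : point) : spec_point K :=
  SpecPoint (@normalization_stalk_subring (base x)) (pt_prime x).

Definition kappa (x : point) : fieldType := residue (spec_pt x).

Record galois_group := GaloisAut {
  gal :> {rmorphism K -> K};
  gal_bij : bijective gal;
  gal_fix : forall a, gal (iota a) = iota a }.

(* [sigma] acts on the points by [m |-> sigma^-1(m)]; this is a right action,
   and [sigma] induces an isomorphism from the residue field at [x^sigma] to
   the one at [x]. *)
Section Action.
Variables (sigma : galois_group) (x : point).

Lemma normalization_stalk_gal (y : X) z :
  normalization_stalk y z -> normalization_stalk y (sigma z).
Proof.
move=> [p [mp Ap pz]]; exists p; split => //.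
suff e : map_poly sigma p = p by rewrite -e fmorph_root.
by apply/polyP => i; rewrite coef_map; have [a _ <-] := Ap i; exact: gal_fix.
Qed.

Definition act_ideal : set K :=
  normalization_stalk (base x) `&` [set z | pt_ideal x (sigma z)].

Lemma act_ideal_prime :
  prime_ideal_of (normalization_stalk (base x)) act_ideal.
Proof.
have [A1 AB AM] := @normalization_stalk_subring (base x).
have A0 : normalization_stalk (base x) 0 by rewrite -(subrr 1); exact: AB.
have AD a b :
    normalization_stalk (base x) a -> normalization_stalk (base x) b ->
    normalization_stalk (base x) (a + b).
  move=> ? ?; rewrite -[b]opprK; apply: (AB _ _) => //.
  by rewrite -sub0r; exact: AB.
have [pS p0 pD pM [np1 pr]] := pt_prime x.
split.
- by move=> z [].
- by split => //=; rewrite rmorph0.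
- move=> a b [Aa pa] [Ab pb]; split; first exact: AD.
  by rewrite /= rmorphD; exact: pD.
- move=> a b Aa [Ab pb]; split; [exact: AM | rewrite /= rmorphM].
  by apply: pM => //; exact: normalization_stalk_gal.
- split; first by move=> [_] /=; rewrite rmorph1.
  move=> a b Aa Ab [_ /=]; rewrite rmorphM.
  by case/(pr _ _ (normalization_stalk_gal Aa) (normalization_stalk_gal Ab));
    [left|right].
Qed.

Lemma act_ideal_over f : local_ring K0 (base x) f ->
  (act_ideal (iota f) <-> local_ring_ideal K0 (base x) f).
Proof.
move=> Of; rewrite -(pt_over Of) /act_ideal /= (gal_fix sigma f).
split=> [[]//|pf].
by have [pS _ _ _ _] := pt_prime x; split => //; exact: pS.
Qed.

Definition act_point : point := Point act_ideal_prime act_ideal_over.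

Lemma act_ring z :
  sp_ring (spec_pt act_point) z -> sp_ring (spec_pt x) (sigma z).
Proof. exact: normalization_stalk_gal. Qed.

Lemma act_idealE z : sp_ring (spec_pt act_point) z ->
  (sp_ideal (spec_pt act_point) z <-> sp_ideal (spec_pt x) (sigma z)).
Proof. by move=> Az; split => [[]|]. Qed.

Definition act_kappa : {rmorphism kappa act_point -> kappa x} :=
  residue_map act_ring act_idealE.
End Action.
End Normalization.

(* A homomorphism [k^* -> C^*] is represented by its extension by
   [0 |-> 0] to a multiplicative map [k -> C]. *)
Record character (C k : fieldType) := Character {
  char_val :> k -> C;
  char_eq0 : forall a, char_val a = 0 <-> a = 0;
  char1 : char_val 1 = 1;
  charM : forall a b, char_val (a * b) = char_val a * char_val b }.

Section Characters.
Variable C : fieldType.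

Section Comp.
Variables (k k' : fieldType) (chi : character C k) (tau : {rmorphism k' -> k}).

Fact char_comp_eq0 a : chi (tau a) = 0 <-> a = 0.
Proof.
by split=> [/char_eq0 /eqP|->]; rewrite ?fmorph_eq0 ?rmorph0;
  [move/eqP | exact/char_eq0].
Qed.

Fact char_comp1 : chi (tau 1) = 1.
Proof. by rewrite rmorph1 char1. Qed.

Fact char_compM a b : chi (tau (a * b)) = chi (tau a) * chi (tau b).
Proof. by rewrite rmorphM charM. Qed.

Definition char_comp : character C k' :=
  Character char_comp_eq0 char_comp1 char_compM.
End Comp.

(* [chi \o (fun a => a ^ nu)] on [k^*]. *)
Section Pow.
Variables (k : fieldType) (chi : character C k) (nu : nat).

Let pow (a : k) : C := if a == 0 then 0 else chi (a ^+ nu).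

Fact char_pow_eq0 a : pow a = 0 <-> a = 0.
Proof.
rewrite /pow; case: eqP => // a0; split => // /char_eq0 /eqP.
by rewrite expf_eq0 => /andP[_ /eqP].
Qed.

Fact char_pow1 : pow 1 = 1.
Proof. by rewrite /pow oner_eq0 expr1n char1. Qed.

Fact char_powM a b : pow (a * b) = pow a * pow b.
Proof.
rewrite /pow mulf_eq0; case: eqP => /= a0; first by rewrite mul0r.
by case: eqP => /= b0; rewrite ?mulr0 // exprMn charM.
Qed.

Definition char_pow : character C k :=
  Character char_pow_eq0 char_pow1 char_powM.
End Pow.

End Characters.

Inductive generated_monoid (S : set nat) : set nat :=
| gen_one : generated_monoid S 1
| gen_mul p n : S p -> generated_monoid S n -> generated_monoid S (p * n)%N.

Definition char_ker (C k : fieldType) (chi : character C k) : set k :=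
  [set a | chi a = 1].

Definition torsion (k : fieldType) : set k :=
  [set a | exists n, (0 < n)%N /\ a ^+ n = 1].
Arguments torsion : clear implicits.

Definition has_order_in (N0 : set nat) (T : Type) (A : set T) : Prop :=
  exists2 n, N0 n & (A #= `I_n)%card.

(* A class is a predicate on the characters of all fields; [class_closed]
   restricts it to characters of algebraically closed fields. *)
Record admissible_class (C : fieldType) (N0 : set nat) := AdmissibleClass {
  char_class :> forall k : fieldType, character C k -> Prop;
  class_closed : forall (k : fieldType) (chi : character C k),
    char_class chi -> GRing.closed_field_axiom k;
  class_iso : forall (k k' : fieldType) (tau : {rmorphism k' -> k})
      (chi : character C k), bijective tau ->
    (char_class chi <-> char_class (char_comp chi tau));
  class_pow : forall (k : fieldType) (chi : character C k) (nu : nat),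
    N0 nu -> (char_class chi <-> char_class (char_pow chi nu));
  class_torsion : forall (k : fieldType) (chi : character C k),
    char_class chi -> has_order_in N0 (char_ker chi `&` torsion k) }.

Definition finite_kernel_class (C : fieldType) (N0 : set nat) (k : fieldType)
    (chi : character C k) : Prop :=
  GRing.closed_field_axiom k /\ has_order_in N0 (char_ker chi).

(* The quotient by the equivalence relation generated by [r], with the quotient
   topology. *)
Section Quotient.
Variables (T : topologicalType) (r : T -> T -> Prop).

Definition generated_eq : rel T :=
  fun a b => `[< clos_refl_sym_trans T r a b >].

Lemma generated_eq_equiv : equiv_class_of generated_eq.
Proof.
split=> [a|a b|b a c].
- by apply/asboolP; exact: rst_refl.
- by apply/asboolP/asboolP; exact: rst_sym.
- by move=> /asboolP ab /asboolP bc; apply/asboolP; exact: rst_trans bc.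
Qed.

Canonical generated_equiv := EquivRelPack generated_eq_equiv.
Canonical generated_encModRel := defaultEncModRel generated_eq.

Definition quotient_space : topologicalType :=
  quotient_topology {eq_quot generated_eq}.

Definition to_quotient (a : T) : quotient_space := \pi_{eq_quot generated_eq} a.
Definition of_quotient (m : quotient_space) : T :=
  repr (m : {eq_quot generated_eq}).

Lemma of_quotientK m : to_quotient (of_quotient m) = m.
Proof. exact: reprK. Qed.

Lemma to_quotient_eq a b :
  to_quotient a = to_quotient b <-> clos_refl_sym_trans T r a b.
Proof.
split.
  by move/eqmodP/asboolP.
by move=> h; apply/eqmodP/asboolP.
Qed.
End Quotient.

(* The map induced by [f]; meaningful when [quotient_mapE] applies. *)
Section QuotientMap.
Variables (S T : topologicalType) (r : S -> S -> Prop) (q : T -> T -> Prop).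
Definition quotient_map (f : S -> T) (m : quotient_space r) :
    quotient_space q :=
  to_quotient q (f (of_quotient m)).

Lemma quotient_mapE (f : S -> T) : (forall a b, r a b -> q (f a) (f b)) ->
  forall a, quotient_map f (to_quotient r a) = to_quotient q (f a).
Proof.
move=> fr a; apply/to_quotient_eq.
have: clos_refl_sym_trans S r (of_quotient (to_quotient r a)) a.
  by apply/to_quotient_eq; rewrite of_quotientK.
move: (of_quotient _) => b; elim=> [x y rxy|x|x y _ IH|x y z _ xy _ yz].
- by apply: rst_step; exact: fr.
- exact: rst_refl.
- exact: rst_sym.
- exact: rst_trans xy yz.
Qed.
End QuotientMap.

Section Characters.
Variables (X : scheme) (K0 : function_field X).
Variables (K : fieldType) (iota : {rmorphism K0 -> K}).
Variable C : numClosedFieldType.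

Record dotX := DotX {
  dot_pt : point iota;
  dot_char : character C (kappa dot_pt) }.

HB.instance Definition _ := gen_eqMixin dotX.
HB.instance Definition _ := gen_choiceMixin dotX.

Definition dot_frob (nu : nat) (d : dotX) : dotX :=
  DotX (char_pow (dot_char d) nu).

Definition dot_act (sigma : galois_group iota) (d : dotX) : dotX :=
  DotX (char_comp (dot_char d) (act_kappa sigma (dot_pt d))).

Definition dot_over (U : set X) : set dotX := [set d | U (base (dot_pt d))].

(* [P(r) = chi(r mod p)] for [r] outside the prime [p], and [P(r) = 0] for [r]
   in [p] since characters are extended by zero. *)
Definition dot_eval (U : set X) (d : dot_over U) :
    {ptws normalization_ring iota U -> C} :=
  fun r => let x := set_val d in
    dot_char x (reduce (spec_pt (dot_pt x)) (set_val r)).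

(* The preimage of every affine open [U] has the topology of pointwise
   convergence of the maps [P] on [normalization_ring U]. *)
Definition dot_open : set_system dotX := [set O | forall U, affine_open U ->
  open (set_val @^-1` O : set (initial_topology (@dot_eval U)))].

Lemma dot_openT : dot_open setT.
Proof. by move=> U _; rewrite preimage_setT; exact: openT. Qed.

Lemma dot_openI : setI_closed dot_open.
Proof.
move=> P Q oP oQ U aU; rewrite preimage_setI.
by apply: openI; [exact: oP | exact: oQ].
Qed.

Lemma dot_open_bigU (I : Type) (O : I -> set dotX) :
  (forall i, dot_open (O i)) -> dot_open (\bigcup_i O i).
Proof.
move=> oO U aU; rewrite preimage_bigcup.
by apply: bigcup_open => i _; exact: oO.
Qed.

HB.instance Definition _ :=
  isOpenTopological.Build dotX dot_openT dot_openI dot_open_bigU.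

Variable charN0 : set nat.
Let N0 := generated_monoid charN0.

(* The inductive limit, as a quotient of the disjoint union of copies of
   [dotX]; its quotient topology is the inductive limit topology. *)
Definition dot_sum : topologicalType := {nu : N0 & (fun=> dotX) nu}.

Definition colim_rel (s t : dot_sum) : Prop :=
  exists2 mu, N0 mu &
    set_val (projT1 t) = (set_val (projT1 s) * mu)%N /\
    projT2 t = dot_frob mu (projT2 s).

Definition checkX : topologicalType := quotient_space colim_rel.

Definition sum_map (f : dotX -> dotX) (s : dot_sum) : dot_sum :=
  existT _ (projT1 s) (f (projT2 s)).

Definition check_frob (nu : nat) : checkX -> checkX :=
  quotient_map colim_rel (sum_map (dot_frob nu)).

Definition check_act (sigma : galois_group iota) : checkX -> checkX :=
  quotient_map colim_rel (sum_map (dot_act sigma)).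

Lemma char_ext (k : fieldType) (chi psi : character C k) :
  chi =1 psi -> chi = psi.
Proof.
case: chi psi => [f f0 f1 fM] [g g0 g1 gM] /= /funext e; subst g.
by congr Character; exact: Prop_irrelevance.
Qed.

Lemma char_powC (k : fieldType) (chi : character C k) m n :
  char_pow (char_pow chi m) n = char_pow (char_pow chi n) m.
Proof.
apply: char_ext => a /=; rewrite /char_pow /=; case: eqP => // a0.
by rewrite !expf_eq0 (introF eqP a0) !andbF -!exprM mulnC.
Qed.

Lemma check_frobE nu (s : dot_sum) :
  check_frob nu (to_quotient colim_rel s) =
  to_quotient colim_rel (sum_map (dot_frob nu) s).
Proof.
apply: quotient_mapE => a b [mu mu0 [ab1 ab2]]; exists mu => //; split => //=.
by rewrite ab2 /dot_frob /= char_powC.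
Qed.

Lemma dot_actC sigma nu (d : dotX) :
  dot_act sigma (dot_frob nu d) = dot_frob nu (dot_act sigma d).
Proof.
rewrite /dot_act /dot_frob /=; congr DotX; apply: char_ext => a /=.
by rewrite fmorph_eq0 rmorphXn.
Qed.

Lemma check_actE sigma (s : dot_sum) :
  check_act sigma (to_quotient colim_rel s) =
  to_quotient colim_rel (sum_map (dot_act sigma) s).
Proof.
apply: quotient_mapE => a b [mu mu0 [ab1 ab2]]; exists mu => //; split => //=.
by rewrite ab2 dot_actC.
Qed.

Lemma check_frob_act nu sigma m :
  check_frob nu (check_act sigma m) = check_act sigma (check_frob nu m).
Proof.
rewrite -(of_quotientK m) check_actE !check_frobE check_actE.
by congr to_quotient; rewrite /sum_map /= dot_actC.
Qed.

Variable E : admissible_class C N0.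

(* The image of the inductive limit of the pairs whose character is in [E]. *)
Definition checkX_class : set checkX :=
  [set m | exists2 s : dot_sum, E _ (dot_char (projT2 s))
           & m = to_quotient colim_rel s].

Definition checkXE : topologicalType := checkX_class.

Lemma check_frob_class (nu : N0) (m : checkXE) :
  checkX_class (check_frob (set_val nu) (set_val m)).
Proof.
have [s Es em] : checkX_class (set_val m) by exact: set_valP.
rewrite em check_frobE.
exists (sum_map (dot_frob (set_val nu)) s) => //=.
exact: (class_pow E _ (set_valP nu)).1.
Qed.

Definition checkXE_frob (nu : N0) (m : checkXE) : checkXE :=
  SigSub (mem_set (check_frob_class nu m)).

Definition gal_rel (m m' : checkXE) : Prop :=
  exists sigma : galois_group iota, set_val m' = check_act sigma (set_val m).

Definition checkX0E : topologicalType := quotient_space gal_rel.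

Definition checkX0E_frob (nu : N0) : checkX0E -> checkX0E :=
  quotient_map gal_rel (checkXE_frob nu).

Lemma checkX0E_frobE nu (m : checkXE) :
  checkX0E_frob nu (to_quotient gal_rel m) =
  to_quotient gal_rel (checkXE_frob nu m).
Proof.
apply: quotient_mapE => a b [sigma e]; exists sigma.
exact: etrans (congr1 (check_frob _) e) (check_frob_act _ _ _).
Qed.

End Characters.

Arguments checkXE_frob {X K0 K} iota {C charN0} E nu m.
Arguments checkX0E_frob {X K0 K} iota {C charN0} E nu m.

Section Suspension.
Variables (R : realType) (charN0 : set nat).
Let N0 := generated_monoid charN0.
Variables (M : topologicalType) (F : N0 -> M -> M).

Definition positive_reals : topologicalType := [set u : R | 0 < u].

(* [F_q = F_nu \o F_mu^-1] for [q = nu / mu]: the orbit relation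
   [(m, u) ~ (F_q m, q^-1 u)] of the group of positive rationals generated by
   [N0]. *)
Definition suspension_rel (a b : M * positive_reals) : Prop :=
  exists nu mu : N0,
    F mu b.1 = F nu a.1 /\
    set_val b.2 = ((set_val nu)%:R / (set_val mu)%:R)^-1 * set_val a.2.

Definition suspension : topologicalType := quotient_space suspension_rel.
End Suspension.

(* Main.v *)
(* Since each line [m x R^{>0}] is connected, a clopen subset of either space is
   given by a locally constant, Frobenius invariant function [g] on the points
   [(x, chi)] with [chi] in the class.  Let [mu] be the group of roots of unity
   of [K].  Injective characters of [K^*] sit at the generic point, and two of
   them with the same restriction to [mu] are joined, up to an arbitrarily small
   error, by a path [chi exp (t L)] of injective characters; hence [g] depends on
   an injective [chi] only through its restriction to [mu], and continuously so.
   Every point is, up to Frobenius, a limit of Frobenius powers [F_(q^e)] of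
   injective generic characters, [q] being the characteristic exponent of its
   residue field, and the limit remembers only the prime-to-[q] part of [mu].
   Comparing a point of residue characteristic [p] with its image under [F_p],
   one may therefore replace [chi] on the prime-to-[p] part of [mu] by its
   [p]-th power without changing [g].  All but finitely many primes are residue
   characteristics, so this carries any injective character of [mu] arbitrarily
   close to any other one, and [g] is constant. *)
Require Import Defs.
From HB Require Import structures.
From mathcomp Require Import all_boot all_order all_algebra.
From mathcomp Require Import all_classical all_reals all_analysis.
From mathcomp Require Import ring lra.
From mathcomp Require Import cyclic separable cyclotomic.
From mathcomp.real_closed Require Import complex.
From Stdlib Require Import Relation_Operators.

Set Implicit Arguments.
Unset Strict Implicit.
Unset Printing Implicit Defensive.
Import numFieldNormedType.Exports.
Import Order.TTheory GRing.Theory Num.Theory.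
Local Open Scope classical_set_scope.
Local Open Scope ring_scope.
Local Notation Re := complex.Re.
Local Notation Im := complex.Im.

(** * Extending homomorphisms to divisible groups *)

(** What is known about [E] is its invariance and that it contains characters with finite kernel, so
    new characters are made injective in order to lie in [E]. This shapes every construction. Zorn's
    lemma and divisibility prescribe a character on roots of unity and make it injective there; a
    generic twist by an exponential makes it injective everywhere. The twist has to avoid countably
    many real conditions, which is where the countability of [K] enters. Since the topology is that
    of pointwise convergence, only finitely many elements need control at a time. At a special point
    the difficulty is to push elements of the maximal ideal towards 0 while units keep their values.
    Gordan's alternative supplies a substitute for a valuation: a rational homomorphism, trivial on
    units and positive on finitely many given elements of the ideal. The Frobenius exponents are
    [q ^ n!] because these become 1 modulo every [N] prime to [q]. On [N]-th roots of unity two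
    injective characters differ by an exponent prime to [N]. Once the exceptional primes divide [N],
    the prime factors of this exponent are residue characteristics. *)

Section PartialHom.
Variables (k F : fieldType).

Definition mul_subgroup (D : set F) : Prop :=
  [/\ D 1, forall a b, D a -> D b -> D (a / b) & forall a, D a -> a != 0].

Definition mul_divisible (D : set F) : Prop :=
  forall b n, D b -> (0 < n)%N -> exists2 c, D c & c ^+ n = b.

(* The graph of a homomorphism from a subgroup of [k^*] to [F^*]. *)
Definition partial_hom (G : set (k * F)) : Prop :=
  [/\ G (1, 1), forall x y, G x -> G y -> G (x.1 / y.1, x.2 / y.2),
      forall x, G x -> x.1 != 0 /\ x.2 != 0
    & forall b, G (1, b) -> b = 1].

Definition hom_adjoin (G : set (k * F)) (a : k) (b : F) : set (k * F) :=
  [set y | exists x (z : int), G x /\ y = (x.1 * a ^ z, x.2 * b ^ z)].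

Lemma hom_adjoin_sub G a b : G `<=` hom_adjoin G a b.
Proof. by move=> [x1 x2] Gx; exists (x1, x2), 0; rewrite !expr0z !mulr1. Qed.

Lemma hom_adjoin_mem G a b : G (1, 1) -> hom_adjoin G a b (a, b).
Proof. by move=> G1; exists (1, 1), 1; rewrite !expr1z !mul1r. Qed.

Section Graph.
Variables (G : set (k * F)) (hG : partial_hom G).

Lemma partial_homV x : G x -> G (x.1^-1, x.2^-1).
Proof.
by move=> Gx; have [G1 GB _ _] := hG; have := GB _ _ G1 Gx; rewrite !div1r.
Qed.

Lemma partial_homM x y : G x -> G y -> G (x.1 * y.1, x.2 * y.2).
Proof.
move=> Gx Gy; have [_ GB _ _] := hG.
by have := GB _ _ Gx (partial_homV Gy); rewrite /= !invrK.
Qed.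

Lemma partial_homX x (z : int) : G x -> G (x.1 ^ z, x.2 ^ z).
Proof.
move=> Gx; have HN n : G (x.1 ^+ n, x.2 ^+ n).
  elim: n => [|n IH]; first by rewrite !expr0; case: hG.
  by rewrite !exprS; exact: (partial_homM Gx IH).
case: z => n; first exact: HN.
by rewrite NegzE -!invr_expz; exact: (partial_homV (HN _)).
Qed.

Lemma partial_hom_fun a b c : G (a, b) -> G (a, c) -> b = c.
Proof.
move=> Gb Gc; have [_ GB G0 Gf] := hG.
have [/= a0 _] := G0 _ Gb; have [/= _ c0] := G0 _ Gc.
have /= := GB _ _ Gb Gc; rewrite divff // => /Gf bc.
by rewrite -[b](divfK c0) bc mul1r.
Qed.

(** Adjoining [a] can destroy single-valuedness only at powers of [a] already in the domain, and
    there the hypothesis makes [b] compatible with [G]. *)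
Lemma partial_hom_adjoin a b : a != 0 -> b != 0 ->
  (forall (z : int) w, G (a ^ z, w) -> w = b ^ z) ->
  partial_hom (hom_adjoin G a b).
Proof.
move=> a0 b0 ab; have [G1 GB G0 Gf] := hG; split.
- exact: hom_adjoin_sub.
- move=> _ _ [x [z [Gx ->]]] [y [t [Gy ->]]] /=.
  exists (x.1 / y.1, x.2 / y.2), (z - t); split; first exact: GB.
  by congr pair; rewrite expfzDr // -invr_expz invfM mulrACA.
- by move=> _ [x [z [Gx ->]]] /=; have [? ?] := G0 _ Gx;
    rewrite !mulf_neq0 // expfz_neq0.
- move=> c [x [z [Gx [/esym ex ->]]]]; have [x10 x20] := G0 _ Gx.
  have xz : x.1 = a ^ (- z).
    by rewrite -invr_expz -[x.1](mulfK (expfz_neq0 z a0)) ex div1r.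
  have := ab (- z) x.2; rewrite -xz -surjective_pairing => /(_ Gx) ->.
  by rewrite -invr_expz mulVf // expfz_neq0.
Qed.

End Graph.

(** Zorn's lemma is applied to the property [Q] of the union of [A] and [G0]. The empty chain then
    gives [G0] itself, so only nonempty chains above [G0] have to be bounded. *)
Lemma zorn_above (T : Type) (Q : set (set T)) (G0 : set T) : Q G0 ->
  (forall H : set (set T), H !=set0 -> H `<=` Q -> (forall A, H A -> G0 `<=` A) ->
     total_on H subset -> Q (\bigcup_(A in H) A)) ->
  exists A, [/\ Q A, G0 `<=` A & forall B, A `<=` B -> Q B -> B `<=` A].
Proof.
move=> QG0 Qchain.
have [H HQ Ht|A [QA Amax]] := @Zorn_bigcup T [set A | Q (A `|` G0)].
  have [->|/set0P [B HB]] := eqVneq H set0.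
    by rewrite /mkset bigcup_set0 set0U; exact: QG0.
  have -> : [set A | Q (A `|` G0)] (\bigcup_(X in H) X) =
      Q (\bigcup_(X in [set A `|` G0 | A in H]) X).
    congr Q; apply/seteqP; split=> x.
      case=> [[A HA Ax]|Gx].
        by exists (A `|` G0); [exists A | left].
      by exists (B `|` G0); [exists B | right].
    by case=> _ [A HA <-] [Ax|Gx]; [left; exists A | right].
  apply: Qchain.
  - by exists (B `|` G0), B.
  - by move=> _ [A HA <-]; exact: HQ.
  - by move=> _ [A HA <-] x; right.
  - move=> _ _ [A HA <-] [C HC <-]; have [AC|CA] := Ht _ _ HA HC.
      by left; exact: setSU.
    by right; exact: setSU.
exists (A `|` G0); split => // B AB QB; have e : B `|` G0 = B.
  by apply/seteqP; split=> x; [case=> // Gx; apply: AB; right | left].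
have [sBA x Bx|nBA] := pselect (B `<=` A); first by left; exact: sBA.
have : A `<` B.
  by split=> //; move=> x Ax; apply: AB; left.
by move/Amax; rewrite /mkset e.
Qed.

Lemma partial_hom_bigcup (H : set (set (k * F))) : H !=set0 ->
  H `<=` partial_hom -> total_on H subset -> partial_hom (\bigcup_(A in H) A).
Proof.
move=> [B HB] Hp Ht; split.
- by exists B => //; have [] := Hp _ HB.
- move=> x y [A HA Ax] [C HC Cy]; have [AC|CA] := Ht _ _ HA HC.
    by exists C => //; have [_ GB _ _] := Hp _ HC; apply: GB => //; exact: AC.
  by exists A => //; have [_ GB _ _] := Hp _ HA; apply: GB => //; exact: CA.
- by move=> x [A HA Ax]; have [_ _ G0 _] := Hp _ HA; exact: G0.
- by move=> b [A HA Ab]; have [_ _ _ G1] := Hp _ HA; exact: G1.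
Qed.

Lemma mul_subgroupX (D : set F) b (z : int) : mul_subgroup D -> D b -> D (b ^ z).
Proof.
move=> [D1 DB D0] Db.
have DV c : D c -> D c^-1 by move=> Dc; rewrite -div1r; exact: DB.
have HN n : D (b ^+ n).
  elim: n => [//|n IH]; rewrite exprS -[b ^+ n]invrK.
  by apply: (DB _ _) => //; exact: DV.
case: z => n; first exact: HN.
by rewrite NegzE -invr_expz; exact: (DV _ (HN _)).
Qed.

(* Divisible groups are injective (Baer). *)
Lemma partial_hom_extend (D : set F) (G : set (k * F)) :
  mul_subgroup D -> mul_divisible D -> partial_hom G ->
  (forall x, G x -> D x.2) ->
  exists f : k -> F, [/\ forall a, a != 0 -> D (f a), f 1 = 1,
    forall a b, a != 0 -> b != 0 -> f (a * b) = f a * f b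
    & forall x, G x -> f x.1 = x.2].
Proof.
move=> sD dD hG GD; have [D1 DB D0] := sD.
have DM a b : D a -> D b -> D (a * b).
  by move=> Da Db; rewrite -[b]invrK -[b^-1]div1r; apply: (DB _ _ Da); exact: DB.
pose Q A := partial_hom A /\ forall x, A x -> D x.2.
have [|H H0 HQ _ Ht|A [[hA AD] GA Amax]] := @zorn_above _ Q G.
- by split.
- split; first by apply: partial_hom_bigcup => // B /HQ [].
  by move=> x [B HB Bx]; have [_] := HQ _ HB; exact.
have [A1 AB A0 Af] := hA.
have dom a : a != 0 -> exists b, A (a, b).
  move=> a0; suff [b [Db bP]] : exists b, D b /\
      forall (z : int) w, A (a ^ z, w) -> w = b ^ z.
    exists b; apply: (Amax (hom_adjoin A a b)).
    - exact: hom_adjoin_sub.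
    - split; first by apply: partial_hom_adjoin => //; exact: D0.
      move=> _ [x [z [Ax ->]]] /=.
      by apply: DM; [exact: AD | exact: mul_subgroupX].
    - exact: hom_adjoin_mem.
  pose P n := (0 < n)%N && `[< exists w, A (a ^+ n, w) >].
  have nonzero (z : int) w : z != 0 -> A (a ^ z, w) -> P `|z|%N.
    move=> z0 Az; rewrite /P absz_gt0 z0; apply/asboolP.
    case: (intP z) z0 Az => [//|n|n] _ Az; first by exists w.
    by exists w^-1; rewrite abszN /= -[a ^+ _]invrK; exact: (partial_homV hA Az).
  (* If no positive power of [a] lies in the domain, any value is allowed and 1 is taken. Otherwise
     the powers in the domain are those of [a ^ m] with [m] minimal, and [b] is an [m]-th root of
     the value there. *)
  have [[n Pn]|noP] := pselect (exists n, P n); last first.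
    exists 1; split=> // z w Az; rewrite exp1rz.
    have [z0|z0] := eqVneq z 0; first by move: Az; rewrite z0 expr0z; exact: Af.
    by case: noP; exists `|z|%N; exact: nonzero Az.
  have [m /andP[m0 /asboolP[v Av]] mmin] := ex_minnP (ex_intro _ n Pn).
  have [b Db bm] := dD v m (AD _ Av) m0.
  exists b; split=> // z w Az.
  have zE : z = (z %/ m)%Z * m + (z %% m)%Z := divz_eq z m.
  have rE : (z %% m)%Z = z + m%:Z * - (z %/ m)%Z by rewrite {2}zE mulrN mulrC addrAC subrr add0r.
  have Ar : A (a ^ (z %% m)%Z, w / v ^ (z %/ m)%Z).
    rewrite rE expfzDr // -exprz_exp -invr_expz.
    exact: (AB (a ^ z, w) _ Az (partial_homX hA (z %/ m)%Z Av)).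
  have r0 : (z %% m)%Z = 0.
    apply/eqP; apply: contraT => r0; have := mmin _ (nonzero _ _ r0 Ar).
    have := ltz_mod z (lt0n_neq0 m0 : m%:Z != 0).
    have := modz_ge0 z (lt0n_neq0 m0 : m%:Z != 0).
    by case: (z %% m)%Z => // r _; rewrite absz_nat ltz_nat ltnNge => /negbTE ->.
  move: Ar; rewrite r0 expr0z => /Af /divr1_eq ->.
  by rewrite [in RHS]zE r0 addr0 mulrC -exprz_exp -bm.
pose f a := if pselect (a != 0) is left a0 then projT1 (cid (dom a a0)) else 1.
have fP a : a != 0 -> A (a, f a).
  by move=> a0; rewrite /f; case: pselect => // h; case: cid.
exists f; split.
- by move=> a a0; exact: (AD _ (fP a a0)).
- by apply: Af; apply: fP; rewrite oner_neq0.
- move=> a b a0 b0; apply: (partial_hom_fun hA (fP _ (mulf_neq0 a0 b0))).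
  exact: (partial_homM hA (fP _ a0) (fP _ b0)).
- move=> x Gx; have [x10 _] := A0 _ (GA _ Gx).
  apply: (partial_hom_fun hA (fP _ x10)).
  by rewrite -surjective_pairing; exact: GA.
Qed.

End PartialHom.

(** * Characters and roots of unity *)

Lemma closed_prim_root_exists (F : closedFieldType) (n : nat) :
  n%:R != 0 :> F -> exists z : F, n.-primitive_root z.
Proof.
move=> nF; have n_gt0 : (0 < n)%N by case: n nF => //; rewrite eqxx.
pose p : {poly F} := 'X^n - 1; have [r Dp] := closed_field_poly_normal p.
rewrite (monicP _) ?monicXnsubC // scale1r in Dp.
have rn1 : all n.-unity_root r by apply/allP=> z; rewrite -root_prod_XsubC -Dp.
have sz_r : (n < (size r).+1)%N.
  by rewrite -(size_prod_XsubC r id) -Dp size_XnsubC.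
have [|z] := hasP (has_prim_root n_gt0 rn1 _ sz_r); last by exists z.
by rewrite -separable_prod_XsubC -Dp separable_Xn_sub_1.
Qed.

Lemma prime_primitive_root (F : fieldType) (l : nat) (a : F) :
  prime l -> a ^+ l = 1 -> a != 1 -> l.-primitive_root a.
Proof.
move=> l_pr al a1; have [m pm /(primeP l_pr).2 /orP[/eqP m1|/eqP <- //]] :=
  prim_order_exists (prime_gt0 l_pr) al.
by move: (prim_expr_order pm) a1; rewrite m1 expr1 => ->; rewrite eqxx.
Qed.

(** A nontrivial root of unity has a power of exact prime order. Used with [N] the kernel of a
    character. *)
Lemma torsion_subgroup_trivial (k : fieldType) (N : set k) :
  (forall a n, N a -> N (a ^+ n)) ->
  (forall l a, prime l -> a ^+ l = 1 -> N a -> a = 1) ->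
  forall a, torsion k a -> N a -> a = 1.
Proof.
move=> NX Np a [n [n0 an]] Na.
have [m pm _] := prim_order_exists n0 an.
have [m1|m1] := eqVneq m 1%N; first by move: (prim_expr_order pm); rewrite m1.
have m0 := prim_order_gt0 pm.
have l_pr : prime (pdiv m) by rewrite pdiv_prime // ltn_neqAle eq_sym m1.
have /(Np _ _ l_pr) : (a ^+ (m %/ pdiv m)) ^+ pdiv m = 1.
  by rewrite -exprM divnK ?pdiv_dvd // prim_expr_order.
move/(_ (NX _ _ Na))/eqP; rewrite -(prim_order_dvd pm) => /dvdn_leq.
rewrite divn_gt0 ?pdiv_gt0 // dvdn_leq ?pdiv_dvd // => /(_ isT).
by rewrite leqNgt ltn_Pdiv ?prime_gt1.
Qed.

Lemma torsionX (k : fieldType) (a : k) n : torsion k a -> torsion k (a ^+ n).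
Proof. by move=> [m [m0 am]]; exists m; rewrite exprAC am expr1n. Qed.

Lemma torsionM (k : fieldType) (a b : k) :
  torsion k a -> torsion k b -> torsion k (a * b).
Proof.
move=> [m [m0 am]] [n [n0 bn]]; exists (m * n)%N; rewrite muln_gt0 m0 n0.
by rewrite exprMn exprM am expr1n mulnC exprM bn expr1n mulr1.
Qed.

Lemma torsionV (k : fieldType) (a : k) : torsion k a -> torsion k a^-1.
Proof. by move=> [m [m0 am]]; exists m; rewrite exprVn am invr1. Qed.

Lemma torsion1 (k : fieldType) : torsion k 1.
Proof. by exists 1%N; rewrite expr1. Qed.

Lemma torsion_neq0 (k : fieldType) (a : k) : torsion k a -> a != 0.
Proof.
move=> [[|m] [// _ /eqP am]]; apply: contraTneq am => ->.
by rewrite expr0n /= eq_sym oner_eq0.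
Qed.

Lemma prim_root_torsion (k : fieldType) n (a : k) :
  n.-primitive_root a -> torsion k a.
Proof.
by move=> pa; exists n; rewrite (prim_order_gt0 pa) (prim_expr_order pa).
Qed.

Section Char.
Variables (k C : fieldType) (chi : character C k).

Lemma char0 : chi 0 = 0.
Proof. exact/char_eq0. Qed.

Lemma char_neq0 a : a != 0 -> chi a != 0.
Proof. by apply: contra_neq => /char_eq0. Qed.

Lemma charX a n : chi (a ^+ n) = chi a ^+ n.
Proof.
by elim: n => [|n IH]; rewrite ?expr0 ?char1 // !exprS charM IH.
Qed.

Lemma charV a : chi a^-1 = (chi a)^-1.
Proof.
have [->|a0] := eqVneq a 0; first by rewrite invr0 char0 invr0.
by apply: (mulIf (char_neq0 a0)); rewrite -charM !mulVf ?char1 // char_neq0.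
Qed.

Lemma char_expz a (z : int) : chi (a ^ z) = chi a ^ z.
Proof. by case: z => n; rewrite ?NegzE -?invr_expz ?charV charX. Qed.

Lemma char_powE nu a : (0 < nu)%N -> char_pow chi nu a = chi a ^+ nu.
Proof.
move=> nu0; rewrite /char_pow /=; case: eqP => [->|_]; last exact: charX.
by rewrite char0 expr0n eqn0Ngt nu0.
Qed.

(** This much injectivity can be reached by algebra alone; a generic twist later upgrades it to
    [char_inj]. *)
Definition torsion_inj := forall a, torsion k a -> chi a = 1 -> a = 1.
Definition char_inj := forall a, chi a = 1 -> a = 1.

Lemma char_inj_torsion : char_inj -> torsion_inj.
Proof. by move=> h a _; exact: h. Qed.

End Char.

Section Extension.
Variables (k : fieldType) (C : closedFieldType).

Lemma closed_root (b : C) n : (0 < n)%N -> exists c, c ^+ n = b.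
Proof.
move=> n0; have [c] := @solve_monicpoly C n (fun i => if i == 0%N then b else 0) n0.
case: n n0 => // n _; rewrite big_ord_recl /= mulr1 big1 ?addr0 => [|i _].
  by exists c.
by rewrite mul0r.
Qed.

Lemma mul_subgroup_units (F : fieldType) : mul_subgroup [set a : F | a != 0].
Proof.
split=> //=; first exact: oner_neq0.
by move=> a b a0 b0; rewrite mulf_neq0 // invr_neq0.
Qed.

Lemma mul_divisible_units : mul_divisible [set a : C | a != 0].
Proof.
move=> b n /= b0 n0; have [c cb] := closed_root b n0; exists c => //=.
by apply: contra_neq b0 => c0; rewrite -cb c0 expr0n eqn0Ngt n0.
Qed.

Lemma char_extend (G : set (k * C)) : partial_hom G ->
  exists chi : character C k, forall x, G x -> chi x.1 = x.2.
Proof.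
move=> hG; have [|f [f0 f1 fM fG]] := partial_hom_extend (mul_subgroup_units C)
  mul_divisible_units hG.
  by move=> x Gx; have [_ _ /(_ _ Gx)[]] := hG.
pose g a := if a == 0 then 0 else f a.
have g_eq0 a : g a = 0 <-> a = 0.
  rewrite /g; case: eqVneq => // a0; split=> [fa|a00].
    by move: (f0 a a0); rewrite /= fa eqxx.
  by move: a0; rewrite a00 eqxx.
have g1 : g 1 = 1 by rewrite /g oner_eq0.
have gM : forall a b, g (a * b) = g a * g b.
  move=> a b; rewrite /g mulf_eq0; case: eqVneq => [|a0] /=; first by rewrite mul0r.
  by case: eqVneq => [|b0] /=; rewrite ?mulr0 ?fM.
exists (Character g_eq0 g1 gM) => x Gx /=.
by have [_ _ /(_ _ Gx)[/negbTE x0 _] _] := hG; rewrite /g x0; exact: fG.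
Qed.

Hypothesis charC : forall n, (0 < n)%N -> n%:R != 0 :> C.

(** A maximal extension that is injective on torsion is defined at every element of prime order [l],
    since [C] contains primitive [l]-th roots of unity to map it to. Any further extension to [k^*]
    then kills no element of prime order. *)
Lemma torsion_inj_extend (G : set (k * C)) : partial_hom G ->
  (forall a, torsion k a -> G (a, 1) -> a = 1) ->
  exists chi : character C k,
    (forall x, G x -> chi x.1 = x.2) /\ torsion_inj chi.
Proof.
move=> hG Gi.
pose Q (A : set (k * C)) :=
  partial_hom A /\ forall a, torsion k a -> A (a, 1) -> a = 1.
have [|H H0 HQ _ Ht|A [[hA Ai] GA Amax]] := @zorn_above _ Q G.
- by split.
- split; first by apply: partial_hom_bigcup => // B /HQ [].
  by move=> a ta [B HB Ba]; have [_ Bi] := HQ _ HB; exact: Bi.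
have [A1 AB A0 Af] := hA.
have dom l a : prime l -> a ^+ l = 1 -> exists b, A (a, b).
  move=> l_pr al; have [->|a1] := eqVneq a 1; first by exists 1.
  have [//|noA] := pselect (exists b, A (a, b)).
  have pa := prime_primitive_root l_pr al a1.
  have [b pb] := closed_prim_root_exists (charC (prime_gt0 l_pr)).
  have [a0 b0] := (torsion_neq0 (prim_root_torsion pa), torsion_neq0 (prim_root_torsion pb)).
  (* The [l]-torsion is cyclic of prime order, so a nontrivial element of it in the domain would
     bring [a] into the domain. *)
  have powA (c : k) w : c ^+ l = 1 -> A (c, w) -> c = 1.
    move=> cl Acw; apply/eqP; apply: contraT => c1; case: noA.
    have pc := prime_primitive_root l_pr cl c1.
    by have [i ->] := prim_rootP pc al; exists (w ^+ i); exact: (partial_homX hA i Acw).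
  have az (z : int) : (a ^ z == 1) = (b ^ z == 1).
    by case: z => n; rewrite ?NegzE -?invr_expz ?invr_eq1 -(prim_order_dvd pa) -(prim_order_dvd pb).
  have alz (z : int) : (a ^ z) ^+ l = 1.
    by rewrite -[_ ^+ l]/(_ ^ (l%:Z)) exprz_exp mulrC -exprz_exp -exprnP al exp1rz.
  have blz (z : int) : (b ^ z) ^+ l = 1.
    by rewrite -[_ ^+ l]/(_ ^ (l%:Z)) exprz_exp mulrC -exprz_exp -exprnP (prim_expr_order pb) exp1rz.
  exists b; apply: (Amax (hom_adjoin A a b)).
  - exact: hom_adjoin_sub.
  - split.
      apply: partial_hom_adjoin => // z w Aw.
      have az1 := powA _ _ (alz z) Aw; rewrite az1 in Aw; rewrite (Af _ Aw).
      by apply/esym/eqP; rewrite -az az1.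
    move=> c tc [[x1 x2] [z [Ax [/= ec /esym e1]]]].
    have e2 : x2 = (b ^ z)^-1 by rewrite -[x2](mulfK (expfz_neq0 z b0)) e1 div1r.
    have tx : torsion k x1.
      have -> : x1 = c * (a ^ z)^-1 by rewrite ec mulfK // expfz_neq0.
      apply: torsionM => //; apply: torsionV; exists l; split; first exact: prime_gt0.
      exact: alz.
    have x1l : x1 ^+ l = 1.
      apply: Ai; first exact: torsionX.
      by have := partial_homX hA l Ax; rewrite /= -!exprnP e2 exprVn blz invr1.
    have x11 := powA _ _ x1l Ax; rewrite x11 in Ax; have x21 := Af _ Ax.
    by rewrite ec x11 mul1r; apply/eqP; rewrite az -invr_eq1 -e2 x21.
  - exact: hom_adjoin_mem.
have [chi chiA] := char_extend hA; exists chi; split=> [x /GA /chiA //|].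
apply: torsion_subgroup_trivial => [a n /= ca|l a l_pr al /= ca].
  by rewrite charX ca expr1n.
have [b Ab] := dom _ _ l_pr al; apply: Ai.
  by exists l; split=> //; exact: prime_gt0.
by rewrite -ca (chiA _ Ab).
Qed.

End Extension.

(** * Rational coordinates on the multiplicative group of a countable field *)

Section Coordinates.
Variables (k : fieldType) (H : set k).
Hypothesis sH : mul_subgroup H.

(** A polynomial over [int] serves as a finitely supported family of exponents. *)
Definition monomial (u : nat -> k) (z : {poly int}) : k :=
  \prod_(i < size z) u i ^ z`_i.

Variable u : nat -> k.
Hypothesis u_neq0 : forall n, u n != 0.

Lemma monomial_widen (z : {poly int}) n : (size z <= n)%N ->
  monomial u z = \prod_(i < n) u i ^ z`_i.
Proof.
move=> zn; rewrite /monomial (big_ord_widen n (fun i => u i ^ z`_i) zn).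
rewrite [RHS](bigID (fun i : 'I_n => (i < size z)%N)) /=.
rewrite [X in _ * X]big1 ?mulr1 // => i; rewrite -leqNgt => zi.
by rewrite nth_default.
Qed.

Lemma monomial_neq0 z : monomial u z != 0.
Proof. by apply/prodf_neq0 => i _; exact: expfz_neq0. Qed.

Lemma monomialD : {morph monomial u : z w / z + w >-> z * w}.
Proof.
move=> z w; pose n := maxn (size z) (size w).
rewrite (@monomial_widen _ n) ?size_polyD // (@monomial_widen z n) ?leq_maxl //.
rewrite (@monomial_widen w n) ?leq_maxr // -big_split; apply: eq_bigr => i _.
by rewrite coefD expfzDr.
Qed.

Lemma monomial0 : monomial u 0 = 1.
Proof. by rewrite /monomial size_poly0 big_ord0. Qed.

Lemma monomialMn z n : monomial u (z *+ n) = monomial u z ^+ n.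
Proof.
by elim: n => [|n IH]; rewrite ?mulr0n ?monomial0 ?expr0 // mulrSr exprSr monomialD IH.
Qed.

Lemma monomialN z : monomial u (- z) = (monomial u z)^-1.
Proof.
apply: (mulIf (monomial_neq0 z)); rewrite -monomialD addNr monomial0 mulVf //.
exact: monomial_neq0.
Qed.

Lemma monomialXn i : monomial u 'X^i = u i.
Proof.
rewrite /monomial size_polyXn big_ord_recr /= big1 => [|j _].
  by rewrite mul1r coefXn eqxx expr1z.
by rewrite coefXn ltn_eqF // expr0z.
Qed.

Let HM a b : H a -> H b -> H (a * b).
Proof.
move=> Ha Hb; have [H1 HB _] := sH; rewrite -[b]invrK -[b^-1]div1r.
by apply: (HB _ _ Ha); exact: HB.
Qed.

Let HX a n : H a -> H (a ^+ n).
Proof. by move=> Ha; exact: (mul_subgroupX n sH Ha). Qed.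

(* The [u i] with this property form a basis of [k^*/H] tensored with the
   rationals. *)
Definition independent (i : nat) : Prop :=
  forall (m : nat) (z : {poly int}), (0 < m)%N -> (size z <= i)%N ->
    ~ H (u i ^+ m / monomial u z).

Definition independent_supp (z : {poly int}) : Prop :=
  forall i, z`_i != 0 -> independent i.

Lemma independent_suppD z w :
  independent_supp z -> independent_supp w -> independent_supp (z + w).
Proof.
move=> iz iw i; rewrite coefD => zw; have [zi|/iz //] := eqVneq z`_i 0.
by apply: iw; rewrite zi add0r in zw.
Qed.

Lemma independent_suppMn z n : independent_supp z -> independent_supp (z *+ n).
Proof.
by move=> iz i; rewrite coefMn => zi; apply: iz; apply: contraNneq zi => ->;
  rewrite mul0rn.
Qed.

Lemma independent_suppN z : independent_supp z -> independent_supp (- z).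
Proof. by move=> iz i; rewrite coefN oppr_eq0; exact: iz. Qed.

(** The leading exponent of a nonzero [z] would express a positive power of the corresponding [u i]
    through earlier ones modulo [H]. *)
Lemma monomial_independent z : independent_supp z -> H (monomial u z) -> z = 0.
Proof.
move=> iz Hz; apply/eqP/negPn/negP => z0.
pose i := (size z).-1; have sz : size z = i.+1 by rewrite prednK // size_poly_gt0.
have ilc : z`_i != 0 by rewrite -[z`_i]/(lead_coef z) lead_coef_eq0.
pose w := take_poly i z.
have mw : monomial u z = monomial u w * u i ^ z`_i.
  rewrite /monomial sz big_ord_recr /= -/(monomial u w).
  rewrite (@monomial_widen w i) ?size_take_poly //; congr (_ * _).
  by apply: eq_bigr => j _; rewrite coef_take_poly ltn_ord.
case zn : (z`_i) => [[|n]|n].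
- by move: ilc; rewrite zn eqxx.
- rewrite zn in mw; apply: (iz i ilc n.+1 (- w)) => //.
    by rewrite size_polyN size_take_poly.
  by rewrite monomialN invrK mulrC -[_ ^+ _]/(_ ^ n.+1%:Z) -mw.
- rewrite zn in mw; apply: (iz i ilc n.+1 w) => //.
    by rewrite size_take_poly.
  have [H1 HB _] := sH; have := HB _ _ H1 Hz.
  by rewrite mw NegzE -invr_expz invfM invrK mul1r mulrC.
Qed.

Definition spanned : set k := [set a | a != 0 /\ exists (m : nat) (z : {poly int}),
  [/\ (0 < m)%N, independent_supp z & H (a ^+ m / monomial u z)]].

Lemma spannedM a b : spanned a -> spanned b -> spanned (a * b).
Proof.
move=> [a0 [m [z [m0 iz Hz]]]] [b0 [n [w [n0 iw Hw]]]].
split; first exact: mulf_neq0.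
exists (m * n)%N, (z *+ n + w *+ m); split; first by rewrite muln_gt0 m0.
  by apply: independent_suppD; exact: independent_suppMn.
have -> : (a * b) ^+ (m * n) / monomial u (z *+ n + w *+ m) =
    (a ^+ m / monomial u z) ^+ n * (b ^+ n / monomial u w) ^+ m.
  rewrite monomialD !monomialMn invfM exprMn !exprM -!exprVn !exprMn.
  by rewrite mulrACA [b ^+ m ^+ n]exprAC.
by apply: HM; exact: HX.
Qed.

Lemma spannedV a : spanned a -> spanned a^-1.
Proof.
move=> [a0 [m [z [m0 iz Hz]]]]; split; first by rewrite invr_neq0.
exists m, (- z); split=> //; first exact: independent_suppN.
have [H1 HB _] := sH; have := HB _ _ H1 Hz.
by rewrite monomialN invrK exprVn invfM invrK mul1r.
Qed.

Lemma spanned1 : spanned 1.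
Proof.
split; first exact: oner_neq0.
exists 1%N, 0; split=> //; first by move=> i; rewrite coef0 eqxx.
by rewrite expr1n monomial0 divr1; case: sH.
Qed.

Lemma spannedX a (z : int) : spanned a -> spanned (a ^ z).
Proof.
move=> Sa; have SX n : spanned (a ^+ n).
  by elim: n => [|n IH]; [exact: spanned1 | rewrite exprS; exact: spannedM].
case: z => n; first exact: SX.
by rewrite NegzE -invr_expz; exact: (spannedV (SX _)).
Qed.

Lemma spanned_root a n : a != 0 -> (0 < n)%N -> spanned (a ^+ n) -> spanned a.
Proof.
move=> a0 n0 [_ [m [z [m0 iz Hz]]]]; split=> //; exists (n * m)%N, z.
by rewrite exprM muln_gt0 n0.
Qed.

Lemma spanned_sub a : H a -> spanned a.
Proof.
move=> Ha; split; first by case: sH => _ _; exact.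
exists 1%N, 0; split=> //; first by move=> i; rewrite coef0 eqxx.
by rewrite expr1 monomial0 divr1.
Qed.

(** Greedy choice of a basis: if [u i] is not independent, a power of it is, modulo [H], a monomial
    in earlier [u j], which are spanned by induction. *)
Lemma spanned_gen i : spanned (u i).
Proof.
elim/ltn_ind: i => i IH; have [Ii|/existsNP[m]] := pselect (independent i).
  split=> //; exists 1%N, 'X^i; split=> //.
    by move=> j; rewrite coefXn; have [->|_] := eqVneq j i; rewrite ?eqxx.
  by rewrite monomialXn expr1 divff //; case: sH.
move/existsNP=> [z /not_implyP[m0 /not_implyP[zi /contrapT Hz]]].
apply: (spanned_root (u_neq0 i) m0).
rewrite -[_ ^+ m](divfK (monomial_neq0 z)); apply: spannedM.
  exact: spanned_sub.
apply: (big_ind spanned) => [||j _]; [exact: spanned1|exact: spannedM|].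
by apply: spannedX; apply: IH; apply: leq_trans (ltn_ord j) zi.
Qed.

Hypothesis u_surj : forall a, a != 0 -> exists n, u n = a.

(** [c a] lists the coordinates of [a] in [k^*/H] tensored with the rationals, with respect to the
    independent [u i]; a polynomial encodes their finite support. The last clause clears
    denominators and recovers a power of [a] up to [H]. *)
Lemma coordinates : exists c : k -> {poly rat}, [/\
  forall a b, a != 0 -> b != 0 -> c (a * b) = c a + c b,
  forall a, a != 0 -> (c a = 0 <-> exists2 m, (0 < m)%N & H (a ^+ m))
  & forall a, a != 0 -> exists m (z : {poly int}),
      [/\ (0 < m)%N, H (a ^+ m / monomial u z)
        & c a *+ m = map_poly intr z]].
Proof.
pose P a (p : {poly rat}) := exists (m : nat) (z : {poly int}),
  [/\ (0 < m)%N, independent_supp z, H (a ^+ m / monomial u z)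
    & p *+ m = map_poly intr z].
have intr_inj0 (z : {poly int}) : map_poly intr z = 0 :> {poly rat} -> z = 0.
  by move=> z0; apply/polyP => i; move/polyP/(_ i): z0;
    rewrite coef_map !coef0 /= => /eqP; rewrite intr_eq0 => /eqP.
have ex a : a != 0 -> exists p, P a p.
  move=> a0; have [i <-] := u_surj a0.
  have [_ [m [z [m0 iz Hz]]]] := spanned_gen i.
  exists (m%:R^-1 *: map_poly intr z), m, z; split=> //.
  rewrite -scaler_nat scalerA divff ?scale1r //.
  by rewrite pnatr_eq0 -lt0n.
have uniq a p q : a != 0 -> P a p -> P a q -> p = q.
  move=> a0 [m [z [m0 iz Hz pz]]] [n [w [n0 iw Hw qw]]].
  have : z *+ n - w *+ m = 0.
    apply: monomial_independent.
      by apply: independent_suppD; [|apply: independent_suppN];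
        exact: independent_suppMn.
    have [H1 HB _] := sH.
    have -> : monomial u (z *+ n - w *+ m) =
        (a ^+ n / monomial u w) ^+ m / (a ^+ m / monomial u z) ^+ n.
      rewrite monomialD monomialN !monomialMn !exprMn !exprVn invfM invrK.
      rewrite [a ^+ n ^+ m]exprAC mulrACA divff ?mul1r 1?mulrC //.
      by rewrite !expf_neq0.
    by apply: HB; exact: HX.
  move=> /(congr1 (map_poly (intr : int -> rat))).
  rewrite rmorphB !rmorphMn /= rmorph0 -pz -qw => /eqP.
  rewrite -!mulrnA [(n * m)%N]mulnC -mulrnBl -scaler_nat scaler_eq0.
  by rewrite pnatr_eq0 muln_eq0 !eqn0Ngt m0 n0 subr_eq0 => /eqP.
pose c a := xget 0 [set p | P a p].
have cP a : a != 0 -> P a (c a).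
  by move=> /ex [p Pp]; exact: (@xgetPex _ 0 [set p | P a p]) (ex_intro _ p Pp).
exists c; split.
- move=> a b a0 b0; apply: (uniq _ _ _ (mulf_neq0 a0 b0) (cP _ (mulf_neq0 a0 b0))).
  have [m [z [m0 iz Hz pz]]] := cP _ a0; have [n [w [n0 iw Hw qw]]] := cP _ b0.
  exists (m * n)%N, (z *+ n + w *+ m); split; first by rewrite muln_gt0 m0.
  + by apply: independent_suppD; exact: independent_suppMn.
  + have -> : (a * b) ^+ (m * n) / monomial u (z *+ n + w *+ m) =
        (a ^+ m / monomial u z) ^+ n * (b ^+ n / monomial u w) ^+ m.
      rewrite monomialD !monomialMn invfM exprMn !exprM -!exprVn !exprMn.
      by rewrite mulrACA [b ^+ m ^+ n]exprAC.
    by apply: HM; exact: HX.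
  + rewrite rmorphD !rmorphMn /= -pz -qw mulrnDl -!mulrnA.
    by rewrite [(n * m)%N]mulnC.
- move=> a a0; split=> [c0|[m m0 Hm]].
    have [m [z [m0 iz Hz]]] := cP _ a0; rewrite c0 mul0rn => /esym/intr_inj0 z0.
    by exists m => //; move: Hz; rewrite z0 monomial0 divr1.
  apply: (uniq a) => //; first exact: cP.
  exists m, 0; split=> //; first by move=> i; rewrite coef0 eqxx.
    by rewrite monomial0 divr1.
  by rewrite mul0rn rmorph0.
- by move=> a a0; have [m [z [? ? ? ?]]] := cP _ a0; exists m, z.
Qed.

End Coordinates.

Definition log_hom (k : fieldType) (V : zmodType) (f : k -> V) : Prop :=
  forall a b, a != 0 -> b != 0 -> f (a * b) = f a + f b.

Section LogHom.
Variables (k : fieldType) (V : zmodType) (f : k -> V).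
Hypothesis hf : log_hom f.

Lemma log_hom1 : f 1 = 0.
Proof.
have /eqP := hf (oner_neq0 k) (oner_neq0 k).
by rewrite mulr1 -subr_eq0 opprD addrA subrr sub0r oppr_eq0 => /eqP.
Qed.

Lemma log_homV a : a != 0 -> f a^-1 = - f a.
Proof.
move=> a0; have /eqP := hf a0 (invr_neq0 a0).
by rewrite divff // log_hom1 eq_sym addrC addr_eq0 => /eqP.
Qed.

Lemma log_homX a n : a != 0 -> f (a ^+ n) = f a *+ n.
Proof.
move=> a0; elim: n => [|n IH]; first by rewrite expr0 log_hom1.
by rewrite exprS hf ?expf_neq0 // IH mulrS.
Qed.

Lemma log_hom_expz a (z : int) : a != 0 -> f (a ^ z) = f a *~ z.
Proof.
move=> a0; case: z => n; first by rewrite -exprnP log_homX.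
by rewrite NegzE -invr_expz log_homV ?expf_neq0 // -exprnP log_homX // mulrNz.
Qed.

Lemma log_hom_torsion a : (forall (v : V) n, (0 < n)%N -> v *+ n = 0 -> v = 0) ->
  torsion k a -> f a = 0.
Proof.
move=> Vtf ta; have a0 := torsion_neq0 ta; have [n [n0 an]] := ta.
by apply: (Vtf _ _ n0); rewrite -log_homX // an log_hom1.
Qed.

End LogHom.

(** * Homomorphisms to the rationals with prescribed signs *)

Section Gordan.
Variables (k : fieldType) (u : nat -> k).
Hypothesis u_neq0 : forall n, u n != 0.
Hypothesis u_surj : forall a, a != 0 -> exists n, u n = a.

Lemma separating_hom (H : set k) (a : k) : mul_subgroup H -> a != 0 ->
  (forall m, (0 < m)%N -> ~ H (a ^+ m)) ->
  exists f : k -> rat, [/\ log_hom f, forall h, H h -> f h = 0 & 0 < f a].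
Proof.
move=> sH a0 Ha; have [c [cM c0 _]] := coordinates sH u_neq0 u_surj.
have ca : c a != 0.
  by apply/eqP => /(c0 _ a0) [m m0]; exact: Ha.
(* One coordinate in which [a] does not vanish, scaled by its value at [a] so that this value
   becomes a square. *)
exists (fun x => (c x)`_(size (c a)).-1 * lead_coef (c a)); split.
- by move=> x y x0 y0 /=; rewrite cM // coefD mulrDl.
- move=> h Hh; have [_ _ /(_ _ Hh) h0] := sH.
  have -> : c h = 0 by apply/(c0 _ h0); exists 1%N; rewrite ?expr1.
  by rewrite coef0 mul0r.
- by rewrite -expr2 exprn_even_gt0 //= lead_coef_eq0.
Qed.

(** The empty product is excluded on purpose: 1 lies in every subgroup [H], and the alternative is
    about products that avoid [H]. *)
Inductive pos_product (rs : seq k) : set k :=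
| pos_product_gen r : r \in rs -> pos_product rs r
| pos_product_mul a b :
    pos_product rs a -> pos_product rs b -> pos_product rs (a * b).

Lemma pos_productX rs a n : pos_product rs a -> pos_product rs (a ^+ n.+1).
Proof.
move=> Pa; elim: n => [|n IH]; first by rewrite expr1.
by rewrite exprS; exact: pos_product_mul.
Qed.

Lemma pos_product_subset rs ss a : {subset rs <= ss} ->
  pos_product rs a -> pos_product ss a.
Proof.
move=> rss; elim=> [r /rss|x y _ Px _ Py]; first exact: pos_product_gen.
exact: pos_product_mul.
Qed.

Lemma pos_product_gt0 rs (f : k -> rat) : log_hom f ->
  (forall r, r \in rs -> r != 0) -> (forall r, r \in rs -> 0 < f r) ->
  forall a, pos_product rs a -> a != 0 /\ 0 < f a.
Proof.
move=> hf rs0 fr a; elim=> [r rrs|x y _ [x0 fx] _ [y0 fy]].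
  by split; [exact: rs0 | exact: fr].
by split; [exact: mulf_neq0 | rewrite hf // addr_gt0].
Qed.

Lemma pos_combination (rs : seq k) (f g : k -> rat) :
  (forall r, r \in rs -> 0 < f r) ->
  exists N, forall r, r \in rs -> 0 < f r * N + g r.
Proof.
elim: rs => [|s rs IH] fr; first by exists 0.
have [|N NP] := IH; first by move=> r rrs; apply: fr; rewrite in_cons rrs orbT.
have fs : 0 < f s by apply: fr; rewrite mem_head.
exists (Num.max N ((1 - g s) / f s)) => r; rewrite in_cons => /orP[/eqP ->|rrs].
  have : f s * ((1 - g s) / f s) <= f s * Num.max N ((1 - g s) / f s).
    by rewrite ler_pM2l // le_max lexx orbT.
  rewrite mulrC divfK ?gt_eqF // lerBlDr => h.
  by apply: lt_le_trans h; exact: ltr01.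
apply: (lt_le_trans (NP _ rrs)); rewrite lerD2r ler_pM2l ?le_max ?lexx //.
by apply: fr; rewrite in_cons rrs orbT.
Qed.

(* Gordan's theorem of the alternative *)
Lemma positive_hom (rs : seq k) (H : set k) : mul_subgroup H ->
  (forall r, r \in rs -> r != 0) ->
  (forall a, pos_product rs a -> ~ H a) ->
  exists f : k -> rat,
    [/\ log_hom f, forall h, H h -> f h = 0 & forall r, r \in rs -> 0 < f r].
Proof.
elim: rs H => [|r rs IH] H sH rs0 rsH.
  exists (fun=> 0); split=> //; move=> a b _ _ /=; by rewrite addr0.
have [H1 HB H0] := sH; have r0 : r != 0 by apply: rs0; rewrite mem_head.
have rs0' s : s \in rs -> s != 0.
  by move=> srs; apply: rs0; rewrite in_cons srs orbT.
have sub_rs : {subset rs <= r :: rs} by move=> s srs; rewrite in_cons srs orbT.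
have Pr : pos_product (r :: rs) r by apply: pos_product_gen; rewrite mem_head.
(* [H] with [r] adjoined. If a product [q] of [rs] lies in it, say [q = h * r ^ z], then the [f]
   found for [H] satisfies [f q = z * f r]. A [z <= 0] would put the product [q * r ^ (- z)] into
   [H], so [z] is positive and [f r > 0]. *)
pose H' := [set a | exists (z : int) h, H h /\ a = h * r ^ z].
have [[q [Pq [z [h [Hh qE]]]]]|noq] :=
    pselect (exists q, pos_product rs q /\ H' q).
  have [|f [hf fH fr]] := IH H sH rs0'.
    by move=> a /(pos_product_subset sub_rs); exact: rsH.
  exists f; split=> // s; rewrite in_cons => /orP[/eqP ->{s}|]; last exact: fr.
  have [q0 fq] := pos_product_gt0 hf rs0' fr Pq.
  have := fq; rewrite qE hf ?expfz_neq0 //; last exact: H0.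
  rewrite fH // add0r (log_hom_expz hf) //.
  case: z qE => [n|n] qE; first by case: n qE => // n _; rewrite pmulrn_lgt0.
  case: (rsH (q * r ^+ n.+1)); last first.
    by rewrite qE NegzE -invr_expz -exprnP divfK // expf_neq0.
  apply: pos_product_mul; first exact: (pos_product_subset sub_rs).
  exact: pos_productX.
have sH' : mul_subgroup H'.
  split; first by exists 0, 1; rewrite expr0z mulr1.
    move=> _ _ [z [h [Hh ->]]] [w [g [Hg ->]]]; exists (z - w), (h / g).
    by split; [exact: HB | rewrite expfzDr // -invr_expz invfM mulrACA].
  by move=> _ [z [h [Hh ->]]]; rewrite mulf_neq0 ?expfz_neq0 //; exact: H0.
have [|f [hf fH fr]] := IH H' sH' rs0'.
  by move=> a Pa H'a; apply: noq; exists a.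
have [|g [hg gH gr]] := separating_hom sH r0.
  by move=> [//|m] _; apply: rsH; exact: pos_productX.
(* Here [f] vanishes at [r], where [g] is positive; a large multiple of [f] restores positivity on
   [rs]. *)
have [N NP] := pos_combination g fr.
exists (fun x => f x * N + g x); split.
- by move=> a b a0 b0 /=; rewrite hf // hg // mulrDl addrACA.
- move=> h Hh; rewrite (gH _ Hh) (fH h) ?mul0r ?addr0 //.
  by exists 0, h; rewrite expr0z mulr1.
- move=> s; rewrite in_cons => /orP[/eqP ->|]; last exact: NP.
  by rewrite (fH r) ?mul0r ?add0r //; exists 1, 1; rewrite expr1z mul1r.
Qed.

End Gordan.

(** * Twisting characters by exponentials *)

Section ComplexExp.
Variable R : realType.
Implicit Types z w : R[i].

Definition cexp z : R[i] :=
  Complex (expR (Re z) * cos (Im z)) (expR (Re z) * sin (Im z)).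

Lemma cexpD z w : cexp (z + w) = cexp z * cexp w.
Proof.
case: z w => [a b] [c d]; apply/eqP; rewrite eq_complex /= expRD cosD sinD.
by apply/andP; split; apply/eqP; ring.
Qed.

Lemma cexp0 : cexp 0 = 1.
Proof. by rewrite /cexp /= expR0 cos0 sin0 mul1r mulr0. Qed.

Lemma cexpN z : cexp (- z) * cexp z = 1.
Proof. by rewrite -cexpD addNr cexp0. Qed.

Lemma cexp_neq0 z : cexp z != 0.
Proof.
by apply/eqP => z0; have /eqP := cexpN z; rewrite z0 mulr0 eq_sym oner_eq0.
Qed.

Lemma normc_cexp z : `|cexp z| = (expR (Re z))%:C%C.
Proof.
rewrite normc_def /=; congr (_%:C)%C.
by rewrite !exprMn -mulrDr cos2Dsin2 mulr1 sqrtr_sqr ger0_norm.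
Qed.

Lemma cexp_nat z n : cexp (z *+ n) = cexp z ^+ n.
Proof.
by elim: n => [|n IH]; rewrite ?mulr0n ?cexp0 ?expr0 // mulrS cexpD IH exprS.
Qed.

Lemma cexp_surj w : w != 0 -> exists z, cexp z = w.
Proof.
case: w => a b w0; pose r := Num.sqrt (a ^+ 2 + b ^+ 2).
have r2 : r ^+ 2 = a ^+ 2 + b ^+ 2 by rewrite sqr_sqrtr // addr_ge0 // sqr_ge0.
have r0 : 0 < r.
  rewrite sqrtr_gt0 lt_neqAle addr_ge0 ?sqr_ge0 // andbT eq_sym.
  rewrite paddr_eq0 ?sqr_ge0 // !sqrf_eq0; move: w0.
  by rewrite eq_complex /=.
have unit_circle (c s : R) : c ^+ 2 + s ^+ 2 = 1 -> exists t, cos t = c /\ sin t = s.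
  move=> cs; have c1 : -1 <= c <= 1.
    by rewrite -ler_norml -sqrtr_sqr -[X in _ <= X]sqrtr1 ler_sqrt // -cs lerDl sqr_ge0.
  have c1' : c \in `[(-1), 1]%R by rewrite in_itv.
  have sc : 1 - c ^+ 2 = s ^+ 2 by rewrite -cs addrAC subrr add0r.
  have [s0|s0] := lerP 0 s.
    by exists (acos c); rewrite sin_acos // acosK // sc sqrtr_sqr ger0_norm.
  exists (- acos c); rewrite cosN sinN sin_acos // acosK // sc sqrtr_sqr.
  by rewrite ltr0_norm // opprK.
have [|t [ct st]] := unit_circle (a / r) (b / r).
  by rewrite !expr_div_n -mulrDl r2 divff // -r2 expf_neq0 // gt_eqF.
exists (Complex (ln r) t); rewrite /cexp /= lnK ?posrE // ct st.
by rewrite !mulrA ![r * _]mulrC !mulfK // gt_eqF.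
Qed.

Lemma cos_eq1_small (y : R) : `|y| < pi *+ 2 -> cos y = 1 -> y = 0.
Proof.
move=> y2 cy; have c2 : cos (y / 2) ^+ 2 = 1.
  have yE : y / 2 *+ 2 = y by rewrite -mulr_natr divfK.
  have := cos_mulr2n (y / 2); rewrite yE cy.
  by lra.
have s2 : sin (y / 2) = 0.
  by apply/eqP; rewrite -sqrf_eq0 sin2cos2 c2 subrr.
apply/eqP/negPn/negP => y0.
have : sin `|y / 2| = 0.
  have [h|h] := lerP 0 (y / 2); first by rewrite ger0_norm.
  by rewrite ltr0_norm // sinN s2 oppr0.
apply/eqP; rewrite gt_eqF // sin_gt0_pi // normr_gt0 mulf_neq0 //=.
by rewrite normrM [`|2^-1|]gtr0_norm // ltr_pdivrMr // mulr_natr.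
Qed.

Lemma countable_fiber (T S : Type) (A : set T) (f : T -> S) (g : S -> option nat) :
  (forall x y, A x -> A y -> f x = f y -> x = y) -> injective g -> countable A.
Proof.
move=> fi gi; apply/countable_injP.
exists (fun x => if g (f x) is Some n then n.+1 else 0%N).
move=> x y /set_mem Ax /set_mem Ay e; apply: fi => //; apply: gi.
by move: e; case: (g (f x)) (g (f y)) => [n|] [m|] // [->].
Qed.

(* Two logarithms of [w] with arguments in the same window of length [2 pi]
   coincide. *)
Lemma countable_log w : countable [set z | cexp z = w].
Proof.
pose f z : int := Num.floor (Im z / (pi *+ 2)).
apply: (@countable_fiber _ _ _ f (fun n => Some (pickle n))) => [z1 z2 /= e1 e2 fe|].
  have p2 : 0 < pi *+ 2 :> R by rewrite pmulrn_lgt0 // pi_gt0.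
  have /eqP : cexp (z1 - z2) = 1.
    by rewrite cexpD e1 -e2 -cexpD subrr cexp0.
  move=> ez; have re0 : Re (z1 - z2) = 0.
    have := normc_cexp (z1 - z2); rewrite (eqP ez) normr1 => -[/esym e].
    by apply: expR_inj; rewrite expR0.
  have im0 : Im (z1 - z2) = 0.
    apply: cos_eq1_small; last first.
      by move: ez; rewrite eq_complex /= -/(Re (z1 - z2)) re0 expR0 !mul1r => /andP[/eqP].
    have -> : Im (z1 - z2) = (Im z1 / (pi *+ 2) - Im z2 / (pi *+ 2)) * (pi *+ 2).
      by rewrite -mulrBl divfK ?gt_eqF //; case: (z1) (z2) => [a b] [c d].
    rewrite normrM [X in _ * X]gtr0_norm // -[X in _ < X]mul1r ltr_pM2r //.
    have := floor_itv (Im z1 / (pi *+ 2)); have := floor_itv (Im z2 / (pi *+ 2)).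
    rewrite -/(f z1) -/(f z2) -fe intrD => /andP[? ?] /andP[? ?].
    by rewrite ltr_norml; apply/andP; split; lra.
  apply/eqP; rewrite -subr_eq0; move: re0 im0.
  by case: (z1 - z2) => a b /= -> ->.
by move=> m n [/(pcan_inj pickleK)].
Qed.

(** A countable set has Lebesgue measure zero and cannot contain an interval. Arbitrarily small
    generic parameters are chosen in this way. *)
Lemma uncountable_gt0 (A : set R) e : countable A -> 0 < e ->
  exists s, [/\ 0 < s, s < e & ~ A s].
Proof.
move=> cA e0; apply: contrapT => no.
have : countable `]0, e[%classic.
  apply: sub_countable cA; apply: subset_card_le => s /=.
  rewrite in_itv /= => /andP[s0 se]; apply: contrapT => nA.
  by apply: no; exists s.
move/countable_lebesgue_measure0; rewrite lebesgue_measure_itv /= lte_fin e0.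
by rewrite oppr0 addr0 => -[] /eqP; rewrite gt_eqF.
Qed.

End ComplexExp.

Section Twist.
Variables (R : realType) (k : fieldType).
Implicit Types (chi : character R[i] k) (L : k -> R[i]).

Let tw chi L (a : k) : R[i] := chi a * cexp (L a).

Fact twist_eq0 chi L a : tw chi L a = 0 <-> a = 0.
Proof.
rewrite /tw; split=> [/eqP|->]; last by rewrite char0 mul0r.
by rewrite mulf_eq0 (negbTE (cexp_neq0 _)) orbF => /eqP/char_eq0.
Qed.

Fact twist1 chi L : log_hom L -> tw chi L 1 = 1.
Proof. by move=> hL; rewrite /tw char1 (log_hom1 hL) cexp0 mulr1. Qed.

Fact twistM chi L : log_hom L ->
  forall a b, tw chi L (a * b) = tw chi L a * tw chi L b.
Proof.
move=> hL a b; rewrite /tw charM.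
have [->|a0] := eqVneq a 0; first by rewrite mul0r char0 !mul0r.
have [->|b0] := eqVneq b 0; first by rewrite mulr0 char0 !(mulr0, mul0r).
by rewrite hL // cexpD mulrACA.
Qed.

Definition twist chi L (hL : log_hom L) : character R[i] k :=
  Character (twist_eq0 chi L) (twist1 chi hL) (twistM chi hL).

Lemma log_hom_scale L (t : R[i]) : log_hom L -> log_hom (fun a => t * L a).
Proof. by move=> hL a b a0 b0 /=; rewrite hL // mulrDr. Qed.

Lemma log_homC_torsion L a : log_hom L -> torsion k a -> L a = 0.
Proof.
move=> hL; apply: (log_hom_torsion hL) => v n n0 /eqP.
by rewrite mulrn_eq0 eqn0Ngt n0 => /eqP.
Qed.

Lemma twist_torsion chi L (hL : log_hom L) a :
  torsion k a -> twist chi hL a = chi a.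
Proof. by move=> ta; rewrite /= /tw (log_homC_torsion hL ta) cexp0 mulr1. Qed.

End Twist.

Section Generic.
Variables (R : realType) (k : fieldType) (u : nat -> k).
Hypothesis u_neq0 : forall n, u n != 0.
Hypothesis u_surj : forall a, a != 0 -> exists n, u n = a.

Lemma mul_subgroup1 : mul_subgroup [set 1 : k].
Proof.
split=> //= [a b -> ->|a ->]; first by rewrite divr1.
exact: oner_neq0.
Qed.

Lemma countable_root (p : {poly R}) : p != 0 -> countable [set s | root p s].
Proof.
move=> p0; apply: finite_set_countable; apply: contrapT.
move/infinite_set_fset => /(_ (size p)) [B sB]; apply/negP; rewrite -ltnNge.
apply: max_poly_roots p0 _ (finmap.fset_uniq B); apply/allP => s sinB.
exact: (sB s sinB).
Qed.

(** The left side is a constant plus [q(s^2) * (al * s + be * s^2)], a nonzero polynomial in [s]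
    vanishing at 0 and therefore not constant. *)
Lemma countable_bad_line (q : {poly R}) (x y al be ga : R) : q != 0 ->
  (al != 0) || (be != 0) ->
  countable [set s | al * (x + s * q.[s ^+ 2]) + be * (y + s ^+ 2 * q.[s ^+ 2]) = ga].
Proof.
move=> q0 ab.
pose f : {poly R} := (q \Po 'X^2) * (al *: 'X + be *: 'X^2).
pose p := f + (al * x + be * y - ga)%:P.
have fE s : f.[s] = q.[s ^+ 2] * (al * s + be * s ^+ 2).
  by rewrite !hornerE horner_comp !hornerE.
have f0 : f != 0.
  apply: mulf_neq0.
    by rewrite comp_poly_eq0 ?size_polyXn.
  apply/eqP => e; have := congr1 (fun h : {poly R} => h`_1) e.
  have := congr1 (fun h : {poly R} => h`_2) e.
  rewrite !coefD !coefZ !coefXn !coefX !coef0 !mulr1 !mulr0 addr0 add0r => be0 al0.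
  by move: ab; rewrite al0 be0 eqxx.
have p0 : p != 0.
  apply: contraNneq f0 => p0.
  have := congr1 (fun h : {poly R} => h.[0]) p0.
  rewrite hornerD fE hornerC horner0 !(mulr0, expr0n, addr0, add0r) /= => c0.
  by move: p0; rewrite /p c0 polyC0 addr0 => ->.
apply: sub_countable (countable_root p0); apply: subset_card_le => s /= e.
rewrite rootE hornerD fE hornerC -e; apply/eqP; ring.
Qed.

Lemma countable_bad_bigcup (F : nat -> set R) :
  (forall n, countable (F n)) -> countable (\bigcup_n F n).
Proof. by move=> cF; apply: bigcup_countable. Qed.

Section Perturbation.
Variable c : k -> {poly rat}.
Hypothesis cM : log_hom c.
Hypothesis c_eq0 : forall a, a != 0 -> (c a = 0 <-> torsion k a).

Let q (a : k) : {poly R} := map_poly ratr (c a).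

(* [s + i s^2] runs through a curve meeting every real line finitely often. *)
Definition perturbation (s : R) (a : k) : R[i] :=
  Complex (s * (q a).[s ^+ 2]) (s ^+ 2 * (q a).[s ^+ 2]).

Lemma perturbation_log_hom s : log_hom (perturbation s).
Proof.
move=> a b a0 b0; apply/eqP; rewrite eq_complex /= /q cM // rmorphD hornerD.
by rewrite -!mulrDr !eqxx.
Qed.

Let q_neq0 a : a != 0 -> ~ torsion k a -> q a != 0.
Proof.
by move=> a0 ta; rewrite map_poly_eq0; apply: contra_not_neq ta => /(c_eq0 a0).
Qed.

(** Each pair of a non-torsion [a] and a logarithm [z] of [w a] forbids those [s] for which the
    perturbed value at [a] falls on one real line, and there are countably many pairs. The
    coefficients stay open because two kinds of line occur: the vertical line through [z], and the
    line joining 0 and [z]. *)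
Lemma countable_bad (w : k -> R[i]) (L0 : k -> R[i])
    (al be ga : R[i] -> R) :
  (forall a z, a != 0 -> ~ torsion k a -> cexp z = w a ->
    (al z != 0) || (be z != 0)) ->
  countable [set s | exists a z, [/\ a != 0, ~ torsion k a, cexp z = w a &
    al z * Re (L0 a + perturbation s a) + be z * Im (L0 a + perturbation s a)
      = ga z]].
Proof.
move=> ab; apply: (@sub_countable _ _ _ (\bigcup_n
  [set s | exists z, [/\ ~ torsion k (u n), cexp z = w (u n) &
    al z * Re (L0 (u n) + perturbation s (u n)) +
    be z * Im (L0 (u n) + perturbation s (u n)) = ga z]])).
  apply: subset_card_le => s [a [z [a0 ta ez e]]].
  by have [n na] := u_surj a0; exists n => //; exists z; rewrite na.
apply: countable_bad_bigcup => n.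
have [tn|tn] := pselect (torsion k (u n)).
  by apply: (@sub_countable _ _ _ set0) => //; apply: subset_card_le => s [z []].
apply: (@sub_countable _ _ _ (\bigcup_(z in [set z | cexp z = w (u n)])
  [set s | al z * (Re (L0 (u n)) + s * (q (u n)).[s ^+ 2]) +
    be z * (Im (L0 (u n)) + s ^+ 2 * (q (u n)).[s ^+ 2]) = ga z])).
  apply: subset_card_le => s [z [_ ez e]]; exists z => //=.
  by move: e; case: (L0 (u n)).
apply: bigcup_countable; first exact: countable_log.
by move=> z /= ez; apply: countable_bad_line; [exact: q_neq0 | exact: ab ez].
Qed.

Lemma perturbation_small (l : seq k) (e : R) : 0 < e -> exists2 d, 0 < d &
  forall s, 0 < s -> s < d -> forall a, a \in l ->
    `|Re (perturbation s a)| < e /\ `|Im (perturbation s a)| < e.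
Proof.
move=> e0; elim: l => [|b l [d d0 IH]]; first by exists 1.
have [d' d'0 hb] : exists2 d, 0 < d & forall s, 0 < s -> s < d ->
    `|Re (perturbation s b)| < e /\ `|Im (perturbation s b)| < e.
  have bound (p : {poly R}) : p.[0] = 0 ->
      exists2 d, 0 < d & forall s, 0 < s -> s < d -> `|p.[s]| < e.
    move=> p0; have /cvgrPdist_lt/(_ e e0) := @continuous_horner R p 0.
    move=> /nbhs_ballP[d3 /= d30 H]; exists d3 => // s s0 sd.
    have := H s; rewrite /ball /= sub0r normrN gtr0_norm // => /(_ sd).
    by rewrite p0 sub0r normrN.
  have [|d1 d10 H1] := bound ('X * (q b \Po 'X^2)).
    by rewrite !hornerE ?mul0r.
  have [|d2 d20 H2] := bound ('X^2 * (q b \Po 'X^2)).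
    by rewrite !hornerE ?expr0n ?mul0r.
  exists (Num.min d1 d2); first by rewrite lt_min d10.
  move=> s s0; rewrite lt_min => /andP[sd1 sd2] /=.
  have := H1 s s0 sd1; have := H2 s s0 sd2.
  by rewrite !hornerE !horner_comp !hornerE.
exists (Num.min d d'); first by rewrite lt_min d0.
move=> s s0; rewrite lt_min => /andP[sd sd'] a; rewrite in_cons.
by move=> /orP[/eqP ->|]; [exact: hb | exact: IH].
Qed.

End Perturbation.

Let coordinates1 : exists c : k -> {poly rat},
  log_hom c /\ forall a, a != 0 -> (c a = 0 <-> torsion k a).
Proof.
have [c [cM c0 _]] := coordinates mul_subgroup1 u_neq0 u_surj.
exists c; split=> // a a0; rewrite c0 //; split=> [[m m0 am]|[m [m0 am]]];
  by exists m.
Qed.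

(** On torsion the twist changes nothing. Elsewhere a kernel element [a] makes [L a] a logarithm of
    [(psi a)^-1], and comparing real parts alone excludes this for all but countably many [s]. *)
Lemma generic_twist (psi : character R[i] k) L0 (l : seq k) (e : R) :
  torsion_inj psi -> log_hom L0 -> 0 < e ->
  exists L (hL : log_hom L), char_inj (twist psi hL) /\
    forall a, a \in l -> `|Re (L a - L0 a)| < e /\ `|Im (L a - L0 a)| < e.
Proof.
move=> tpsi hL0 e0; have [c [cM c0]] := coordinates1.
have [d d0 dP] := perturbation_small c l e0.
have [|s [s0 sd sP]] := uncountable_gt0
    (@countable_bad c c0 (fun a => (psi a)^-1) L0 (fun=> 1) (fun=> 0) (@Re R) _) d0.
  by move=> *; rewrite oner_neq0.
have hL : log_hom (fun a => L0 a + perturbation c s a).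
  by move=> a b a0 b0 /=; rewrite hL0 // perturbation_log_hom // addrACA.
exists _, hL; split=> [a|a al]; last first.
  by rewrite addrAC subrr add0r; exact: dP.
have [->|a0] := eqVneq a 0; first by rewrite char0 => /eqP; rewrite eq_sym oner_eq0.
have [ta|ta] := pselect (torsion k a).
  by rewrite twist_torsion //; exact: tpsi.
rewrite /= => e1; case: sP; exists a, (L0 a + perturbation c s a); split=> //.
  by rewrite -[RHS]mulr1 -e1 mulKf // char_neq0.
by rewrite mul1r mul0r addr0.
Qed.

(** All real [t] are handled by one condition: if [t * L a] is a logarithm [z] of [(chi a)^-1], then
    [L a] lies on the real line through 0 and [z]. This is a genuine line, since injectivity of
    [chi] makes [z] nonzero. *)
Lemma generic_twist_path (chi : character R[i] k) L0 (l : seq k) (e : R) :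
  char_inj chi -> log_hom L0 -> 0 < e ->
  exists L (hL : log_hom L),
    (forall t : R, char_inj (twist chi (log_hom_scale t%:C%C hL))) /\
    forall a, a \in l -> `|Re (L a - L0 a)| < e /\ `|Im (L a - L0 a)| < e.
Proof.
move=> ichi hL0 e0; have [c [cM c0]] := coordinates1.
have [d d0 dP] := perturbation_small c l e0.
have [|s [s0 sd sP]] := uncountable_gt0 (@countable_bad c c0
    (fun a => (chi a)^-1) L0 (@Im R) (fun z => - Re z) (fun=> 0) _) d0.
  move=> a z a0 ta ez; rewrite oppr_eq0; apply/negPn; rewrite negb_or !negbK.
  apply/negP => /andP[/eqP i0 /eqP r0]; apply: ta.
  have z0 : z = 0 by apply/eqP; rewrite eq_complex /= i0 r0 !eqxx.
  have -> : a = 1; last exact: torsion1.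
  by apply: ichi; rewrite -[chi a]invrK -ez z0 cexp0 invr1.
have hL : log_hom (fun a => L0 a + perturbation c s a).
  by move=> a b a0 b0 /=; rewrite hL0 // perturbation_log_hom // addrACA.
exists _, hL; split=> [t a|a al]; last first.
  by rewrite addrAC subrr add0r; exact: dP.
have [->|a0] := eqVneq a 0; first by rewrite char0 => /eqP; rewrite eq_sym oner_eq0.
have [ta|ta] := pselect (torsion k a).
  by rewrite twist_torsion //; exact: ichi.
rewrite /=; set w := L0 a + _ => e1.
case: sP; exists a, (t%:C%C * w); split=> //.
  by rewrite -[RHS]mulr1 -e1 mulKf // char_neq0.
rewrite -/w; case: w {e1} => x y /=; ring.
Qed.

End Generic.

(** * Reduction at a point of the spectrum *)

Section Subring.
Variables (A : pzRingType) (S : set A).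
Hypothesis sS : subring S.

Lemma subring0 : S 0.
Proof. by have [S1 SB _] := sS; rewrite -(subrr 1); exact: SB. Qed.

Lemma subringN a : S a -> S (- a).
Proof. by move=> Sa; have [_ SB _] := sS; rewrite -sub0r; apply: (SB) => //; exact: subring0. Qed.

Lemma subringD a b : S a -> S b -> S (a + b).
Proof.
by move=> Sa Sb; have [_ SB _] := sS; rewrite -[b]opprK; apply: (SB) => //; exact: subringN.
Qed.

Lemma subringX a n : S a -> S (a ^+ n).
Proof.
by have [S1 _ SM] := sS; elim: n => [//|n IH] Sa; rewrite exprS; apply: (SM) => //; exact: IH.
Qed.

Lemma subring_nat n : S n%:R.
Proof.
have [S1 _ _] := sS; elim: n => [|n IH]; first exact: subring0.
by rewrite -natr1; exact: subringD.
Qed.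

End Subring.

Lemma integral_over_root (K : fieldType) (S : set K) (z : K) n (a : nat -> K) :
  subring S -> (0 < n)%N -> (forall i, (i < n)%N -> S (a i)) ->
  z ^+ n = \sum_(i < n) a i * z ^+ i -> integral_over S z.
Proof.
move=> sS n0 Sa zn; have [S1 SB SM] := sS.
pose q := \poly_(i < n) a i; exists ('X^n - q); split.
- rewrite monicE lead_coefDl ?lead_coefXn // size_polyXn size_polyN ltnS.
  exact: size_poly.
- move=> i; rewrite coefB coefXn coef_poly; apply: (SB).
    by case: eqP => _; [exact: S1 | exact: subring0].
  by case: ltnP => [/Sa //|_]; exact: subring0.
- rewrite rootE hornerD hornerN hornerXn horner_poly zn subrr //.
Qed.

Section SpecPoint.
Variables (K : closedFieldType) (x : spec_point K).
Let S := sp_ring x.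
Let p := sp_ideal x.

Let valE : {rmorphism localization x -> K} := \val.

Let local_val1 : local_val (1 : localization x) = 1.
Proof. exact: (rmorph1 valE). Qed.

Let local_valM (z w : localization x) :
  local_val (z * w) = local_val z * local_val w.
Proof. exact: (rmorphM valE). Qed.

Let local_valD (z w : localization x) :
  local_val (z + w) = local_val z + local_val w.
Proof. exact: (rmorphD valE). Qed.

Let local_valX (z : localization x) n : local_val (z ^+ n) = local_val z ^+ n.
Proof. exact: (rmorphXn valE). Qed.

Lemma in_local_ring z : S z -> in_local x z.
Proof.
move=> Sz; have [S1 _ _] := sp_subring x; have [_ _ _ _ [p1 _]] := sp_prime x.
by apply/asboolP; exists z, 1; rewrite divr1.
Qed.

Lemma in_maximal_ideal z : p z -> in_maximal x z.
Proof.
move=> pz; have [S1 _ _] := sp_subring x; have [_ _ _ _ [p1 _]] := sp_prime x.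
by apply/asboolP; exists z, 1; rewrite divr1.
Qed.

Lemma reduceE z (Lz : in_local x z) : reduce x z = to_residue (Local Lz).
Proof.
rewrite /reduce; case: insubP => [w Lw wz|]; last by rewrite Lz.
by congr to_residue; apply: val_inj.
Qed.

Lemma reduce_local (z : localization x) : reduce x (local_val z) = to_residue z.
Proof. by rewrite (reduceE (local_valP z)); congr to_residue; apply: val_inj. Qed.

Lemma reduceM z w : in_local x z -> in_local x w ->
  reduce x (z * w) = reduce x z * reduce x w.
Proof.
move=> Lz Lw; rewrite (reduceE Lz) (reduceE Lw) /to_residue -rmorphM.
by rewrite -[RHS]/(to_residue _) -reduce_local local_valM.
Qed.

Lemma reduce1 : reduce x 1 = 1.
Proof. by rewrite -local_val1 reduce_local /to_residue rmorph1. Qed.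

Lemma reduceD z w : in_local x z -> in_local x w ->
  reduce x (z + w) = reduce x z + reduce x w.
Proof.
move=> Lz Lw; rewrite (reduceE Lz) (reduceE Lw) /to_residue -rmorphD.
by rewrite -[RHS]/(to_residue _) -reduce_local local_valD.
Qed.

Lemma reduce_eq0 z : in_local x z -> (reduce x z = 0 <-> in_maximal x z).
Proof.
by move=> Lz; rewrite (reduceE Lz); split=> [/eqP|]; rewrite ?to_residue_eq0 // => ?;
  apply/eqP; rewrite to_residue_eq0.
Qed.

Lemma reduce0 : reduce x 0 = 0.
Proof.
apply/(reduce_eq0 (in_local_ring (subring0 (sp_subring x)))).
by apply: in_maximal_ideal; have [] := sp_prime x.
Qed.

Lemma reduce_nat n : reduce x n%:R = n%:R.
Proof.
have Sn m := subring_nat (sp_subring x) m.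
elim: n => [|n IH]; first exact: reduce0.
rewrite -!natr1 (reduceD (in_local_ring (Sn n)) (in_local_ring (Sn 1))).
by rewrite IH reduce1.
Qed.

Lemma reduce_surj c : exists z, in_local x z /\ reduce x z = c.
Proof.
exists (local_val (repr c)); split; first exact: local_valP.
by rewrite reduce_local /to_residue reprK.
Qed.

Definition local_unit : set K := [set z | in_local x z /\ reduce x z != 0].

Lemma local_unit_neq0 z : local_unit z -> z != 0.
Proof.
by move=> [_]; apply: contra_neq => ->; exact: reduce0.
Qed.

Lemma local_unitV z : local_unit z -> local_unit z^-1.
Proof.
move=> [Lz rz]; have /asboolP[a [b [Sa Sb pb zE]]] := Lz.
have pa : ~ p a.
  move=> pa; move/eqP: rz; apply; apply/(reduce_eq0 Lz).
  by apply/asboolP; exists a, b.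
have LV : in_local x z^-1 by apply/asboolP; exists b, a; rewrite zE invf_div.
split; first exact: LV.
apply/eqP => r0; have := reduceM Lz LV.
rewrite r0 mulr0 divff ?reduce1; first by move/eqP; rewrite oner_eq0.
by rewrite zE mulf_neq0 ?invr_neq0 // ; exact: (@den_neq0 _ x).
Qed.

Lemma mul_subgroup_local_unit : mul_subgroup local_unit.
Proof.
have [L1 LB LM] := in_local_subring x; split; last exact: local_unit_neq0.
- by split; [exact: L1 | rewrite reduce1 oner_neq0].
- move=> z w Uz /local_unitV Uw; have [[Lz rz] [Lw rw]] := (Uz, Uw).
  split; first exact: (LM _ _ Lz Lw).
  rewrite (reduceM Lz Lw); apply: mulf_neq0; [exact: rz | exact: rw].
Qed.

Lemma reduceX z n : in_local x z -> reduce x (z ^+ n) = reduce x z ^+ n.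
Proof.
move=> Lz; rewrite (reduceE Lz) /to_residue -rmorphXn.
by rewrite -[RHS]/(to_residue _) -reduce_local local_valX.
Qed.

Lemma reduceV z : local_unit z -> reduce x z^-1 = (reduce x z)^-1.
Proof.
move=> Uz; have [[Lz rz] [LV _]] := (Uz, local_unitV Uz).
by apply: (mulfI rz); rewrite -reduceM // !divff ?reduce1 // local_unit_neq0.
Qed.

Hypothesis int_closed : forall z, integral_over S z -> S z.

(** A monic equation over the residue field lifts to the local ring and has a root [y] in [K].
    Multiplied by a common denominator [B] of the coefficients, [y] becomes integral over [S], so it
    lies in the local ring and reduces to a root. *)
Lemma residue_closed : GRing.closed_field_axiom (residue x).
Proof.
move=> n P n0; have [S1 SB SM] := sp_subring x.
pose w i : localization x := repr (P i).
have wE i : to_residue (w i) = P i by rewrite /to_residue reprK.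
have Lw i : exists ab : K * K, [/\ S ab.1, S ab.2, ~ p ab.2
    & local_val (w i) = ab.1 / ab.2].
  by have /asboolP[a [b [? ? ? ?]]] := local_valP (w i); exists (a, b).
pose ab i := projT1 (cid (Lw i)); pose a i := (ab i).1; pose b i := (ab i).2.
have Sa i : S (a i) by rewrite /a /ab; case: cid => ? [].
have Sb i : S (b i) by rewrite /b /ab; case: cid => ? [].
have pb i : ~ p (b i) by rewrite /b /ab; case: cid => ? [].
have wab i : local_val (w i) = a i / b i by rewrite /a /b /ab; case: cid => ? [].
have b0 i : b i != 0 := den_neq0 (pb i).
pose B := \prod_(i < n) b i.
have [SB' pB] : S B /\ ~ p B.
  apply: (big_ind (fun c => S c /\ ~ p c)) => [|c d [? ?] [? ?]|i _].
  - by split=> //; have [_ _ _ _ []] := sp_prime x.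
  - exact: denM.
  - by split.
have B0 : B != 0 := den_neq0 pB.
have [y yE] := solve_monicpoly (fun i => local_val (w i)) n0.
have Sby : S (B * y).
  apply: int_closed; apply: (@integral_over_root K S (B * y) n
      (fun i => B ^+ (n - i) * local_val (w i)) (sp_subring x) n0).
    (* As [i < n], at least one factor [B] is left to cancel the denominator [b i]. *)
    move=> i ltin; rewrite wab -(subnSK ltin) exprSr -mulrA.
    apply: (SM); first by apply: subringX => //; exact: sp_subring.
    rewrite /B (bigD1 (Ordinal ltin)) //= [b i * _]mulrC -mulrA.
    rewrite [b i * _]mulrC divfK //.
    apply: (SM); last exact: Sa.
    by apply: (big_ind S) => // j _; exact: Sb.
  rewrite exprMn yE mulr_sumr; apply: eq_bigr => i _.
  by rewrite exprMn mulrACA -exprD subnK // ltnW.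
have Ly : in_local x y.
  by apply/asboolP; exists (B * y), B; split=> //; rewrite mulrC mulrA mulVf ?mul1r.
exists (reduce x y); rewrite (reduceE Ly) /to_residue -rmorphXn.
have -> : Local Ly ^+ n = \sum_(i < n) w i * Local Ly ^+ i.
  apply: val_inj; rewrite [LHS]local_valX /= yE [RHS](rmorph_sum valE).
  by apply: eq_bigr => i _; rewrite [RHS]local_valM local_valX.
rewrite rmorph_sum; apply: eq_bigr => i _; rewrite rmorphM rmorphXn.
by congr (_ * _); exact: wE.
Qed.

End SpecPoint.

(** * Local rings of the scheme and of its normalization *)

Section IntegralOver.
Variables (K : fieldType).

Lemma integral_over_trans (A : set K) z : subring A ->
  integral_over (integral_over A) z -> integral_over A z.
Proof.
move=> sA [q [mq qA qz]]; apply/(integral_overE sA).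
apply: (integral_root_monic mq qz) => a /(nthP 0)[i _ <-].
exact/(integral_overE sA).
Qed.

Lemma integral_over_sub (A B : set K) z : A `<=` B ->
  integral_over A z -> integral_over B z.
Proof. by move=> AB [q [mq qA qz]]; exists q; split=> // i; exact: AB. Qed.

Lemma integral_over_torsion (A : set K) z : subring A ->
  torsion K z -> integral_over A z.
Proof.
move=> sA [n [n0 zn]]; have [A1 _ _] := sA.
apply: (@integral_over_root K A z n (fun i => (i == 0%N)%:R) sA n0).
  by move=> i _; case: (i == 0%N) => //=; exact: subring0.
case: n n0 zn => // n _ ->; rewrite big_ord_recl expr0 mulr1 big1 ?addr0 //.
by move=> i _; rewrite mul0r.
Qed.

End IntegralOver.

Section Scheme.
Variables (X : scheme) (K0 : function_field X).

(** On disjoint [V] and [U] the sections 1 and 0 would glue, and the germ of the result in the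
    function field would be both 1 and 0. *)
Lemma nonempty_opens_meet (V U : set X) : open V -> open U -> V !=set0 ->
  U !=set0 -> (V `&` U) !=set0.
Proof.
move=> oV oU nV nU; apply: contrapT => nVU.
have VU0 : V `&` U = set0 by apply/eqP/negPn/negP => /set0P.
pose W (b : bool) := if b then V else U.
have oW b : open (W b) by case: b.
pose s (b : bool) : sections (W b) := b%:R.
have WVU b : W b `<=` V `|` U by case: b => x; [left|right].
have [||t tP] := @sheaf_gluing X bool W (V `|` U) WVU s oW.
- by apply/seteqP; split=> [x [Vx|Ux]|x [b _ /WVU //]]; [exists true|exists false].
- move=> b c; have [<-|bc] := eqVneq b c; first by congr (restr _ _); exact: Prop_irrelevance.
  (* Any two sections over the empty overlap coincide, by locality for the empty cover. *)
  apply: (@sheaf_locality X False (fun=> set0) (W b `&` W c) (fun i => match i with end)) => //.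
  apply/seteqP; split=> x; last by case.
  have : (V `&` U) x -> False by rewrite VU0.
  by case: b c bc => [] [] //= _ h [? ?]; exfalso; apply: h.
have oVU : open (V `|` U) by exact: openU.
have nVU' : (V `|` U) !=set0 by case: nV => x Vx; exists x; left.
have := germ_restr K0 oV oVU nV nVU' (WVU true) t.
rewrite -(germ_restr K0 oU oVU nU nVU' (WVU false) t) (tP true) (tP false) rmorph1 rmorph0.
by move/eqP; rewrite oner_eq0.
Qed.

Section Affine.
Variables (U : set X) (oU : open U) (nU : U !=set0) (phi : X -> set (sections U)).
Let D f := [set x | U x /\ ~ phi x f].
Hypothesis phi_prime : forall x, U x -> prime_ideal (phi x).
Hypothesis phi_basis : forall V, V `<=` U ->
  (open V <-> exists S : set (sections U), V = \bigcup_(f in S) D f).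
Hypothesis phi_loc : forall f (DU : D f `<=` U), is_localization_at (restr DU) f.

Let g := germ K0 oU nU.

Lemma basic_open f : open (D f).
Proof.
apply/phi_basis; first by move=> x [].
by exists [set f]; rewrite bigcup_set1.
Qed.

Lemma affine_germ_unit y h : U y -> ~ phi y h ->
  g h != 0 /\ local_ring K0 y (g h)^-1.
Proof.
move=> Uy hy; have DU : D h `<=` U by move=> x [].
have [[b hb] _ _] := phi_loc DU.
have nD : D h !=set0 by exists y.
have e : g h * germ K0 (basic_open h) nD b = 1.
  by rewrite /g -(germ_restr K0 (basic_open h) oU nD nU DU) -rmorphM hb rmorph1.
have h0 : g h != 0.
  by apply/eqP => h0; move/eqP: e; rewrite h0 mul0r eq_sym oner_eq0.
split=> //; exists (D h), (basic_open h), nD, b; split=> //.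
by rewrite -[LHS]mulr1 -e mulKf.
Qed.

Lemma phiX y h n : U y -> ~ phi y h -> ~ phi y (h ^+ n).
Proof.
move=> Uy hy; have [_ _ _ _ [p1 pr]] := phi_prime Uy.
by elim: n => [|n IH]; rewrite ?expr0 // exprS => /pr[].
Qed.

Lemma local_section_frac (V : set X) (oV : open V) (nV : V !=set0)
    (s : sections V) y : U y -> V y ->
  exists a h, ~ phi y h /\ germ K0 oV nV s = g a / g h.
Proof.
move=> Uy Vy; have [|S VS] := (phi_basis (@subIsetr _ V U)).1; first exact: openI.
have : (V `&` U) y by [].
rewrite VS => -[h Sh [_ hy]].
have DVU : D h `<=` V `&` U by rewrite VS => x Dx; exists h.
have DU : D h `<=` U by move=> x [].
have DV : D h `<=` V by move=> x /DVU[].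
have nD : D h !=set0 by exists y.
have [_ /(_ (restr DV s)) [n [a e]] _] := phi_loc DU.
exists a, (h ^+ n); split; first exact: phiX.
have [h0 _] := affine_germ_unit Uy (@phiX _ _ n Uy hy).
apply/(canRL (mulfK h0)); rewrite /g.
rewrite -(germ_restr K0 (basic_open h) oV nD nV DV).
by rewrite -!(germ_restr K0 (basic_open h) oU nD nU DU) rmorphXn -rmorphM e.
Qed.

Lemma local_ring_germ y a : U y -> local_ring K0 y (g a).
Proof. by move=> Uy; exists U, oU, nU, a. Qed.

Lemma local_ring_frac y f : U y -> local_ring K0 y f ->
  exists a h, ~ phi y h /\ f = g a / g h.
Proof.
by move=> Uy [V [oV [nV [s [Vy ->]]]]]; exact: local_section_frac.
Qed.

(** Locality of the ring as a disjunction: numerator [a] and denominator [h] of [f] satisfy that [a]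
    or [h - a] lies outside the prime of [y], because [h] does. *)
Lemma local_ring_alternative y f : U y -> local_ring K0 y f ->
  (exists2 f', local_ring K0 y f' & f * f' = 1) \/
  (exists2 f', local_ring K0 y f' & (1 - f) * f' = 1).
Proof.
move=> Uy Of; have [a [h [hy fE]]] := local_ring_frac Uy Of.
have [h0 _] := affine_germ_unit Uy hy; have [_ _ LM] := local_ring_subring K0 y.
have [_ _ pD _ _] := phi_prime Uy.
have [ay|ay] := pselect (phi y a); [right|left].
  have hay : ~ phi y (h - a).
    by move=> ha; apply: hy; rewrite -[h](subrK a); exact: pD.
  have [ha0 hal] := affine_germ_unit Uy hay.
  exists (g h / g (h - a)); first by apply: (LM) => //; exact: local_ring_germ.
  have -> : 1 - f = g (h - a) / g h by rewrite fE rmorphB mulrBl divff.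
  by rewrite mulf_div [g h * _]mulrC divff // mulf_neq0.
have [a0 al] := affine_germ_unit Uy ay.
exists (g h / g a); first by apply: (LM) => //; exact: local_ring_germ.
by rewrite fE mulf_div [g h * _]mulrC divff // mulf_neq0.
Qed.

Hypothesis U_domain : forall s t : sections U, s * t = 0 -> s = 0 \/ t = 0.

Lemma domainX (s t : sections U) n : s ^+ n * t = 0 -> s <> 0 -> t = 0.
Proof.
move=> st s0; elim: n st => [|n IH]; first by rewrite expr0 mul1r.
by rewrite exprS -mulrA => /U_domain[//|/IH].
Qed.

Lemma basic_open_neq0 x f : D f x -> f <> 0.
Proof.
by move=> [Ux fx] f0; apply: fx; rewrite f0; have [] := phi_prime Ux.
Qed.

(** A vanishing germ vanishes on some nonempty [D f], so a power of the nonzero [f] kills [s] in a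
    domain. *)
Lemma germ_inj s : g s = 0 -> s = 0.
Proof.
move=> /germ_eq0 [V [VU [oV [y Vy] r0]]].
have [S VS] := (phi_basis VU).1 oV.
move: (Vy); rewrite {1}VS => -[f Sf Dfy].
have DU : D f `<=` U by move=> x [].
have DV : D f `<=` V by rewrite VS => x Dx; exists f.
have [_ _ /(_ s)[|n fns]] := phi_loc DU.
  by rewrite -(restr_comp DV VU) // ?r0 ?rmorph0 //; exact: basic_open.
by apply: domainX fns _; exact: basic_open_neq0 Dfy.
Qed.

Lemma local_ring_ideal_germ y a : U y -> phi y a -> local_ring_ideal K0 y (g a).
Proof.
move=> Uy ay; split; first exact: local_ring_germ.
move=> [f Of e]; have [b [h [hy fE]]] := local_ring_frac Uy Of.
have [h0 _] := affine_germ_unit Uy hy.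
have /germ_inj/eqP : g (b * a - h) = 0.
  by rewrite rmorphB rmorphM -[g h]mul1r -e fE -[_ * _ * g h]mulrA divfK // [g a * _]mulrC subrr.
rewrite subr_eq0 => /eqP ha; apply: hy; rewrite -ha.
by have [_ _ _ pM _] := phi_prime Uy; exact: pM.
Qed.

End Affine.
End Scheme.

(** * Maximal ideals and points of the normalization *)

Section MaximalIdeal.
Variables (A : comPzRingType) (S : set A).
Hypothesis sS : subring S.

Definition proper_ideal_of (I : set A) : Prop :=
  [/\ I `<=` S, I 0, forall a b, I a -> I b -> I (a + b),
      forall a b, S a -> I b -> I (a * b) & ~ I 1].

Lemma maximal_ideal_exists (I0 : set A) : proper_ideal_of I0 ->
  exists p, [/\ prime_ideal_of S p, I0 `<=` p
    & forall a, S a -> ~ p a -> exists i s, [/\ p i, S s & 1 = i + a * s]].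
Proof.
move=> pI0; have [H [J HJ] HQ _ Ht|p [pp I0p pmax]] := zorn_above pI0.
  split.
  - by move=> a [I HI Ia]; have [IS _ _ _ _] := HQ _ HI; exact: IS.
  - by exists J => //; have [] := HQ _ HJ.
  - move=> a b [I HI Ia] [I' HI' Ib]; have [II'|I'I] := Ht _ _ HI HI'.
      by exists I' => //; have [_ _ ID _ _] := HQ _ HI'; apply: ID => //; exact: II'.
    by exists I => //; have [_ _ ID _ _] := HQ _ HI; apply: ID => //; exact: I'I.
  - by move=> a b Sa [I HI Ib]; exists I => //; have [_ _ _ IM _] := HQ _ HI; exact: IM.
  - by move=> [I HI]; have [] := HQ _ HI.
have [pS p0 pD pM p1] := pp; have [S1 SB SM] := sS.
have pmax' a : S a -> ~ p a -> exists i s, [/\ p i, S s & 1 = i + a * s].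
  move=> Sa pa; apply: contrapT => no; apply: pa.
  apply: (pmax [set b | exists i s, [/\ p i, S s & b = i + a * s]]).
  - by move=> b pb; exists b, 0; rewrite mulr0 addr0; split=> //; exact: subring0.
  - split.
    + move=> _ [i [s [pi Ss ->]]]; apply: subringD => //; first exact: pS.
      exact: (SM).
    + by exists 0, 0; rewrite mulr0 addr0; split=> //; exact: subring0.
    + move=> _ _ [i [s [pi Ss ->]]] [j [t [pj St ->]]].
      exists (i + j), (s + t); split; [exact: pD | exact: subringD |].
      by rewrite mulrDr addrACA.
    + move=> b _ Sb [i [s [pi Ss ->]]]; exists (b * i), (b * s).
      by split; [exact: pM | exact: (SM) | rewrite mulrDr mulrCA].
    + by move=> [i [s [pi Ss e]]]; apply: no; exists i, s.
  - by exists 0, 1; rewrite mulr1 add0r.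
exists p; split=> //; split=> //; split=> // a b Sa Sb pab.
have [|pa] := pselect (p a); [by left | right]; apply: contrapT => pb.
have [i [s [pi Ss e]]] := pmax' _ Sa pa; have [j [t [pj St e']]] := pmax' _ Sb pb.
apply: p1; rewrite -[1]mulr1 {1}e e' mulrDl; apply: (pD).
  by rewrite mulrC; apply: (pM) => //; rewrite -e'.
rewrite mulrDr; apply: (pD).
  by apply: (pM) => //; exact: (SM).
by rewrite mulrACA mulrC; apply: (pM) => //; exact: (SM).
Qed.

End MaximalIdeal.

Section Points.
Variables (X : scheme) (K0 : function_field X).
Variables (K : closedFieldType) (iota : {rmorphism K0 -> K}).

Lemma iota_local_ring_subring y : subring (iota @` local_ring K0 y).
Proof.
have [L1 LB LM] := local_ring_subring K0 y; split.
- by exists 1; rewrite ?rmorph1.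
- by move=> _ _ [a La <-] [b Lb <-]; exists (a - b); rewrite ?rmorphB //; exact: LB.
- by move=> _ _ [a La <-] [b Lb <-]; exists (a * b); rewrite ?rmorphM //; exact: LM.
Qed.

Lemma stalk_closed y z :
  integral_over (normalization_stalk iota y) z -> normalization_stalk iota y z.
Proof. exact: (integral_over_trans (iota_local_ring_subring y)). Qed.

Lemma stalk_normalization_ring (U : set X) y z : U y ->
  normalization_ring iota U z -> normalization_stalk iota y z.
Proof.
move=> Uy; apply: integral_over_sub => _ [oU [nU [s ->]]].
by exists (germ K0 oU nU s) => //; exists U, oU, nU, s.
Qed.

Lemma stalk_sub y a : local_ring K0 y a -> normalization_stalk iota y (iota a).
Proof.
move=> La; exists ('X - (iota a)%:P); split; first exact: monicXsubC.
  have sO := iota_local_ring_subring y; have [_ OB _] := sO.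
  move=> i; rewrite coefB coefX coefC; apply: (OB).
    exact: (subring_nat sO).
  by case: eqP => _; [exists a | exact: (subring0 sO)].
by rewrite root_XsubC.
Qed.

Lemma point_residue_closed (x : Defs.point iota) : GRing.closed_field_axiom (kappa x).
Proof. exact: (@residue_closed K (spec_pt x) (@stalk_closed (base x))). Qed.

Lemma local_alternative (y : X) f : local_ring K0 y f ->
  (exists2 f', local_ring K0 y f' & f * f' = 1) \/
  (exists2 f', local_ring K0 y f' & (1 - f) * f' = 1).
Proof.
move=> Of; have [U [oU [phi [pp _ _ pb pl]]] Uy] := scheme_affine y.
by apply: (@local_ring_alternative X K0 U oU (ex_intro _ y Uy) phi) => //.
Qed.

(** Any maximal ideal [p] of the stalk lies over [y]. If [a = iota f] were outside [p], some [s]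
    would satisfy [a * s = 1] modulo [p]. Multiplied by [a ^ n], the integral equation of [s] then
    puts an element [1 + a * b] into [p], with [b] from the local ring of [y]. This element is not a
    unit there, so [- a * b] is one, and [f] is invertible. *)
Lemma lying_over (y : X) : exists x : Defs.point iota, base x = y.
Proof.
pose S := normalization_stalk iota y; pose O := iota @` local_ring K0 y.
have sS : subring S := normalization_stalk_subring iota y.
have sO : subring O := iota_local_ring_subring y.
have [S1 SB SM] := sS; have [_ OB OM] := sO.
have [|p [pp _ pmax]] := maximal_ideal_exists sS (I0 := [set 0]).
  split=> //=.
  - by move=> _ ->; exact: subring0.
  - by move=> a b -> ->; rewrite addr0.
  - by move=> a b _ ->; rewrite mulr0.
  - by move/eqP; rewrite oner_eq0.
have [pS p0 pD pM [p1 pr]] := pp.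
have unit_notin f g : local_ring K0 y g -> f * g = 1 -> ~ p (iota f).
  move=> Og fg pf; apply: p1; rewrite -(rmorph1 iota) -fg rmorphM mulrC.
  by apply: (pM) => //; exact: stalk_sub.
have over f : local_ring K0 y f -> (p (iota f) <-> local_ring_ideal K0 y f).
  move=> Of; split=> [pf|[_ nf]].
    by split=> // -[g Og fg]; exact: (unit_notin _ _ Og fg pf).
  apply: contrapT => npf.
  have [i [s [pi Ss e1]]] := pmax _ (stalk_sub Of) npf.
  have [q [mq qO qs]] := Ss; pose a := iota f.
  have Oa : O a by exists f.
  have pN b : p b -> p (- b).
    by move=> pb; rewrite -mulN1r; apply: (pM) => //; exact: subringN.
  have Sas : S (a * s) by apply: (SM) => //; exact: stalk_sub.
  have pas j : p ((a * s) ^+ j - 1).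
    elim: j => [|j IH]; first by rewrite expr0 subrr.
    rewrite exprS; have -> : a * s * (a * s) ^+ j - 1 =
      a * s * ((a * s) ^+ j - 1) - i by rewrite mulrBr mulr1 -addrA -opprD -/a [a * s + i]addrC -e1.
    by apply: (pD); [exact: pM | exact: pN].
  have [n sq] : exists n, size q = n.+1.
    by exists (size q).-1; rewrite prednK // size_poly_gt0 monic_neq0.
  have qn : q`_n = 1 by move/monicP: mq; rewrite lead_coefE sq.
  pose b := \sum_(j < n) q`_j * a ^+ (n - j.+1).
  have Ob : O b.
    apply: (big_ind O); [exact: subring0 | exact: subringD |].
    by move=> j _; apply: (OM); [exact: qO | exact: subringX].
  have pab : p (1 + a * b).
    have e : \sum_(j < n.+1) q`_j * a ^+ (n - j) * (a * s) ^+ j = 0.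
      transitivity (a ^+ n * q.[s]); last by rewrite (rootP qs) mulr0.
      rewrite horner_coef sq mulr_sumr; apply: eq_bigr => j _.
      rewrite exprMn [RHS]mulrCA -!mulrA; congr (_ * _).
      by rewrite mulrA -exprD subnK // -ltnS.
    have -> : 1 + a * b = - \sum_(j < n.+1) q`_j * a ^+ (n - j) * ((a * s) ^+ j - 1).
      under eq_bigr => j _ do rewrite mulrBr mulr1.
      rewrite sumrB e sub0r opprK big_ord_recr /= qn subnn expr0 mulr1 addrC.
      rewrite /b mulr_sumr; congr (_ + _); apply: eq_bigr => j _.
      by rewrite mulrCA -exprS subnSK.
    apply: pN; apply: (big_ind p) => // j _; apply: (pM) => //.
    apply: (SM); last by apply: subringX => //; exact: stalk_sub.
    by have [c Oc <-] := qO j; exact: stalk_sub.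
  have [w Ow wE] : O (1 + a * b) by apply: (subringD sO); [case: sO | exact: (OM _ _ Oa Ob)].
  have [c Oc cE] := Ob.
  case: (local_alternative Ow) => [[g Og gE]|[g Og gE]].
    by apply: (unit_notin _ _ Og gE); rewrite wE.
  apply: nf; exists (- c * g).
    have [L1 LB LM] := local_ring_subring K0 y.
    by apply: (LM) => //; apply: subringN.
  apply: (fmorph_inj iota); rewrite -gE !rmorphM rmorphB rmorphN rmorph1 wE cE.
  by rewrite opprD addrA subrr add0r mulrA mulrN.
by exists (@Point X K0 K iota y p pp over).
Qed.

End Points.

(** * The generic point *)

Section GenericResidue.
Variables (K : closedFieldType) (C : fieldType) (y : spec_point K).
Hypothesis ideal0 : forall z, sp_ideal y z -> z = 0.
Hypothesis ringT : forall z, sp_ring y z.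
Variable chi : character C K.

Let maximal0 z : in_maximal y z -> z = 0.
Proof. by move=> /asboolP[a [b [/ideal0 -> _ _ ->]]]; rewrite mul0r. Qed.

Let lift (c : residue y) : K := xget 0 [set z | reduce y z = c].

Let reduce_inj z w : reduce y z = reduce y w -> z = w.
Proof.
move=> e; apply/eqP; rewrite -subr_eq0; apply/eqP/maximal0.
have L v : in_local y v by apply: in_local_ring; exact: ringT.
apply/(reduce_eq0 (L _)); apply: (addIr (reduce y w)).
by rewrite -(reduceD (L _) (L _)) subrK e add0r.
Qed.

Let liftK c : reduce y (lift c) = c.
Proof.
have [z [_ zc]] := reduce_surj c.
exact: (@xgetPex _ 0 [set z | reduce y z = c]) (ex_intro _ z zc).
Qed.

Fact generic_char_eq0 c : chi (lift c) = 0 <-> c = 0.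
Proof.
rewrite char_eq0; split=> [l0|->]; first by rewrite -(liftK c) l0 reduce0.
by apply: reduce_inj; rewrite liftK reduce0.
Qed.

Fact generic_char1 : chi (lift 1) = 1.
Proof.
rewrite -[RHS](char1 chi); congr (chi _); apply: reduce_inj.
by rewrite liftK reduce1.
Qed.

Fact generic_charM c d : chi (lift (c * d)) = chi (lift c) * chi (lift d).
Proof.
have L v : in_local y v by apply: in_local_ring; exact: ringT.
rewrite -charM; congr (chi _); apply: reduce_inj.
by rewrite (reduceM (L _) (L _)) !liftK.
Qed.

(** With zero ideal and full ring, [reduce] is a bijection from [K] to the residue field; [chi] is
    transported along its inverse [lift]. *)
Definition generic_char : character C (residue y) :=
  Character generic_char_eq0 generic_char1 generic_charM.

Lemma generic_charE z : generic_char (reduce y z) = chi z.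
Proof. by rewrite /=; congr (chi _); apply: reduce_inj; rewrite liftK. Qed.

Lemma reduce_full_surj c : exists z, reduce y z = c.
Proof. by have [z [_ zc]] := reduce_surj c; exists z. Qed.

End GenericResidue.

Section GenericPoint.
Variables (X : scheme) (K0 : function_field X).

(** The point is the zero ideal of one affine open [U]. A nonempty open set meets [U] in a union of
    sets [D h], one of them with [h] nonzero, and this one contains the point. *)
Lemma generic_point_exists : integral_scheme X ->
  exists eta : X, forall V, open V -> V !=set0 -> V eta.
Proof.
move=> [[x _] iX]; have [U aU Ux] := scheme_affine x.
have [oU [phi [pp _ psurj pb pl]]] := aU; have nU : U !=set0 by exists x.
have [U10 Udom] := iX U oU nU.
have [|eta Ueta pe] := psurj [set 0].
  split=> //=.
  - by move=> a b -> ->; rewrite addr0.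
  - by move=> a b _ ->; rewrite mulr0.
  - by split=> [/U10|a b _ _] //; exact: Udom.
exists eta => V oV nV; have [y [Vy Uy]] := nonempty_opens_meet K0 oV oU nV nU.
have [|S VS] := (pb _ (@subIsetr _ V U)).1; first exact: openI.
have : (V `&` U) y by [].
rewrite VS => -[h Sh Dhy]; have h0 := basic_open_neq0 pp Dhy.
suff : (V `&` U) eta by case.
rewrite VS; exists h => //; split=> //; by rewrite pe.
Qed.

Variables (K : closedFieldType) (iota : {rmorphism K0 -> K}).

Lemma generic_point_over : integral_scheme X ->
  (forall z : K, algebraicOver iota z) ->
  exists x : Defs.point iota, [/\ forall V, open V -> V !=set0 -> V (base x),
    forall z, sp_ideal (spec_pt x) z -> z = 0
    & forall z, sp_ring (spec_pt x) z].
Proof.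
move=> iX alg; have [eta etaP] := generic_point_exists iX.
have full f : local_ring K0 eta f.
  have [U [oU [nU [s ->]]]] := germ_surj f.
  by exists U, oU, nU, s; split=> //; exact: etaP.
have ring z : normalization_stalk iota eta z.
  have /integral_algebraic[p mp pz] := alg z.
  exists (map_poly iota p); split=> //; first by rewrite map_monic.
  by move=> i; rewrite coef_map; exists p`_i.
have pr : prime_ideal_of (normalization_stalk iota eta) [set 0].
  split=> //=.
  - by move=> a b -> ->; rewrite addr0.
  - by move=> a b _ ->; rewrite mulr0.
  - split=> [/eqP|a b _ _ /eqP]; first by rewrite oner_eq0.
    by rewrite mulf_eq0 => /orP[/eqP|/eqP]; [left|right].
have over f : local_ring K0 eta f ->
    ([set 0] (iota f) <-> local_ring_ideal K0 eta f).
  move=> Of /=; split=> [/eqP|[_ nf]].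
    rewrite fmorph_eq0 => /eqP ->; split=> // -[g _ /eqP].
    by rewrite mul0r eq_sym oner_eq0.
  apply/eqP; rewrite fmorph_eq0; apply/negPn/negP => f0; apply: nf.
  by exists f^-1 => //; rewrite divff.
by exists (@Point X K0 K iota eta _ pr over).
Qed.

End GenericPoint.

(** * Arithmetic of schemes of finite type over the integers *)

Section InvertiblePrimes.
Variable F : fieldType.
Implicit Types (B : set F) (a b c : F) (p q : {poly F}).

Definition coefs_in B p : Prop := forall i, B p`_i.

Definition adjoin B a : set F := [set x | exists2 p, coefs_in B p & x = p.[a]].

Definition localize B c : set F := [set x | exists n, B (x * c ^+ n)].

Fixpoint adjoin_seq B (s : seq F) : set F :=
  if s is a :: s' then adjoin_seq (adjoin B a) s' else B.

Lemma coefs_inM B p q : subring B -> coefs_in B p -> coefs_in B q ->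
  coefs_in B (p * q).
Proof.
move=> sB Bp Bq i; rewrite coefM; have [_ _ BM] := sB.
by apply: (big_ind B) => [||j _]; [exact: subring0|exact: subringD|exact: BM].
Qed.

Lemma coefs_in1 B : subring B -> coefs_in B 1.
Proof.
move=> sB i; rewrite coef1; exact: subring_nat.
Qed.

Lemma coefs_inX B p n : subring B -> coefs_in B p -> coefs_in B (p ^+ n).
Proof.
move=> sB Bp; elim: n => [|n IH]; first exact: coefs_in1.
by rewrite exprS; exact: coefs_inM.
Qed.

Lemma adjoin_subring B a : subring B -> subring (adjoin B a).
Proof.
move=> sB; have [B1 BB BM] := sB; split.
- by exists 1; [exact: coefs_in1 | rewrite hornerC].
- move=> _ _ [p Bp ->] [q Bq ->]; exists (p - q); last by rewrite hornerD hornerN.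
  by move=> i; rewrite coefB; exact: BB.
- move=> _ _ [p Bp ->] [q Bq ->]; exists (p * q); last by rewrite hornerM.
  exact: coefs_inM.
Qed.

Lemma adjoin_sub B a : subring B -> B `<=` adjoin B a.
Proof.
move=> sB b Bb; exists b%:P; last by rewrite hornerC.
by move=> i; rewrite coefC; case: eqP => _ //; exact: subring0.
Qed.

Lemma adjoin_gen B a : subring B -> adjoin B a a.
Proof.
move=> sB; exists 'X; last by rewrite hornerX.
by move=> i; rewrite coefX; exact: subring_nat.
Qed.

Lemma adjoin_seq_subring B s : subring B -> subring (adjoin_seq B s).
Proof. by elim: s B => //= a s IH B sB; apply: (IH); exact: adjoin_subring. Qed.

Lemma adjoin_seq_sub B s : subring B -> B `<=` adjoin_seq B s.
Proof.
elim: s B => [|a s IH] B sB b Bb //=.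
by apply: (IH); [exact: adjoin_subring | exact: adjoin_sub].
Qed.

Lemma adjoin_seq_gen B s a : subring B -> a \in s -> adjoin_seq B s a.
Proof.
elim: s B => //= b s IH B sB; rewrite in_cons => /orP[/eqP ->|].
  by apply: adjoin_seq_sub; [exact: adjoin_subring | exact: adjoin_gen].
by apply: IH; exact: adjoin_subring.
Qed.

Lemma localize_subring B c : subring B -> B c -> subring (localize B c).
Proof.
move=> sB Bc; have [B1 BB BM] := sB; split.
- by exists 0%N; rewrite expr0 mulr1.
- move=> x y [m Bx] [n By]; exists (m + n)%N.
  rewrite mulrBl; apply: (BB).
    by rewrite exprD mulrA; apply: (BM) => //; exact: subringX.
  by rewrite addnC exprD mulrA; apply: (BM) => //; exact: subringX.
- move=> x y [m Bx] [n By]; exists (m + n)%N.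
  by rewrite exprD mulrACA; exact: BM.
Qed.

Lemma localize_sub B c : B `<=` localize B c.
Proof. by move=> b Bb; exists 0%N; rewrite expr0 mulr1. Qed.

Lemma localizeM B c d : subring B -> B c -> B d ->
  localize B c `<=` localize B (c * d).
Proof.
move=> sB Bc Bd x [n Bx]; exists n; have [_ _ BM] := sB.
by rewrite exprMn mulrA; apply: (BM) => //; exact: subringX.
Qed.

Lemma localize_div B c a n : subring B -> B c -> B a -> c != 0 ->
  localize B c (a / c ^+ n).
Proof.
by move=> sB Bc Ba c0; exists n; rewrite divfK // expf_neq0.
Qed.

Lemma integral_over_lead B p a : subring B -> coefs_in B p -> p != 0 ->
  root p a -> integral_over (localize B (lead_coef p)) a.
Proof.
move=> sB Bp p0 pa; have lc0 : lead_coef p != 0 by rewrite lead_coef_eq0.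
exists ((lead_coef p)^-1 *: p); split.
- by rewrite monicE lead_coefZ mulVf.
- move=> i; rewrite coefZ mulrC -[lead_coef p in X in _ * X]expr1.
  by apply: localize_div => //; exact: Bp.
- by rewrite rootE hornerZ (rootP pa) mulr0.
Qed.

(** A monic equation of degree [n + 1] for [c^-1], multiplied by [c ^ n], writes [c^-1] as a
    polynomial in [c]. *)
Lemma integral_over_inv B c : subring B -> B c -> c != 0 ->
  integral_over B c^-1 -> B c^-1.
Proof.
move=> sB Bc c0 [q [mq Bq qc]]; have [_ _ BM] := sB.
have [n sq] : exists n, size q = n.+1.
  by exists (size q).-1; rewrite prednK // size_poly_gt0 monic_neq0.
have qn : q`_n = 1 by move/monicP: mq; rewrite lead_coefE sq.
case: n sq qn => [|n] sq qn.
  move: qc; rewrite rootE horner_coef sq big_ord1 qn expr0 mulr1.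
  by rewrite oner_eq0.
have e : c ^+ n * q.[c^-1] = 0 by rewrite (rootP qc) mulr0.
rewrite horner_coef sq big_ord_recr /= qn mul1r mulrDr in e.
have {e} : c^-1 = - (c ^+ n * \sum_(i < n.+1) q`_i * c^-1 ^+ i).
  apply/eqP; rewrite -addr_eq0 addrC; apply/eqP; rewrite -[RHS]e; congr (_ + _).
  by rewrite exprSr mulrA exprVn (divff (expf_neq0 n c0)) mul1r.
move=> ->; apply: subringN => //; rewrite mulr_sumr.
apply: (big_ind B); [exact: subring0 | exact: subringD|] => i _.
have le_in : ((c == 0%R) + i <= n)%N by rewrite (negbTE c0) add0n -ltnS.
rewrite mulrCA exprVn -(expfB_cond le_in).
by apply: (BM) => //; exact: subringX.
Qed.

Lemma adjoin_integral B a : subring B -> integral_over B a ->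
  adjoin B a `<=` integral_over B.
Proof.
move=> sB Ba _ [p Bp ->]; have sI := integral_closure_subring sB.
have [_ _ IM] := sI.
rewrite horner_coef; apply: (big_ind (integral_over B)).
- exact: subring0.
- by move=> x y; exact: subringD.
- move=> i _; apply: (IM); last exact: subringX.
  exists ('X - (p`_i)%:P); split; first exact: monicXsubC.
    have [_ BB _] := sB; move=> j; rewrite coefB coefX coefC; apply: (BB).
      exact: subring_nat.
    by case: eqP => _ //; exact: subring0.
  by rewrite root_XsubC.
Qed.

Lemma root_div_Xn q x : q != 0 -> root q x -> x != 0 ->
  exists q', [/\ forall i, exists j, q'`_i = q`_j, q'`_0 != 0 & root q' x].
Proof.
elim: {q}(size q) {-2}q (leqnn (size q)) => [|n IH] q.
  by rewrite leqn0 size_poly_eq0 => ->.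
move=> sq q0 qx x0; have [q00|q00] := eqVneq q`_0 0; last first.
  by exists q; split=> // i; exists i.
pose r := \poly_(i < (size q).-1) q`_i.+1.
have rE i : r`_i = q`_i.+1.
  rewrite coef_poly; case: ltnP => // h; rewrite nth_default //.
  by rewrite -[size q]prednK // size_poly_gt0.
have qE : q = r * 'X.
  by apply/polyP => i; rewrite coefMX rE; case: i => //= ; rewrite q00.
have r0 : r != 0 by apply: contraNneq q0 => r0; rewrite qE r0 mul0r.
have sr : (size r <= n)%N.
  by rewrite (leq_trans (size_poly _ _)) // -ltnS prednK // size_poly_gt0.
have rx : root r x by move: qx; rewrite qE rootM rootX (negbTE x0) orbF.
have [q' [q'1 q'2 q'3]] := IH r sr r0 rx x0.
exists q'; split=> // i; have [j ->] := q'1 i; exists j.+1; exact: rE.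
Qed.

(** Descent of denominators from [B[a]] to [B], with [c] independent of [b] and [n]. Write
    [c1 = p(a)]. If [a] is transcendental, [p ^ n] and [b * q] agree as polynomials and comparing
    leading coefficients allows [c = lead_coef p]. If [a] is algebraic, [c] is chosen such that [a]
    and [c1^-1] become integral over [B[1/c]]; then so is [b^-1], which therefore lies in
    [B[1/c]]. *)
Lemma adjoin_inverse B a c1 : subring B -> adjoin B a c1 -> c1 != 0 ->
  exists c, [/\ B c, c != 0 & forall b n, B b -> b != 0 ->
    adjoin B a (c1 ^+ n / b) -> localize B c b^-1].
Proof.
move=> sB [p Bp c1E] c10; have [_ _ BM] := sB.
have [[r [Br r0 ra]]|notr] :=
    pselect (exists r, [/\ coefs_in B r, r != 0 & root r a]); last first.
  have p0 : p != 0 by apply: contraNneq c10 => p0; rewrite c1E p0 horner0.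
  exists (lead_coef p); split; [exact: Bp | by rewrite lead_coef_eq0 |].
  move=> b n Bb b0 [q Bq qE]; exists n.
  have e : p ^+ n = b *: q.
    apply/eqP; rewrite -subr_eq0; apply: contrapT => /negP ne; apply: notr.
    exists (p ^+ n - b *: q); split=> //.
      move=> i; rewrite coefB coefZ; have [_ BB _] := sB; apply: (BB).
        exact: coefs_inX.
      exact: BM.
    rewrite rootE hornerD hornerN hornerZ horner_exp -c1E -qE mulrC divfK //.
    by rewrite subrr.
  have := congr1 lead_coef e; rewrite lead_coef_exp lead_coefZ => ->.
  by rewrite mulKf //; exact: Bq.
pose l := lead_coef r.
have Bl : B l by exact: Br.
have l0 : l != 0 by rewrite lead_coef_eq0.
have sBl := localize_subring sB Bl.
have ia : integral_over (localize B l) a := integral_over_lead sB Br r0 ra.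
have sub_adj c : B c -> adjoin B a `<=` adjoin (localize B c) a.
  by move=> Bc _ [q Bq ->]; exists q => // i; apply: localize_sub; exact: Bq.
have [q [mq Bq qc1]] : integral_over (localize B l) c1.
  by apply: (adjoin_integral sBl ia); apply: sub_adj => //; exists p.
have [q' [q'1 q'0 q'c1]] := root_div_Xn (monic_neq0 mq) qc1 c10.
have [n0 Bd] : localize B l q'`_0 by have [j ->] := q'1 0%N; exact: Bq.
(* The constant term of an equation for [c1], brought into [B] by a power of [l]. Inverting [l]
   makes [a] integral, inverting [d] makes [c1^-1] integral. *)
pose d := q'`_0 * l ^+ n0; have d0 : d != 0 by rewrite mulf_neq0 // expf_neq0.
exists (l * d); split; [exact: BM | exact: mulf_neq0 |].
have Bld : B (l * d) by exact: BM.
have sB' := localize_subring sB Bld.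
pose B' := localize B (l * d).
have lB' : localize B l `<=` B' := localizeM sB Bl Bd.
have B'V : B' (q'`_0)^-1.
  have -> : (q'`_0)^-1 = l ^+ n0.+1 / (l * d) ^+ 1.
    rewrite expr1 /d exprS invfM mulrACA divff // mul1r invfM mulrCA divff ?mulr1 //.
    by rewrite expf_neq0.
  exact: (localize_div 1 sB Bld (subringX sB n0.+1 Bl) (mulf_neq0 l0 d0)).
have sub_int (A1 A2 : set F) : A1 `<=` A2 -> integral_over A1 `<=` integral_over A2.
  by move=> A12 x [t [mt At tx]]; exists t; split=> // i; exact: A12.
have ia' : integral_over B' a := sub_int _ _ lB' _ ia.
have sI := integral_closure_subring sB'; have [_ _ IM] := sI.
have ic1 : integral_over B' c1.
  by apply: (adjoin_integral sB' ia'); apply: sub_adj => //; exists p.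
have iV : integral_over B' c1^-1.
  pose t := \poly_(i < (size q').-1) q'`_i.+1.
  have tE i : t`_i = q'`_i.+1.
    rewrite coef_poly; case: ltnP => // h; rewrite nth_default //.
    by move: h; case: (size q').
  have q'E : q' = t * 'X + (q'`_0)%:P.
    by apply/polyP => i; rewrite coefD coefMX coefC; case: i => [|i] /=;
      rewrite ?tE ?add0r ?addr0.
  have -> : c1^-1 = - (q'`_0)^-1 * t.[c1].
    apply: (mulIf c10); rewrite mulVf // -mulrA.
    have : t.[c1] * c1 = - q'`_0.
      by apply/eqP; rewrite -addr_eq0; move/eqP: q'c1; rewrite {1}q'E !hornerE => /eqP.
    by move=> ->; rewrite mulrNN mulVf.
  apply: (adjoin_integral sB' ic1); exists (- (q'`_0)^-1 *: t); last by rewrite hornerZ.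
  move=> i; rewrite coefZ; have [_ _ B'M] := sB'; apply: (B'M); first exact: subringN.
  by rewrite tE; have [j ->] := q'1 i.+1; apply: lB'; exact: Bq.
move=> b n Bb b0 /(sub_adj _ Bld)/(adjoin_integral sB' ia') ib.
apply: integral_over_inv => //; first exact: localize_sub.
have -> : b^-1 = c1 ^+ n / b * c1^-1 ^+ n.
  by rewrite exprVn mulrAC divff ?mul1r // expf_neq0.
by apply: (IM) => //; exact: subringX.
Qed.

Lemma adjoin_seq_inverse s B d : subring B -> adjoin_seq B s d -> d != 0 ->
  exists c, [/\ B c, c != 0 & forall b, B b -> b != 0 ->
    localize (adjoin_seq B s) d b^-1 -> localize B c b^-1].
Proof.
elim: s B => /= [|a s IH] B sB Bd d0; first by exists d.
have sBa := adjoin_subring a sB.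
have [c1 [Bc1 c10 c1P]] := IH _ sBa Bd d0.
have [c [Bc c0 cP]] := adjoin_inverse sB Bc1 c10.
exists c; split=> // b Bb b0 /(c1P _ (adjoin_sub a sB Bb) b0) [n].
by rewrite mulrC; exact: cP.
Qed.

End InvertiblePrimes.

(** The image of [A] lies in the ring obtained from the integers by adjoining finitely many
    elements. Descending denominators through these gives an integer [z] such that a prime
    invertible in [A] is invertible in [Z[1/z]], hence divides [z]. *)
Lemma finitely_many_invertible_primes (A : comPzRingType) (F : fieldType)
    (g : {rmorphism A -> F}) :
  (forall n, (0 < n)%N -> n%:R != 0 :> F) -> finite_type_over_Z A ->
  exists2 N, (0 < N)%N & forall p a, prime p -> p%:R * a = 1 :> A -> (p %| N)%N.
Proof.
move=> char0 [s sA]; pose B : set F := [set z%:~R | z in setT].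
have sB : subring B.
  split; first by exists 1.
    by move=> _ _ [z _ <-] [w _ <-]; exists (z - w); rewrite ?rmorphB.
  by move=> _ _ [z _ <-] [w _ <-]; exists (z * w); rewrite ?rmorphM.
have sBs := adjoin_seq_subring (map g s) sB; have [S1 SB SM] := sBs.
have gA a : adjoin_seq B (map g s) (g a).
  suff : [set a | adjoin_seq B (map g s) (g a)] = setT.
    by move/seteqP => [_ /(_ a)]; exact.
  apply: sA.
    split=> /=; first by rewrite rmorph1.
      by move=> b c ? ?; rewrite rmorphB; exact: SB.
    by move=> b c ? ?; rewrite rmorphM; exact: SM.
  move=> b bs; rewrite inE /=; apply: adjoin_seq_gen => //.
  exact: map_f.
have [_ [[z _ <-] z0 zP]] := adjoin_seq_inverse sB S1 (oner_neq0 F).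
have intF (w : int) : (w%:~R == 0 :> F) = (w == 0).
  case: w => n; rewrite ?NegzE ?rmorphN ?oppr_eq0 /= -pmulrn;
    by [case: n => [|n]; rewrite ?eqxx //; apply/negbTE; exact: char0
       | apply/negbTE; exact: char0].
exists `|z|%N; first by rewrite absz_gt0 -intF.
move=> p a p_pr pa; have p0 : p%:R != 0 :> F by apply: char0; exact: prime_gt0.
have gV : (p%:R : F)^-1 = g a.
  by apply: (mulfI p0); rewrite divff // -(rmorph_nat g) -rmorphM pa rmorph1.
have [||n [w _ wE]] := zP p%:R _ p0; first by exists p%:Z.
  by rewrite gV; apply: localize_sub.
have : (z ^+ n = p%:Z * w)%R.
  apply/eqP; rewrite -subr_eq0 -intF rmorphB rmorphM rmorphXn /= wE.
  by rewrite mulrA divff // mul1r subrr.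
move/(congr1 absz); rewrite abszX abszM /= => e.
have : (p %| `|z| ^ n)%N by rewrite e dvdn_mulr.
by rewrite Euclid_dvdX // => /andP[].
Qed.

(** * Countability of rings of finite type and of algebraic closures *)

Section Enumeration.

Definition enumerable (T : Type) : Prop := exists e : nat -> T, forall x, exists n, e n = x.

Lemma enumerable_image (S T : Type) (f : S -> T) : enumerable S ->
  (forall y, exists x, f x = y) -> enumerable T.
Proof.
move=> [e eS] fT; exists (f \o e) => y; have [x <-] := fT y.
by have [n <-] := eS x; exists n.
Qed.

Lemma countType_enumerable (T : countType) : T -> enumerable T.
Proof.
move=> x0; exists (fun n => odflt x0 (unpickle n)) => x; exists (pickle x).
by rewrite pickleK.
Qed.

Lemma enumerable_seq (T : Type) : enumerable T -> enumerable (seq T).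
Proof.
move=> [e eT]; apply: (enumerable_image (f := map e)).
  exact: (@countType_enumerable (seq nat) [::]).
elim=> [|x s [l <-]]; first by exists [::].
by have [n <-] := eT x; exists (n :: l).
Qed.

Lemma enumerable_prod (S T : Type) : enumerable S -> enumerable T -> enumerable (S * T).
Proof.
move=> [e eS] [f fT]; apply: (enumerable_image (f := fun mn : nat * nat => (e mn.1, f mn.2))).
  exact: (@countType_enumerable (nat * nat)%type (0%N, 0%N)).
move=> [x y]; have [m <-] := eS x; have [n <-] := fT y.
by exists (m, n).
Qed.

Lemma enumerable_units (F : fieldType) : enumerable F ->
  exists u : nat -> F, (forall n, u n != 0) /\
    forall a, a != 0 -> exists n, u n = a.
Proof.
move=> [e eF]; exists (fun n => if e n == 0 then 1 else e n); split=> [n|a a0].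
  by case: ifPn => // _; rewrite oner_neq0.
by have [n na] := eF a; exists n; rewrite na (negbTE a0).
Qed.

Lemma finite_type_enumerable (A : comPzRingType) : finite_type_over_Z A ->
  enumerable A.
Proof.
move=> [s sA].
pose next (l : seq A) := 1 :: l ++ [seq a - b | a <- l, b <- l] ++ [seq a * b | a <- l, b <- l].
pose L n := iter n next s.
have LS n : {subset L n <= L n.+1}.
  by move=> a aL; rewrite /L iterS /next in_cons mem_cat aL orbT.
have Lmono m n : (m <= n)%N -> {subset L m <= L n}.
  move=> /subnKC <-; elim: (n - m)%N => [|j IH]; first by rewrite addn0.
  by move=> a /IH /LS; rewrite addnS.
have two a b : (exists n, a \in L n) -> (exists n, b \in L n) ->
    exists n, a \in L n /\ b \in L n.
  move=> [m am] [n bn]; exists (maxn m n); split.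
    by apply: Lmono am; exact: leq_maxl.
  by apply: Lmono bn; exact: leq_maxr.
have all a : exists n, a \in L n.
  suff : [set a | exists n, a \in L n] = setT by move/seteqP => [_ /(_ a)]; exact.
  apply: sA; last by move=> b bs; rewrite inE; exists 0%N.
  split=> /=.
  - by exists 1%N; rewrite /L /= /next mem_head.
  - move=> b c bL cL; have [n [bn cn]] := two _ _ bL cL; exists n.+1.
    rewrite /L iterS /next in_cons !mem_cat.
    by apply/orP; right; apply/orP; right; apply/orP; left; apply/allpairsP; exists (b, c).
  - move=> b c bL cL; have [n [bn cn]] := two _ _ bL cL; exists n.+1.
    rewrite /L iterS /next in_cons !mem_cat.
    by apply/orP; right; apply/orP; right; apply/orP; right; apply/allpairsP; exists (b, c).
apply: (enumerable_image (f := fun mn : nat * nat => nth 0 (L mn.1) mn.2)).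
  exact: (@countType_enumerable (nat * nat)%type (0%N, 0%N)).
move=> a; have [n an] := all a; exists (n, index a (L n)) => /=.
exact: nth_index.
Qed.

Lemma algebraic_enumerable (F : fieldType) (K : closedFieldType)
    (iota : {rmorphism F -> K}) :
  enumerable F -> (forall z : K, algebraicOver iota z) -> enumerable K.
Proof.
move=> eF alg; pose rs (p : {poly F}) := sval (closed_field_poly_normal (map_poly iota p)).
apply: (enumerable_image (f := fun mn : seq F * nat => nth 0 (rs (Poly mn.1)) mn.2)).
  apply: enumerable_prod; first exact: enumerable_seq.
  exact: (@countType_enumerable nat 0%N).
move=> z; have [p p0 pz] := alg z.
have zr : z \in rs p.
  rewrite /rs; case: closed_field_poly_normal => r /= e.
  move: pz; rewrite e rootZ ?root_prod_XsubC //.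
  by rewrite lead_coef_eq0 map_poly_eq0.
by exists (p : seq F, index z (rs p)); rewrite /= polyseqK nth_index.
Qed.

End Enumeration.

(** * Flatness over the integers and characteristic zero *)

Section FlatZ.

Definition int_mulrn (n : nat) (z : int) : int := z *+ n.

Fact int_mulrn_additive n : zmod_morphism (int_mulrn n).
Proof. by move=> z w; rewrite /int_mulrn mulrnBl. Qed.

HB.instance Definition _ n :=
  GRing.isZmodMorphism.Build int int (int_mulrn n) (int_mulrn_additive n).

(** Multiplication by [n] is injective on [int] and sends the tensor of 1 and [m] to that of [n] and
    [m], which is the tensor of 1 and [m *+ n] and so vanishes. By flatness the tensor of 1 and [m]
    vanishes, and the action of [int] on [M] evaluates it to [m]. *)
Lemma flat_torsion_free (M : zmodType) (m : M) n : flat_over_Z M -> (0 < n)%N ->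
  m *+ n = 0 -> m = 0.
Proof.
move=> fM n0 mn; have inj : injective (int_mulrn n).
  move=> z w; rewrite /int_mulrn => /eqP; rewrite -subr_eq0 -mulrnBl mulrn_eq0.
  by rewrite eqn0Ngt n0 subr_eq0 => /eqP.
suff t0 : tensor_eq0 [:: (1 : int, m)].
  have := t0 M (fun z x => x *~ z); rewrite big_seq1 /= mulr1z; apply.
    by move=> x z w; rewrite mulrzBr.
  by move=> z x y; rewrite mulrzBl.
apply: (fM int int (int_mulrn n) inj) => P b bl br; rewrite big_seq1 /=.
  have b0 : b 1 0 = 0 by have := br 1 0 0; rewrite !subrr.
  have bN z : b (- z) m = - b z m.
    have := bl m 0 z; rewrite sub0r => ->.
    by have := bl m 0 0; rewrite !subrr => ->; rewrite sub0r.
  have bNr x : b 1 (- x) = - b 1 x.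
    by have := br 1 0 x; rewrite sub0r b0 sub0r.
  have bD z w : b (z + w) m = b z m + b w m.
    by have := bl m z (- w); rewrite bN !opprK.
  have bDr x y : b 1 (x + y) = b 1 x + b 1 y.
    by have := br 1 x (- y); rewrite bNr !opprK.
  have bl0 : b 0 m = 0 by have := bl m 0 0; rewrite !subrr.
  have -> : b (int_mulrn n 1) m = b 1 (m *+ n).
    rewrite /int_mulrn; elim: n {n0 mn inj} => [|n IH]; first by rewrite !mulr0n b0.
    by rewrite !mulrS bD bDr IH.
  by rewrite mn.
Qed.

End FlatZ.

Section SchemeArithmetic.
Variables (X : scheme) (K0 : function_field X).
Hypotheses (iX : integral_scheme X) (fX : flat_scheme X) (ftX : finite_type_scheme X).

Lemma affine_finite_type_exists : exists U : set X,
  [/\ affine_open U, U !=set0 & finite_type_over_Z (sections U)].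
Proof.
have [n [V [aV VT Vft]]] := ftX; have [[x _] _] := iX.
have : [set: X] x by []; rewrite -VT => -[i _ Vix].
by exists (V i); split=> //; exists x.
Qed.

Lemma sections_char0 (U : set X) n : affine_open U -> U !=set0 -> (0 < n)%N ->
  (n%:R : sections U) <> 0.
Proof.
move=> aU nU n0 e; have [oU _] := aU; have [_ /(_ U oU nU)[U10 _]] := iX.
by apply: U10; exact: (flat_torsion_free (fX aU) n0).
Qed.

Lemma function_field_char0 n : (0 < n)%N -> n%:R != 0 :> K0.
Proof.
move=> n0; have [U [aU nU _]] := affine_finite_type_exists.
have [oU [phi [pp _ _ pb pl]]] := aU; have [_ /(_ U oU nU)[_ Udom]] := iX.
apply/eqP => e; apply: (sections_char0 aU nU n0).
by apply: (germ_inj (K0 := K0) (oU := oU) (nU := nU) pp pb pl Udom); rewrite rmorph_nat.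
Qed.

Lemma function_field_enumerable : enumerable K0.
Proof.
have [U [aU nU /finite_type_enumerable eU]] := affine_finite_type_exists.
have [oU [phi [pp _ _ pb pl]]] := aU; have [eta etaP] := generic_point_exists K0 iX.
apply: (enumerable_image (f := fun ab : sections U * sections U =>
    germ K0 oU nU ab.1 / germ K0 oU nU ab.2)).
  exact: enumerable_prod.
move=> f; have [V [oV [nV [s ->]]]] := germ_surj f.
have [a [h [_ ->]]] := local_section_frac K0 oU nU pp pb pl oV nV s (etaP _ oU nU) (etaP _ oV nV).
by exists (a, h).
Qed.

(** A prime not dividing [N] is not invertible on the affine [U], so it lies in a maximal ideal of
    the sections, which is a point of [U]. *)
Lemma residue_characteristics_cofinite : exists2 N, (0 < N)%N &
  forall p, prime p -> ~~ (p %| N)%N -> residue_characteristics K0 p.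
Proof.
have [U [aU nU ftU]] := affine_finite_type_exists.
have [oU [phi [pp _ psurj pb pl]]] := aU; have [_ /(_ U oU nU)[_ Udom]] := iX.
have [N N0 NP] := finitely_many_invertible_primes (germ K0 oU nU) function_field_char0 ftU.
exists N => // p p_pr pN; split=> //.
have sT : subring [set: sections U] by split.
have [|m [pm pI _]] := maximal_ideal_exists sT (I0 := [set b | exists a, b = a * p%:R]).
  split=> //=.
  - by exists 0; rewrite mul0r.
  - by move=> _ _ [a ->] [b ->]; exists (a + b); rewrite mulrDl.
  - by move=> c _ _ [a ->]; exists (c * a); rewrite mulrA.
  - by move=> [a e]; move/negP: pN; apply; apply: (NP p a p_pr); rewrite mulrC -e.
have [y Uy ym] := psurj _ pm; exists y.
rewrite -(rmorph_nat (germ K0 oU nU)).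
apply: (local_ring_ideal_germ K0 oU nU pp pb pl Udom Uy).
by rewrite ym; apply: pI; exists 1; rewrite mul1r.
Qed.

End SchemeArithmetic.

(** * Reduction of roots of unity *)

(* The characteristic exponent: [1] in characteristic zero. *)
Definition char_exponent (F : fieldType) (q : nat) : Prop :=
  (q = 1%N /\ forall n, (0 < n)%N -> n%:R != 0 :> F) \/
  (prime q /\ q%:R = 0 :> F).

Section CharExponent.
Variables (F : fieldType) (q : nat).
Hypothesis hq : char_exponent F q.

Lemma char_exponent_gt0 : (0 < q)%N.
Proof. by case: hq => [[-> //]|[/prime_gt0]]. Qed.

Lemma char_exponent_split n : (0 < n)%N ->
  exists a N, [/\ n = (q ^ a * N)%N, coprime N q & (0 < N)%N].
Proof.
move=> n0; case: hq => [[-> _]|[q_pr _]].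
  by exists 0%N, n; rewrite expn0 mul1n coprimen1.
exists (logn q n), (n`_q^')%N; rewrite -p_part partnC // part_gt0; split=> //.
by rewrite coprime_sym prime_coprime // -p'natE // part_pnat.
Qed.

Lemma coprime_char_exponent N : coprime N q -> (0 < N)%N -> N%:R != 0 :> F.
Proof.
move=> cN N0; case: hq => [[_]|[q_pr q0]]; first exact.
have q_char : q \in [pchar F] by rewrite inE q_pr q0 eqxx.
by rewrite -(dvdn_pcharf q_char) -prime_coprime // coprime_sym.
Qed.

Lemma char_exponent_root (a : F) e : a ^+ (q ^ e) = 1 -> a = 1.
Proof.
case: hq => [[-> _]|[q_pr q0]]; first by rewrite exp1n expr1.
have q_char : q \in [pchar F] by rewrite inE q_pr q0 eqxx.
move=> ae; apply/eqP; rewrite -subr_eq0.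
have qn : [pchar F].-nat (q ^ e)%N.
  by rewrite pnatX; apply/orP; left; rewrite pnatE.
have : (a - 1 + 1) ^+ (q ^ e) = (a - 1) ^+ (q ^ e) + 1 ^+ (q ^ e).
  exact: GRing.exprDn_pchar.
rewrite subrK ae expr1n => /eqP; rewrite -subr_eq0 opprD addrC addrNK oppr_eq0.
by rewrite expf_eq0 => /andP[].
Qed.

(** The totient of [N] divides [n!] as soon as [n >= N]. This is the reason for the exponents
    [q ^ n!]: on each root of unity of order prime to [q] they eventually act trivially. *)
Lemma char_exponent_modn N : coprime N q -> (0 < N)%N ->
  forall n, (N <= n)%N -> (q ^ n`! = 1 %[mod N])%N.
Proof.
move=> cN N0 n Nn; have t0 : (0 < totient N)%N by rewrite totient_gt0.
have /dvdnP[j ->] : (totient N %| n`!)%N.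
  apply: dvdn_fact; rewrite t0 (leq_trans _ Nn) // totient_count_coprime big_mkord.
  by rewrite -[leqRHS]card_ord -sum1_card leq_sum // => i _; exact: leq_b1.
rewrite mulnC expnM -modnXm Euler_exp_totient; last by rewrite coprime_sym.
by rewrite modnXm exp1n.
Qed.

End CharExponent.

Lemma char_exponent_exists (F : fieldType) : exists q, char_exponent F q.
Proof.
have [h|/existsNP[n /not_implyP[n0 /negP]]] :=
    pselect (forall n, (0 < n)%N -> n%:R != 0 :> F).
  by exists 1%N; left.
rewrite negbK => nF; have [p p_char] := natf0_pchar n0 nF.
by exists p; right; split; [exact: pcharf_prime p_char | exact: pcharf0 p_char].
Qed.

Lemma expr_modn1 (F : fieldType) (a : F) m N :
  a ^+ N = 1 -> (m = 1 %[mod N])%N -> a ^+ m = a.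
Proof. by move=> aN e; rewrite -(expr_mod m aN) e (expr_mod _ aN) expr1. Qed.

(** The identity of a divisible group extends to [K^*], so [D] is a direct factor with complement
    [w a = 1]. *)
Lemma retraction (K : fieldType) (D : set K) : mul_subgroup D -> mul_divisible D ->
  exists w : K -> K, [/\ forall a, a != 0 -> D (w a), w 1 = 1,
    forall a b, a != 0 -> b != 0 -> w (a * b) = w a * w b
    & forall a, D a -> w a = a].
Proof.
move=> sD dD; have [D1 DB D0] := sD.
pose G : set (K * K) := [set x | D x.1 /\ x.2 = x.1].
have [||w [wD w1 wM wG]] := @partial_hom_extend K K D G sD dD.
- split; [by [] | | |by move=> b []].
  + by move=> [x1 x2] [y1 y2] [/= Dx /= ->] [/= Dy /= ->]; split=> //; exact: DB.
  + by move=> [x1 x2] [/= Dx /= ->]; split; exact: D0.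
- by move=> [x1 x2] [/= Dx /= ->].
by exists w; split=> // a Da; exact: (wG (a, a)).
Qed.

Lemma mul_subgroup_torsion (K : fieldType) : mul_subgroup (torsion K).
Proof.
split; [exact: torsion1 | | exact: torsion_neq0].
by move=> a b ta tb; apply: torsionM => //; exact: torsionV.
Qed.

Lemma mul_divisible_torsion (K : closedFieldType) : mul_divisible (torsion K).
Proof.
move=> b n [m [m0 bm]] n0; have [c cb] := closed_root b n0.
by exists c => //; exists (n * m)%N; rewrite muln_gt0 n0 exprM cb.
Qed.

Section PowerTorsion.
Variables (K : closedFieldType) (q : nat).
Hypothesis q_split : forall n, (0 < n)%N ->
  exists a N, [/\ n = (q ^ a * N)%N, coprime N q & (0 < N)%N].
Hypothesis q_gt0 : (0 < q)%N.

Definition power_torsion : set K := [set a | exists e, a ^+ (q ^ e) = 1].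

Lemma power_torsion_torsion a : power_torsion a -> torsion K a.
Proof. by move=> [e ae]; exists (q ^ e)%N; rewrite expn_gt0 q_gt0. Qed.

Lemma mul_subgroup_power_torsion : mul_subgroup power_torsion.
Proof.
split; [by exists 0%N; rewrite expr1n | | by move=> a /power_torsion_torsion/torsion_neq0].
move=> a b [e ae] [f bf]; exists (e + f)%N.
by rewrite expnD exprMn exprM ae expr1n mul1r mulnC exprM exprVn bf invr1 expr1n.
Qed.

Lemma mul_divisible_power_torsion : mul_divisible power_torsion.
Proof.
move=> b n [e be] n0; have [c cb] := closed_root b n0.
have [a [N [nE cN N0]]] := q_split n0.
(* Being 0 modulo [N], the exponent [s] moves an arbitrary [n]-th root [c] of [b] into the [q]-power
   torsion; being 1 modulo [q ^ e], it fixes [b], so [c ^ s] is still an [n]-th root of [b]. *)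
pose s := chinese (q ^ e) N 1 0.
have cqN : coprime (q ^ e) N by rewrite coprime_sym coprimeXr.
exists (c ^+ s).
  exists (a + e)%N; apply: (@etrans _ _ ((c ^+ (n * q ^ e)) ^+ (s %/ N))).
    rewrite -!exprM; congr (_ ^+ _).
    have Ns : (N %| s)%N by rewrite /dvdn (chinese_modr cqN) mod0n.
    by rewrite -{1}(divnK Ns) nE expnD mulnC; ring.
  by rewrite exprM cb be expr1n.
by rewrite exprAC cb (@expr_modn1 _ _ _ (q ^ e)) // (chinese_modl cqN).
Qed.

End PowerTorsion.

Section TorsionReduction.
Variables (K : closedFieldType) (x : spec_point K).
Hypothesis int_closed : forall z, integral_over (sp_ring x) z -> sp_ring x z.

Lemma torsion_in_local z : torsion K z -> in_local x z.
Proof.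
move=> tz; apply: in_local_ring; apply: int_closed.
exact: integral_over_torsion (sp_subring x) tz.
Qed.

Lemma torsion_local_unit z : torsion K z -> local_unit x z.
Proof.
move=> tz; split; first exact: torsion_in_local.
apply/eqP => r0; have := reduceM (torsion_in_local tz) (torsion_in_local (torsionV tz)).
rewrite r0 mul0r divff; last exact: torsion_neq0.
by rewrite reduce1 => /eqP; rewrite oner_eq0.
Qed.

Variable q : nat.
Hypothesis hq : char_exponent (residue x) q.

Lemma reduce_power_torsion z : power_torsion q z -> reduce x z = 1.
Proof.
move=> tz; have [e ze] := tz.
have tz' := power_torsion_torsion (char_exponent_gt0 hq) tz.
apply: (char_exponent_root hq (e := e)).
by rewrite -(reduceX _ (torsion_in_local tz')) ze reduce1.
Qed.

(** If [z] is not 1, the sum of its first [N] powers is 0, yet it reduces to [N], which is nonzero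
    in the residue field. *)
Lemma reduce_torsion_inj z N : z ^+ N = 1 -> (0 < N)%N -> coprime N q ->
  reduce x z = 1 -> z = 1.
Proof.
move=> zN N0 cN rz; apply/eqP/negPn/negP => z1.
have Lz : in_local x z by apply: torsion_in_local; exists N.
have s0 : \sum_(i < N) z ^+ i = 0.
  have := subrX1 z N; rewrite zN subrr => /esym/eqP.
  by rewrite mulf_eq0 subr_eq0 (negbTE z1) => /eqP.
move/eqP: (coprime_char_exponent hq cN N0); apply.
have LS n : in_local x (\sum_(i < n) z ^+ i) /\ reduce x (\sum_(i < n) z ^+ i) = n%:R.
  have [L1 LB LM] := in_local_subring x.
  have L0 : in_local x 0 by rewrite -(subrr 1); exact: LB.
  have r0 : reduce x 0 = 0.
    by apply/(reduce_eq0 L0); apply: in_maximal_ideal; have [] := sp_prime x.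
  elim: n => [|n [IL IH]]; first by rewrite big_ord0; split; [exact: L0 | exact: r0].
  have Lzn : in_local x (z ^+ n).
    by elim: (n) => [|i IHi]; rewrite ?expr0 // exprS; exact: LM.
  rewrite big_ord_recr /=; split.
    rewrite -[z ^+ n]opprK; apply: (LB) => //; rewrite -sub0r; exact: LB.
  by rewrite (reduceD IL Lzn) IH (reduceX _ Lz) rz expr1n natr1.
by have [_ <-] := LS N; rewrite s0; have [_] := LS 0%N; rewrite big_ord0.
Qed.

End TorsionReduction.

(** * Approximation by Frobenius powers of injective characters *)

Section FrobeniusLift.
Variables (K C : closedFieldType) (x : spec_point K).
Hypothesis int_closed : forall z, integral_over (sp_ring x) z -> sp_ring x z.
Hypothesis charC : forall n, (0 < n)%N -> n%:R != 0 :> C.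
Variable q : nat.
Hypothesis hq : char_exponent (residue x) q.
Variables (chi : character C (residue x)) (theta : character C K).
Hypothesis ttheta : torsion_inj theta.
Hypothesis compat : forall z N, z ^+ N = 1 -> (0 < N)%N -> coprime N q ->
  theta z = chi (reduce x z).

Let q0 := char_exponent_gt0 hq.
Let M : set K := power_torsion q.

Section Retraction.
Variable w : K -> K.
Hypothesis wM : forall a, a != 0 -> M (w a).
Hypothesis w_mul : forall a b, a != 0 -> b != 0 -> w (a * b) = w a * w b.
Hypothesis w_id : forall a, M a -> w a = a.

Let sM : mul_subgroup M := mul_subgroup_power_torsion K q0.

Let w_hom : forall a, a != 0 -> w a != 0.
Proof. by move=> a /wM; case: sM => _ _; exact. Qed.

Let w1 : w 1 = 1.
Proof. by apply: w_id; case: sM. Qed.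

Let wV a : a != 0 -> w a^-1 = (w a)^-1.
Proof.
by move=> a0; apply: (mulfI (w_hom a0)); rewrite -w_mul ?invr_neq0 // !divff ?w_hom.
Qed.

Let wX a n : a != 0 -> w (a ^+ n) = w a ^+ n.
Proof.
by move=> a0; elim: n => [|n IH]; rewrite ?expr0 // !exprS w_mul ?expf_neq0 // IH.
Qed.

Let Mtorsion a : M a -> torsion K a := power_torsion_torsion q0 (a := a).

Lemma prime_to_part z : torsion K z -> exists N, [/\ (0 < N)%N, coprime N q
  & (z / w z) ^+ N = 1].
Proof.
move=> tz; have z0 := torsion_neq0 tz; have wz0 := w_hom z0.
have [n [n0 zn]] : torsion K (z / w z).
  by apply: torsionM => //; apply: torsionV; apply: Mtorsion; exact: wM.
have [a [N [nE cN N0]]] := char_exponent_split hq n0.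
exists N; split=> //.
have : M ((z / w z) ^+ N) by exists a; rewrite -exprM mulnC -nE.
move/w_id <-; rewrite wX ?mulf_neq0 ?invr_neq0 // w_mul ?invr_neq0 // wV //.
by rewrite (w_id (wM z0)) divff ?expr1n.
Qed.

(* On the complement [w v = 1] of the [q]-power torsion [M], the character
   sends [v ^ (q ^ e)] to [chi v]: it is [chi] composed with the inverse of the
   [e]-th power of Frobenius; on [M], which dies in the residue field, it is
   [theta]. *)
Lemma frobenius_lift e : exists psi : character C K, [/\ torsion_inj psi,
  forall z N, torsion K z -> (0 < N)%N -> coprime N q -> (z / w z) ^+ N = 1 ->
    (q ^ e = 1 %[mod N])%N -> psi z = theta z
  & forall r, local_unit x r -> w r ^+ (q ^ e) = 1 ->
    psi r ^+ (q ^ e) = chi (reduce x r)].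
Proof.
set m := (q ^ e)%N.
have sU := mul_subgroup_local_unit x; have [U1 UB U0] := sU; have [M1 MB M0] := sM.
have MU a : M a -> local_unit x a.
  by move=> Ma; apply: torsion_local_unit => //; exact: Mtorsion.
pose G : set (K * C) := [set y | exists v xi, [/\ local_unit x v, w v = 1, M xi
  & y = (v ^+ m * xi, chi (reduce x v) * theta xi)]].
(* By [compat] a torsion pair in the kernel satisfies [theta (v * xi) = 1], and the two factors of
   [K^*] meet trivially. *)
have trivial v xi : local_unit x v -> w v = 1 -> M xi ->
    torsion K v -> chi (reduce x v) * theta xi = 1 -> v = 1 /\ xi = 1.
  move=> Uv wv Mxi tv e1; have [N [N0 cN]] := prime_to_part tv.
  rewrite wv divr1 => vN; rewrite -(compat vN N0 cN) -charM in e1.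
  have vxi : v * xi = 1.
    by apply: ttheta => //; apply: torsionM => //; exact: Mtorsion.
  have xi0 := M0 _ Mxi; have v1 : v = 1.
    have vE : v = xi^-1 by rewrite -[v](mulfK xi0) vxi div1r.
    by rewrite -wv vE wV // (w_id Mxi).
  by split=> //; move: vxi; rewrite v1 mul1r.
have hG : partial_hom G.
  split.
  - exists 1, 1; split=> //.
    by rewrite reduce1 !char1 expr1n !mulr1.
  - move=> _ _ [v [xi [Uv wv Mxi ->]]] [v' [xi' [Uv' wv' Mxi' ->]]].
    have v0 := U0 _ Uv; have v'0 := U0 _ Uv'.
    exists (v / v'), (xi / xi'); split; [exact: UB | | exact: MB |].
      by rewrite w_mul ?invr_neq0 // wV // wv wv' divr1.
    have [[Lv _] [LV _]] := (Uv, local_unitV Uv').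
    rewrite /= (reduceM Lv LV) (reduceV Uv') !charM !charV expr_div_n.
    by rewrite !invfM; congr (_, _); exact: mulrACA.
  - move=> _ [v [xi [Uv wv Mxi ->]]]; have v0 := U0 _ Uv; have xi0 := M0 _ Mxi.
    have [_ rv] := Uv.
    split; apply: mulf_neq0.
    + exact: expf_neq0.
    + exact: xi0.
    + exact: char_neq0.
    + exact: char_neq0.
  (* Single-valuedness: [v ^ m] lies in [M] and in its complement, so it is 1. Hence [v] is itself a
     [q]-power root of unity in the complement, and equals 1. *)
  - move=> b [v [xi [Uv wv Mxi [e1 ->]]]]; have xi0 := M0 _ Mxi; have v0 := U0 _ Uv.
    have vm : v ^+ m = xi^-1 by rewrite -[LHS](mulfK xi0) -e1 div1r.
    have vm1 : v ^+ m = 1.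
      have Mvm : M (v ^+ m) by rewrite vm -div1r; exact: MB.
      by rewrite -(w_id Mvm) wX // wv expr1n.
    have v1 : v = 1 by rewrite -wv; apply/esym/w_id; exists e.
    have xi1 : xi = 1 by rewrite -[xi]invrK -vm vm1 invr1.
    by rewrite v1 xi1 reduce1 !char1 mulr1.
have [a ta [v [xi [Uv wv Mxi [aE e1]]]]|psi [psiG tpsi]] :=
    torsion_inj_extend charC hG.
  have xi0 := M0 _ Mxi.
  have [n [n0 vn]] : torsion K (v ^+ m).
    rewrite -[_ ^+ _](mulfK xi0) -aE; apply: torsionM => //.
    by apply: torsionV; exact: Mtorsion.
  have tv : torsion K v.
    by exists (m * n)%N; rewrite exprM muln_gt0 n0 /m expn_gt0 q0.
  have [v1 xi1] := trivial _ _ Uv wv Mxi tv (esym e1).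
  by rewrite aE v1 xi1 expr1n mulr1.
have psiM xi : M xi -> psi xi = theta xi.
  move=> Mxi; have : G (xi, theta xi).
    by exists 1, xi; split=> //; rewrite reduce1 char1 expr1n !mul1r.
  by move/psiG.
have psiU v : local_unit x v -> w v = 1 -> psi (v ^+ m) = chi (reduce x v).
  move=> Uv wv; have : G (v ^+ m, chi (reduce x v)).
    by exists v, 1; split=> //; rewrite char1 !mulr1.
  by move/psiG.
have w_compl r : r != 0 -> w (r / w r) = 1.
  move=> r0; rewrite w_mul ?invr_neq0 ?w_hom // wV ?w_hom //.
  by rewrite (w_id (wM r0)) divff // w_hom.
exists psi; split=> // [z N tz N0 cN zN mN|r Ur rm].
  have z0 := torsion_neq0 tz; have wz0 := w_hom z0.
  have Uv : local_unit x (z / w z).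
    by apply: UB; [exact: torsion_local_unit | apply: MU; exact: wM].
  rewrite -[z in LHS](divfK wz0) charM (psiM _ (wM z0)).
  rewrite -(expr_modn1 zN mN) (psiU _ Uv (w_compl _ z0)) -(compat zN N0 cN).
  by rewrite -charM divfK.
have r0 := U0 _ Ur; have wr0 := w_hom r0.
have Uwr := MU _ (wM r0).
have Uv : local_unit x (r / w r) by exact: UB.
rewrite -charX -[r in LHS](divfK wr0) exprMn rm mulr1 (psiU _ Uv (w_compl _ r0)).
have [[Lr _] [LV _]] := (Ur, local_unitV Uwr).
rewrite (reduceM Lr LV) (reduceV Uwr) (reduce_power_torsion int_closed hq (wM r0)).
by rewrite invr1 mulr1.
Qed.

End Retraction.

Lemma frobenius_lifts : exists psi : nat -> character C K, [/\
  forall n, torsion_inj (psi n),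
  forall z, torsion K z -> exists n0, forall n, (n0 <= n)%N -> psi n z = theta z
  & forall r, local_unit x r -> exists n0, forall n, (n0 <= n)%N ->
    psi n r ^+ (q ^ n`!) = chi (reduce x r)].
Proof.
have [w [wM w1 w_mul w_id]] := retraction (mul_subgroup_power_torsion K q0)
  (@mul_divisible_power_torsion K q (char_exponent_split hq)).
pose psi n := projT1 (cid (frobenius_lift wM w_mul w_id n`!)).
exists psi; split=> [n|z tz|r Ur]; rewrite /psi.
- by case: cid => ? [].
- have [N [N0 cN zN]] := prime_to_part wM w_mul w_id tz.
  exists N => n Nn; case: cid => ps [/= _ psz _].
  exact: (psz z N tz N0 cN zN (char_exponent_modn cN N0 Nn)).
- have r0 := local_unit_neq0 Ur; have [e re] := wM _ r0; exists e => n en.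
  case: cid => ps [/= _ _ psr]; apply: (psr r Ur).
  rewrite -(subnKC (leq_trans en (fact_geq n))) expnD exprM re.
  exact: expr1n.
Qed.

End FrobeniusLift.

(** * Convergence of complex functions *)

Section ComplexLimits.
Variable R : realType.
(* [R[i]] carries its topology as a [numClosedFieldType]. *)
Let C : numClosedFieldType := R[i].

Lemma cvg_complex (T : Type) (F : set_system T) {FF : Filter F} (f : T -> C) (l : C) :
  (fun t => Re (f t)) @ F --> Re l -> (fun t => Im (f t)) @ F --> Im l ->
  f @ F --> l.
Proof.
move=> fR fI; apply/cvgrPdist_lt => e e0.
have /complex_realP[d ed] : e \is Num.real by exact: gtr0_real.
move: e0; rewrite {e}ed (ltcR 0) => d0.
have d20 : 0 < d / 2 by rewrite divr_gt0.
have /cvgrPdist_lt/(_ _ d20) hR := fR; have /cvgrPdist_lt/(_ _ d20) hI := fI.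
near=> t.
have h1 : `|Re l - Re (f t)| < d / 2 by near: t.
have h2 : `|Im l - Im (f t)| < d / 2 by near: t.
rewrite normc_def ltcR.
have -> : Re (l - f t) = Re l - Re (f t) by case: (l) (f t) => [a b] [c e].
have -> : Im (l - f t) = Im l - Im (f t) by case: (l) (f t) => [a b] [c e].
set a := Re l - _ in h1 *; set b := Im l - _ in h2 *.
rewrite -[X in _ < X]gtr0_norm // -sqrtr_sqr ltr_sqrt ?exprn_gt0 //.
move: h1 h2; rewrite !ltr_norml => /andP[? ?] /andP[? ?].
have : a ^+ 2 < (d / 2) ^+ 2.
  by nra.
have : b ^+ 2 < (d / 2) ^+ 2.
  by nra.
nra.
Unshelve. all: by end_near. Qed.

Lemma cvg_cexp (T : Type) (F : set_system T) {FF : Filter F} (f : T -> R[i]) (l : R[i]) :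
  (fun t => Re (f t)) @ F --> Re l -> (fun t => Im (f t)) @ F --> Im l ->
  (fun t => cexp (f t) : C) @ F --> (cexp l : C).
Proof.
move=> fR fI.
have eR : (fun t => expR (Re (f t))) @ F --> expR (Re l).
  by apply: continuous_cvg => //; exact: continuous_expR.
apply: cvg_complex => /=; apply: cvgM => //; apply: continuous_cvg => //.
  exact: continuous_cos.
exact: continuous_sin.
Qed.

Lemma cvg_small (f : nat -> R) : (forall n, `|f n| < n.+1%:R^-1) ->
  f @ \oo --> (0 : R).
Proof.
move=> fn; apply/cvgrPdist_lt => e e0.
have /cvgrPdist_lt/(_ e e0) := @cvg_harmonic R.
apply: filterS => n; rewrite !sub0r !normrN /harmonic /= => h.
by apply: lt_trans (fn n) _; move: h; rewrite ger0_norm.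
Qed.

End ComplexLimits.

Section Approximation.
Variables (R : realType) (K : closedFieldType) (x : spec_point K).
Let C : numClosedFieldType := R[i].
Variable u : nat -> K.
Hypothesis u_neq0 : forall n, u n != 0.
Hypothesis u_surj : forall a, a != 0 -> exists n, u n = a.
Hypothesis int_closed : forall z, integral_over (sp_ring x) z -> sp_ring x z.

(** Products of elements of the maximal ideal are never units, which is what Gordan's theorem asks
    for. On [rs] the map [f] behaves like a valuation centred at [x]. *)
Lemma maximal_positive_hom (rs : seq K) :
  (forall r, r \in rs -> r != 0 /\ in_maximal x r) ->
  exists f : K -> rat, [/\ log_hom f, forall h, local_unit x h -> f h = 0
    & forall r, r \in rs -> 0 < f r].
Proof.
move=> rsP; apply: (positive_hom u_neq0 u_surj (mul_subgroup_local_unit x)).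
  by move=> r /rsP[].
move=> a Pa [La]; apply/negP; rewrite negbK; apply/eqP/(reduce_eq0 La).
elim: {La}Pa => [r /rsP[]//|b c _ mb _ mc].
have /asboolP[b1 [b2 [pb1 Sb2 pb2 ->]]] := mb.
have /asboolP[c1 [c2 [pc1 Sc2 pc2 ->]]] := mc.
have [pS p0 pD pM _] := sp_prime x; have [Sbc pbc] := denM Sb2 Sc2 pb2 pc2.
by apply/asboolP; exists (b1 * c1), (b2 * c2); split=> //;
  rewrite ?mulf_div //; apply: (pM) => //; exact: pS.
Qed.

(* One step of the approximation: [psi] is corrected on the maximal ideal by a
   real character which is trivial on the units of the local ring. *)
Lemma twist_approximation (psi : character R[i] K) m n : torsion_inj psi ->
  exists chi : character R[i] K, [/\ char_inj chi,
    forall z, torsion K z -> chi z = psi z,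
    forall i, (i < n)%N -> local_unit x (u i) -> exists z,
      [/\ chi (u i) ^+ m.+1 = psi (u i) ^+ m.+1 * cexp z,
          `|Re z| < n.+1%:R^-1 & `|Im z| < n.+1%:R^-1]
    & forall i, (i < n)%N -> in_maximal x (u i) ->
      `|chi (u i) ^+ m.+1| < (n.+1%:R^-1)%:C%C].
Proof.
move=> tpsi; pose l := [seq u i | i <- iota 0 n].
pose rs := [seq r <- l | in_maximal x r].
have u_l i : (i < n)%N -> u i \in l by move=> ltin; rewrite map_f // mem_iota.
have [|f [hf fU fr]] := @maximal_positive_hom rs.
  move=> r; rewrite mem_filter => /andP[rm /mapP[i _ rE]].
  by split=> //; rewrite rE.
(* The division by [m + 1] pays for raising the twisted character to the power [m + 1]. *)
pose eta : R := n.+1%:R^-1 / m.+1%:R.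
have eta0 : 0 < eta by rewrite divr_gt0 ?invr_gt0 ?ltr0n.
have eta1 : eta <= 1.
  rewrite /eta ler_pdivrMr ?ltr0n // mul1r (@le_trans _ _ 1) //.
    by rewrite invf_le1 ?ler1n ?ltr0n.
  by rewrite ler1n.
(* [T] is so large that the damping [expR (- T * f r)] beats [psi r]. The extra 1 in the exponent
   leaves room for the generic perturbation, whose real part is below [eta <= 1]. *)
have [T TP] : exists T : R, forall r, r \in rs ->
    complex.Re `|psi r| * expR (1 - T * ratr (f r)) < eta.
  have : forall r, r \in rs -> 0 < f r by [].
  elim: (rs) => [|s ss IH] ssP; first by exists 0.
  have [|T TP] := IH; first by move=> r rss; apply: ssP; rewrite in_cons rss orbT.
  have fs : 0 < ratr (f s) :> R by rewrite ltr0q ssP ?mem_head.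
  pose c := complex.Re `|psi s|.
  have c0 : 0 <= c.
    have : 0 <= `|psi s| by [].
    by rewrite /c lecE => /andP[].
  pose T1 := (1 - ln (eta / (c + 1))) / ratr (f s).
  exists (Num.max T T1) => r; rewrite in_cons => rs'.
  have fr' : 0 < ratr (f r) :> R by rewrite ltr0q ssP.
  case/orP: rs' fr' => [/eqP ->{r}|rss] fr'; last first.
    apply: le_lt_trans (TP r rss); apply: ler_wpM2l.
      have : 0 <= `|psi r| by [].
      by rewrite lecE => /andP[].
    by rewrite ler_expR lerD2l lerN2 ler_pM2r // le_max lexx.
  apply: (@le_lt_trans _ _ (c * expR (ln (eta / (c + 1))))).
    apply: ler_wpM2l => //; rewrite ler_expR lerBlDr -lerBlDl.
    rewrite -ler_pdivrMr // -/T1 le_max lexx orbT //.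
  rewrite lnK ?posrE ?divr_gt0 //; last by rewrite ltr_wpDl.
  rewrite mulrCA -[X in _ < X]mulr1 ltr_pM2l // ltr_pdivrMr; last by rewrite ltr_wpDl.
  by rewrite mul1r ltrDl.
pose L0 (a : K) : R[i] := (- T * ratr (f a))%:C%C.
have hL0 : log_hom L0.
  by move=> a b a0 b0; rewrite /L0 hf // rmorphD mulrDr rmorphD.
have [L [hL [iL Ll]]] := generic_twist u_neq0 u_surj l tpsi hL0 eta0.
exists (twist psi hL); split=> //.
- by move=> z tz; rewrite twist_torsion.
- move=> i ltin Ui; exists (L (u i) *+ m.+1).
  have L00 : L0 (u i) = 0 by rewrite /L0 fU // rmorph0 mulr0.
  have [] := Ll _ (u_l _ ltin); rewrite L00 subr0 => hR hI.
  split; first by rewrite /= exprMn cexp_nat.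
    rewrite (raddfMn (@complex.Re R : {additive _ -> _})) normrMn.
    by rewrite -[ltLHS]mulr_natr -ltr_pdivlMr ?ltr0n.
  rewrite (raddfMn (@complex.Im R : {additive _ -> _})) normrMn.
  by rewrite -[ltLHS]mulr_natr -ltr_pdivlMr ?ltr0n.
- move=> i ltin mi; have uirs : u i \in rs by rewrite mem_filter mi u_l.
  have [hR _] := Ll _ (u_l _ ltin).
  have : `|twist psi hL (u i)| < eta%:C%C.
    rewrite /= normrM normc_cexp.
    have : `|psi (u i)| = (complex.Re `|psi (u i)|)%:C%C.
      by rewrite normc_def.
    move=> ->; rewrite -rmorphM ltcR; apply: le_lt_trans (TP _ uirs).
    apply: ler_wpM2l.
      have : 0 <= `|psi (u i)| by [].
      by rewrite lecE => /andP[].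
    rewrite ler_expR; move: hR.
    have -> : Re (L (u i) - L0 (u i)) = Re (L (u i)) + T * ratr (f (u i)).
      by rewrite /L0; case: (L (u i)) => a b /=; rewrite mulNr opprK.
    by rewrite ltr_norml => /andP[_ h]; lra.
  rewrite normrX exprS => h.
  have n0 : 0 <= `|twist psi hL (u i)| by [].
  have h1 : `|twist psi hL (u i)| <= 1.
    by apply: le_trans (ltW h) _; rewrite (lecR _ 1).
  apply: (@le_lt_trans _ _ `|twist psi hL (u i)|).
    by rewrite ler_piMr // exprn_ile1.
  apply: lt_le_trans h _; rewrite lecR /eta ler_pdivrMr ?ltr0n //.
  by rewrite ler_peMr ?invr_ge0 ?ler0n // ler1n.
Qed.

Variable q : nat.
Hypothesis hq : char_exponent (residue x) q.
Variables (chi : character R[i] (residue x)) (theta : character R[i] K).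
Hypothesis ttheta : torsion_inj theta.
Hypothesis compat : forall z N, z ^+ N = 1 -> (0 < N)%N -> coprime N q ->
  theta z = chi (reduce x z).

(** The [n]-th Frobenius lift is corrected on the first [n] elements of [K^*]. After raising to
    [q ^ n!], units have the right value up to a factor tending to 1, and elements of the maximal
    ideal tend to 0; torsion is not affected. *)
Lemma character_approximation : exists psi : nat -> character R[i] K, [/\
  forall n, char_inj (psi n),
  forall z, torsion K z -> exists n0, forall n, (n0 <= n)%N -> psi n z = theta z
  & forall r, in_local x r ->
    (fun n => psi n r ^+ (q ^ n`!) : C) @ \oo --> (chi (reduce x r) : C)].
Proof.
have charC n : (0 < n)%N -> n%:R != 0 :> R[i] by rewrite pnatr_eq0 -lt0n.
have [psi [tpsi psiT psiU]] :=
  frobenius_lifts int_closed charC hq ttheta compat.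
have mE n : (q ^ n`!)%N = (q ^ n`!).-1.+1.
  by rewrite prednK // expn_gt0 (char_exponent_gt0 hq).
pose om n := projT1 (cid (twist_approximation (q ^ n`!).-1 n (tpsi n))).
exists om; split.
- by move=> n; rewrite /om; case: cid => ? [].
- move=> z tz; have [n0 n0P] := psiT z tz; exists n0 => n nn0.
  by rewrite /om; case: cid => ps [/= _ h _ _]; rewrite h // n0P.
- move=> r Lr; have [->|r0] := eqVneq r 0.
    have -> : reduce x 0 = 0.
      have L0 := in_local_ring (subring0 (sp_subring x)).
      by apply/(reduce_eq0 L0); apply: in_maximal_ideal; have [] := sp_prime x.
    rewrite char0; apply: (@cvg_near_cst _ _ _ _ _ _).
    by near=> n; rewrite char0 expr0n expn_eq0 eqn0Ngt (char_exponent_gt0 hq).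
  have [i iE] := u_surj r0; rewrite -iE in Lr *.
  have [r1|/eqP r1] := eqVneq (reduce x (u i)) 0.
    have mi : in_maximal x (u i) by apply/(reduce_eq0 Lr).
    rewrite r1 char0; apply/cvgrPdist_lt => e e0.
    have /complex_realP[d ed] : e \is Num.real by exact: gtr0_real.
    move: e0; rewrite {e}ed (ltcR 0) => d0.
    have /cvgrPdist_lt/(_ d d0) := @cvg_harmonic R.
    move=> h; near=> n; rewrite sub0r normrN.
    have ltin : (i < n)%N by near: n; exists i.+1.
    have hn : `|0 - n.+1%:R^-1| < d by near: n.
    rewrite /om; case: cid => ps [/= _ _ _ h4]; rewrite mE.
    apply: lt_trans (h4 i ltin mi) _; rewrite ltcR.
    by move: hn; rewrite sub0r normrN ger0_norm // invr_ge0.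
  have Ui : local_unit x (u i) by split=> //; apply/eqP.
  have [n0 n0P] := psiU _ Ui.
  (* For small [n] the error [z] is set to 0 so that its bounds hold for all [n]. *)
  have zP n : exists z : R[i], [/\ `|Re z| < n.+1%:R^-1, `|Im z| < n.+1%:R^-1
      & (maxn n0 i.+1 <= n)%N -> om n (u i) ^+ (q ^ n`!) = chi (reduce x (u i)) * cexp z].
    have [le|lt] := leqP (maxn n0 i.+1) n; last first.
      by exists 0; rewrite /= normr0 invr_gt0 ltr0n.
    move: le; rewrite geq_max => /andP[le0 lti].
    rewrite /om; case: cid => ps [/= _ _ h3 _]; have [z [zE zR zI]] := h3 i lti Ui.
    by exists z; split=> // _; rewrite -(n0P n le0) mE zE.
  pose z n := projT1 (cid (zP n)).
  have zR n : `|Re (z n)| < n.+1%:R^-1 by rewrite /z; case: cid => ? [].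
  have zI n : `|Im (z n)| < n.+1%:R^-1 by rewrite /z; case: cid => ? [].
  have zE n : (maxn n0 i.+1 <= n)%N ->
      om n (u i) ^+ (q ^ n`!) = chi (reduce x (u i)) * cexp (z n).
    by rewrite /z; case: cid => ? [].
  rewrite -[chi _]mulr1 -cexp0.
  apply: (@cvg_trans _ ((fun n => chi (reduce x (u i)) * cexp (z n) : C) @ \oo)).
    apply: near_eq_cvg; near=> n; rewrite zE //.
    by near: n; exists (maxn n0 i.+1).
  apply: cvgM; first exact: cvg_cst.
  by apply: cvg_cexp => /=; apply: cvg_small.
Unshelve. all: by end_near. Qed.

End Approximation.

(** * Topology of the character spaces and of suspensions *)

Lemma prod_topology_cvg (I : Type) (V : topologicalType) (T : Type)
    (F : set_system T) {FF : Filter F} (f : T -> {ptws I -> V}) (g : {ptws I -> V}) :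
  (forall i, (fun t => f t i) @ F --> g i) -> f @ F --> g.
Proof.
move=> fg; apply/cvg_sup => i W; rewrite nbhsE => -[_ [[A oA <-] Ag] AW].
have /fg h : nbhs (g i) A by exact: open_nbhs_nbhs.
suff : F [set t | W (f t)] by [].
apply: (@filterS _ F FF [set t | A (f t i)]); last exact: h.
by move=> t At; exact: AW.
Qed.

Section DotTopology.
Variables (X : scheme) (K0 : function_field X) (K : fieldType).
Variables (iota : {rmorphism K0 -> K}) (C : numClosedFieldType).

(** An open set is open on every affine chart, so convergence on one chart containing [d] and the
    values of [f] is enough. *)
Lemma dot_cvg (T : Type) (F : set_system T) {FF : Filter F}
    (f : T -> dotX iota C) (d : dotX iota C) (U : set X) :
  affine_open U -> U (base (dot_pt d)) -> (forall t, U (base (dot_pt (f t)))) ->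
  (forall r, normalization_ring iota U r ->
    (fun t => dot_char (f t) (reduce (spec_pt (dot_pt (f t))) r)) @ F -->
    dot_char d (reduce (spec_pt (dot_pt d)) r)) ->
  forall O, open O -> O d -> \forall t \near F, O (f t).
Proof.
move=> aU Ud Uf fd O oO Od.
pose DU : set (dotX iota C) := dot_over U.
pose d' : DU := SigSub (mem_set (Ud : DU d)).
pose f' t : DU := SigSub (mem_set (Uf t : DU (f t))).
have [W oW WO] := oO U aU.
have Wd : W (dot_eval d').
  by have : (@dot_eval X K0 K iota C U @^-1` W) d' by rewrite WO.
have : (fun t => dot_eval (f' t)) @ F --> dot_eval d'.
  apply: prod_topology_cvg => r; apply: fd; exact: (set_valP r).
move=> /(_ W (open_nbhs_nbhs (conj oW Wd))) h.
apply: (@filterS _ F FF [set t | W (dot_eval (f' t))]); last exact: h.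
by move=> t Wt; have : (set_val @^-1` O) (f' t) by rewrite -WO.
Qed.

End DotTopology.

Lemma continuous_SigSub (S T : topologicalType) (A : set T) (f : S -> T)
    (fA : forall s, A (f s)) : continuous f ->
  continuous (fun s => SigSub (mem_set (fA s)) : A).
Proof.
by move=> /continuousP cf; apply/continuousP => _ [V oV <-]; exact: cf.
Qed.

Lemma to_quotient_continuous (T : topologicalType) (r : T -> T -> Prop) :
  continuous (to_quotient r).
Proof. exact: pi_continuous. Qed.

Section Suspension.
Variables (R : realType) (D : topologicalType) (DE : set D).
Variables (charN0 : set nat) (M : topologicalType).
Let N0 := generated_monoid charN0.
Variables (Frob : N0 -> D -> D) (F : N0 -> M -> M) (mk : DE -> M).
Hypothesis Frob1 : forall nu d, set_val nu = 1%N -> Frob nu d = d.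
Hypothesis FrobE : forall nu d, DE d -> DE (Frob nu d).
Hypothesis mk_continuous : continuous mk.
Hypothesis F_mk : forall nu d d', set_val d' = Frob nu (set_val d) ->
  F nu (mk d) = mk d'.
Hypothesis mk_surj : forall m, exists nu d, F nu m = mk d.
Hypothesis generator_gt0 : forall nu, N0 nu -> (0 < nu)%N.

Let one : N0 := SigSub (mem_set (gen_one charN0)).

Let pos (t : R) : positive_reals R :=
  SigSub (mem_set (expR_gt0 t : [set u : R | 0 < u] (expR t))).

Let pos_surj u : exists t, pos t = u.
Proof.
have u0 : 0 < set_val u by exact: (set_valP u).
by exists (ln (set_val u)); apply: val_inj; rewrite /= lnK.
Qed.

Let susp (m : M) (u : positive_reals R) : suspension R F :=
  to_quotient (suspension_rel (R := R) F) (m, u).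

Let susp_continuous (T : topologicalType) (f : T -> M) (g : T -> positive_reals R) :
  continuous f -> continuous g -> continuous (fun t => susp (f t) (g t)).
Proof.
move=> cf cg t; apply: (continuous_comp (f := fun t => (f t, g t))).
  exact: (cvg_pair (cf t) (cg t)).
exact: to_quotient_continuous.
Qed.

Lemma clopen_line (B : set R) : open B -> open (~` B) -> forall s t, B s -> B t.
Proof.
move=> oB oBC s t Bs.
have cR : connected [set: R] by apply/connected_intervalP.
have -> // : B = setT.
apply: cR; first by exists s.
  by exists B => //; rewrite setTI.
by exists B; rewrite ?setTI // -[B]setCK; exact: open_closedC.
Qed.

(** Abstract in [M] so as to cover both spaces. A clopen [B] does not see the real coordinate and is
    thus determined by [g], its trace at height 1 on the image of [mk]. Every point of [M] is
    carried to that image by some [F nu], which costs only a change of height. *)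
Lemma connected_suspension :
  (forall g : D -> Prop,
    (forall d, DE d -> exists O, [/\ open O, O d &
      forall d', O d' -> DE d' -> (g d' <-> g d)]) ->
    (forall nu d, DE d -> (g (Frob nu d) <-> g d)) ->
    forall d d', DE d -> DE d' -> g d -> g d') ->
  connected [set: suspension R F].
Proof.
move=> main B [b Bb] [B1 oB1]; rewrite setTI => B1E [B2 cB2].
rewrite setTI => B2E; subst B1 B2.
have oBC : open (~` B) by exact: closed_openC.
have slice m u v : B (susp m u) -> B (susp m v).
  have [s <-] := pos_surj u; have [t <-] := pos_surj v.
  have cs : continuous (fun t => susp m (pos t)).
    apply: susp_continuous; first exact: cst_continuous.
    by apply: continuous_SigSub; exact: continuous_expR.
  move/continuousP in cs.
  exact: (@clopen_line _ (cs _ oB1) (cs _ oBC)).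
have step m nu d u : F nu m = mk d -> (B (susp m u) <-> B (susp (mk d) u)).
  move=> e.
  have nu0 : 0 < (set_val nu)%:R^-1 * set_val u.
    rewrite mulr_gt0 ?invr_gt0 ?ltr0n ?generator_gt0 //; first exact: (set_valP nu).
    exact: (set_valP u).
  pose v : positive_reals R := SigSub (mem_set (nu0 : [set u : R | 0 < u] _)).
  have ev : susp m u = susp (mk d) v.
    apply/to_quotient_eq/rst_step; exists nu, one; split=> /=.
      by rewrite e (@F_mk one d d) // Frob1.
    by rewrite divr1.
  by rewrite ev; split; exact: slice.
pose u1 := pos 0.
(* False outside [DE]; only the values on [DE] matter below. *)
pose g d := exists h : DE d, B (susp (mk (SigSub (mem_set h))) u1).
have gE (d : DE) : g (set_val d) <-> B (susp (mk d) u1).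
  have e (h : DE (set_val d)) : SigSub (mem_set h) = d by exact: val_inj.
  by split=> [[h]|Bd]; [rewrite e | exists (set_valP d); rewrite e].
have cg : continuous (fun d => susp (mk d) u1).
  by apply: susp_continuous => //; exact: cst_continuous.
move/continuousP in cg.
have gLC d : DE d -> exists O, [/\ open O, O d &
    forall d', O d' -> DE d' -> (g d' <-> g d)].
  move=> Ed; pose d1 : DE := SigSub (mem_set Ed).
  have [Bd|Bd] := pselect (B (susp (mk d1) u1)).
    have [V oV VE] := cg _ oB1; exists V; split=> //.
      by have : (set_val @^-1` V) d1 by rewrite VE.
    move=> d' Vd' Ed'; pose d2 : DE := SigSub (mem_set Ed').
    have Bd2 : B (susp (mk d2) u1) by have : (set_val @^-1` V) d2 by []; rewrite VE.
    by split=> _; [apply/(gE d1) | apply/(gE d2)].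
  have [V oV VE] := cg _ oBC; exists V; split=> //.
    by have : (set_val @^-1` V) d1 by rewrite VE.
  move=> d' Vd' Ed'; pose d2 : DE := SigSub (mem_set Ed').
  have Bd2 : ~ B (susp (mk d2) u1) by have : (set_val @^-1` V) d2 by []; rewrite VE.
  by split=> [/(gE d2)|/(gE d1)].
have gF nu d : DE d -> (g (Frob nu d) <-> g d).
  move=> Ed; pose d1 : DE := SigSub (mem_set Ed).
  pose d2 : DE := SigSub (mem_set (FrobE nu Ed)).
  have /step h : F nu (mk d1) = mk d2 by exact: F_mk.
  by split=> [/(gE d2)/h/(gE d1)|/(gE d1)/h/(gE d2)].
have const := main g gLC gF.
apply/seteqP; split=> // y _.
rewrite -(of_quotientK b) in Bb; rewrite -(of_quotientK y).
case: (of_quotient b) Bb => m u; case: (of_quotient y) => n v Bb.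
have [mu [c Fm]] := mk_surj m; have [nu [d Fn]] := mk_surj n.
apply/(step _ _ _ v Fn)/(slice _ u1)/(gE d); apply: (const (set_val c)).
- exact: (set_valP c).
- exact: (set_valP d).
- by apply/gE; have /slice := (step _ _ _ u Fm).1 Bb; exact.
Qed.

End Suspension.

Section Spaces.
Variables (X : scheme) (K0 : function_field X) (K : fieldType).
Variables (iota : {rmorphism K0 -> K}) (C : numClosedFieldType).
Variables (charN0 : set nat) (E : admissible_class C (generated_monoid charN0)).
Let N0 := generated_monoid charN0.
Hypothesis charN0_gt0 : forall p, charN0 p -> (0 < p)%N.

Lemma generated_monoid_gt0 nu : N0 nu -> (0 < nu)%N.
Proof. by elim=> // p n /charN0_gt0 p0 _ n0; rewrite muln_gt0 p0. Qed.

Definition dotXE : set (dotX iota C) := [set d | E _ (dot_char d)].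

Definition dot_frobN (nu : N0) : dotX iota C -> dotX iota C :=
  dot_frob (set_val nu).

Lemma dot_frob1 (d : dotX iota C) : dot_frob 1 d = d.
Proof.
case: d => x chi; congr DotX; apply: char_ext => a.
by rewrite char_powE ?expr1.
Qed.

Let one : N0 := SigSub (mem_set (gen_one charN0)).

Definition level1 (d : dotX iota C) : checkX iota C charN0 :=
  to_quotient (@colim_rel X K0 K iota C charN0) (existT _ one d).

Lemma level1_class (d : dotXE) : checkX_class E (level1 (set_val d)).
Proof. by exists (existT _ one (set_val d)) => //=; exact: (set_valP d). Qed.

Definition level1E (d : dotXE) : checkXE iota E :=
  SigSub (mem_set (level1_class d)).

Lemma level1E_continuous : continuous level1E.
Proof.
apply: continuous_SigSub => d.
apply: (continuous_comp (f := set_val) (g := level1)).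
  exact: initial_continuous.
apply: (continuous_comp (f := existT _ one)).
  exact: existT_continuous.
exact: to_quotient_continuous.
Qed.

(** The transition map from index 1 to index [nu] is [dot_frob nu], so Frobenius brings a point of
    index [nu] to index 1. *)
Lemma level1_frob (s : dot_sum iota C charN0) :
  to_quotient (@colim_rel X K0 K iota C charN0)
    (sum_map (dot_frob (set_val (projT1 s))) s) = level1 (projT2 s).
Proof.
apply/to_quotient_eq/rst_sym/rst_step; exists (set_val (projT1 s)).
  exact: (set_valP (projT1 s)).
by split=> //=; rewrite mul1n.
Qed.

Let E_frob (nu : N0) d : dotXE d -> dotXE (dot_frobN nu d).
Proof. exact: (class_pow E _ (set_valP nu)).1. Qed.

Let frob1 (nu : N0) d : set_val nu = 1%N -> dot_frobN nu d = d.
Proof. by rewrite /dot_frobN => ->; exact: dot_frob1. Qed.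

Let F_mk (nu : N0) (d d' : dotXE) : set_val d' = dot_frobN nu (set_val d) ->
  checkXE_frob iota E nu (level1E d) = level1E d'.
Proof.
by move=> e; apply: val_inj; rewrite /= check_frobE /level1 e.
Qed.

Let mk_surj (m : checkXE iota E) : exists nu d, checkXE_frob iota E nu m = level1E d.
Proof.
have [s Es em] := set_valP m; exists (projT1 s), (SigSub (mem_set (Es : dotXE _))).
apply: val_inj; apply: etrans (congr1 (check_frob (set_val (projT1 s))) em) _.
by rewrite check_frobE level1_frob.
Qed.

Variable R : realType.

Lemma connected_suspensions :
  (forall g : dotX iota C -> Prop,
    (forall d, dotXE d -> exists O, [/\ open O, O d &
      forall d', O d' -> dotXE d' -> (g d' <-> g d)]) ->
    (forall nu d, dotXE d -> (g (dot_frobN nu d) <-> g d)) ->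
    forall d d', dotXE d -> dotXE d' -> g d -> g d') ->
  connected [set: suspension R (checkXE_frob iota E)] /\
  connected [set: suspension R (checkX0E_frob iota E)].
Proof.
move=> main; split.
  apply: (connected_suspension (Frob := dot_frobN) (mk := level1E)) main => //.
  - exact: level1E_continuous.
  - exact: generated_monoid_gt0.
apply: (connected_suspension (Frob := dot_frobN)
  (mk := fun d => to_quotient (@gal_rel X K0 K iota C charN0 E) (level1E d))) main => //.
- move=> d; apply: (continuous_comp (f := level1E)); first exact: level1E_continuous.
  exact: to_quotient_continuous.
- by move=> nu d d' e; rewrite checkX0E_frobE (F_mk e).
- move=> m; have [nu [d e]] := mk_surj (of_quotient m); exists nu, d.
  by rewrite -e -checkX0E_frobE of_quotientK.
- exact: generated_monoid_gt0.
Qed.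

End Spaces.

(** * Characters with prescribed restriction to the roots of unity *)

Section CharDiv.
Variables (k C : fieldType) (chi' chi : character C k).

Fact char_div_eq0 a : chi' a / chi a = 0 <-> a = 0.
Proof.
split=> [/eqP|->]; last by rewrite char0 mul0r.
by rewrite mulf_eq0 invr_eq0 => /orP[] /eqP/char_eq0.
Qed.

Fact char_div1 : chi' 1 / chi 1 = 1.
Proof. by rewrite !char1 divr1. Qed.

Fact char_divM a b : chi' (a * b) / chi (a * b) = chi' a / chi a * (chi' b / chi b).
Proof. by rewrite !charM invfM mulrACA. Qed.

Definition char_div : character C k := Character char_div_eq0 char_div1 char_divM.
End CharDiv.

Section CharMix.
Variables (k C : fieldType) (chi' chi : character C k) (w : k -> k).
Hypothesis w1 : w 1 = 1.
Hypothesis w_neq0 : forall a, a != 0 -> w a != 0.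
Hypothesis wM : forall a b, a != 0 -> b != 0 -> w (a * b) = w a * w b.

Let mix a := if a == 0 then 0 else chi' (w a) * chi (a / w a).

Fact char_mix_eq0 a : mix a = 0 <-> a = 0.
Proof.
rewrite /mix; case: eqVneq => // a0; split=> [/eqP|/eqP]; last by rewrite (negbTE a0).
have wa0 := w_neq0 a0; rewrite mulf_eq0 => /orP[] /eqP/char_eq0/eqP.
  by rewrite (negbTE wa0).
by rewrite mulf_eq0 invr_eq0 (negbTE a0) (negbTE wa0).
Qed.

Fact char_mix1 : mix 1 = 1.
Proof. by rewrite /mix oner_eq0 w1 divr1 !char1 mulr1. Qed.

Fact char_mixM a b : mix (a * b) = mix a * mix b.
Proof.
rewrite /mix mulf_eq0; case: eqVneq => [|a0] /=; first by rewrite mul0r.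
case: eqVneq => [|b0] /=; first by rewrite mulr0.
by rewrite wM // charM invfM [a * b * _]mulrACA [X in _ * X = _]charM mulrACA.
Qed.

(** For a retraction [w] this is [chi'] on its image and [chi] on the complement. *)
Definition char_mix : character C k := Character char_mix_eq0 char_mix1 char_mixM.

Lemma char_mixE a : a != 0 -> char_mix a = chi' (w a) * chi (a / w a).
Proof. by move=> a0; rewrite /= /mix (negbTE a0). Qed.
End CharMix.

Section CoprimeTorsion.
Variables (k : fieldType) (q : nat).

Definition coprime_torsion : set k :=
  [set z | exists N, [/\ (0 < N)%N, coprime N q & z ^+ N = 1]].

Lemma coprime_torsion_torsion z : coprime_torsion z -> torsion k z.
Proof. by move=> [N [N0 _ zN]]; exists N. Qed.

Lemma coprime_torsion1 : coprime_torsion 1.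
Proof. by exists 1%N; rewrite coprime1n expr1n. Qed.

Lemma coprime_torsionB z w : coprime_torsion z -> coprime_torsion w ->
  coprime_torsion (z / w).
Proof.
move=> [N [N0 cN zN]] [M [M0 cM wM]]; exists (N * M)%N.
rewrite muln_gt0 N0 M0 coprimeMl cN cM; split=> //.
by rewrite expr_div_n exprM zN expr1n mulnC exprM wM expr1n divr1.
Qed.

End CoprimeTorsion.

Section InjectiveExtension.
Variables (R : realType) (k : fieldType) (u : nat -> k).
Hypothesis u_neq0 : forall n, u n != 0.
Hypothesis u_surj : forall a, a != 0 -> exists n, u n = a.

Lemma complex_char0 n : (0 < n)%N -> n%:R != 0 :> R[i].
Proof. by rewrite pnatr_eq0 -lt0n. Qed.

(** [G] is respected on torsion only, since the twist that creates injectivity moves the other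
    values. *)
Lemma char_inj_extend (G : set (k * R[i])) : partial_hom G ->
  (forall a, torsion k a -> G (a, 1) -> a = 1) ->
  exists chi : character R[i] k, char_inj chi /\
    forall x, torsion k x.1 -> G x -> chi x.1 = x.2.
Proof.
move=> hG Gi; have [psi [psiG tpsi]] := torsion_inj_extend complex_char0 hG Gi.
have h0 : log_hom (fun _ : k => 0 : R[i]) by move=> a b; rewrite addr0.
have [L [hL [iL _]]] := generic_twist u_neq0 u_surj [::] tpsi h0 ltr01.
by exists (twist psi hL); split=> // x tx /psiG <-; exact: twist_torsion.
Qed.

(** A logarithm of [phi] on all of [k^*] may fail to exist, as it does for some homomorphisms from
    the rationals to [C^*]; hence only [n] values are matched. [M] clears the denominators in the
    coordinates of these elements. Logarithms are chosen at [M]-th roots [be j] of the [u j] and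
    extended linearly; the roots of unity lost on the way are killed by [phi]. *)
Lemma log_lift (phi : character R[i] k) n :
  GRing.closed_field_axiom k -> (forall z, torsion k z -> phi z = 1) ->
  exists L : k -> R[i], log_hom L /\
    forall i, (i < n)%N -> cexp (L (u i)) = phi (u i).
Proof.
move=> hk phiT; have [c [cM _ cE]] := coordinates (mul_subgroup1 k) u_neq0 u_surj.
pose mz i := cid (cE _ (u_neq0 i)); pose m i := projT1 (mz i).
pose z i := projT1 (cid (projT2 (mz i))).
have mzP i : [/\ (0 < m i)%N, u i ^+ m i = monomial u (z i)
    & c (u i) *+ m i = map_poly intr (z i)].
  rewrite /z /m; case: (mz i) => m' /= h; case: cid => z' /= [m0 e ez].
  by split=> //; apply/divr1_eq.
pose M := (\prod_(i < n) m i)%N.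
have M0 : (0 < M)%N by apply: prodn_gt0 => i; have [] := mzP i.
pose N := (\max_(i < n) size (z i))%N.
have root_ex (b : k) : exists d, d ^+ M = b.
  have [d] := hk M (fun i => if i == 0%N then b else 0) M0.
  case: (M) M0 => // M' _; rewrite big_ord_recl /= mulr1 big1 ?addr0 => [|i _].
    by exists d.
  by rewrite mul0r.
pose be j := projT1 (cid (root_ex (u j))).
have beE j : be j ^+ M = u j by rewrite /be; case: cid.
have be0 j : be j != 0.
  by apply: contra_neq (u_neq0 j) => b0; rewrite -beE b0 expr0n eqn0Ngt M0.
pose la j := projT1 (cid (cexp_surj (char_neq0 phi (be0 j)))).
have laE j : cexp (la j) = phi (be j) by rewrite /la; case: cid.
exists (fun a => \sum_(j < N) ratr ((c a)`_j *+ M) * la j); split.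
  move=> a b a0 b0; rewrite -big_split; apply: eq_bigr => j _ /=.
  by rewrite cM // coefD mulrnDl rmorphD mulrDl.
move=> i ltin; have [m0 mE zE] := mzP i.
have [t tE] : exists t, M = (m i * t)%N.
  by exists (\prod_(j < n | j != Ordinal ltin) m j)%N; rewrite /M (bigD1 (Ordinal ltin)).
have Nz : (size (z i) <= N)%N.
  exact: (@leq_bigmax _ (fun j : 'I_n => size (z j)) (Ordinal ltin)).
have coefE j : (c (u i))`_j *+ M = (((z i) *+ t)`_j)%:~R.
  rewrite tE mulrnA coefMn rmorphMn /=; congr (_ *+ _).
  by rewrite -coefMn zE coef_map.
have -> : \sum_(j < N) ratr ((c (u i))`_j *+ M) * la j =
    \sum_(j < N) la j *~ (z i *+ t)`_j.
  by apply: eq_bigr => j _; rewrite coefE ratr_int mulrzl.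
have cexpz w (e : int) : cexp (w *~ e) = cexp w ^ e.
  case: e => e; first exact: cexp_nat.
  rewrite NegzE -invr_expz mulrNz; apply: (mulIf (cexp_neq0 (w *~ e.+1))).
  by rewrite cexpN -pmulrn cexp_nat -exprnP mulVf // expf_neq0 // cexp_neq0.
have -> : cexp (\sum_(j < N) la j *~ (z i *+ t)`_j) =
    phi (\prod_(j < N) be j ^ (z i *+ t)`_j).
  elim/big_ind2: _ => [|w1 v1 w2 v2 e1 e2|j _]; first by rewrite cexp0 char1.
    by rewrite cexpD charM e1 e2.
  by rewrite cexpz laE char_expz.
set v := \prod_(j < N) _.
have v0 : v != 0 by apply/prodf_neq0 => j _; exact: expfz_neq0.
have vM : v ^+ M = u i ^+ M.
  have -> : u i ^+ M = monomial u (z i *+ t) by rewrite tE exprM mE monomialMn.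
  rewrite (@monomial_widen _ _ _ N); last first.
    apply: leq_trans Nz; rewrite -scaler_nat; exact: size_scale_leq.
  rewrite /v -prodrXl; apply: eq_bigr => j _.
  by rewrite exprnP exprz_exp mulrC -exprz_exp -exprnP beE.
rewrite -[u i](divfK v0) charM (phiT (u i / v)) ?mul1r //.
exists M; split=> //; rewrite expr_div_n vM divff //.
by rewrite expf_neq0.
Qed.

End InjectiveExtension.

Section FrobeniusRoot.
Variables (k : fieldType) (C : numClosedFieldType) (chi : character C k) (nu : nat).
Hypothesis hk : GRing.closed_field_axiom k.
Hypothesis nu0 : (0 < nu)%N.
Hypothesis ker_nu : (char_ker chi `&` torsion k #= `I_nu)%card.

Let A := char_ker chi `&` torsion k.

Let A_seq : exists s : seq k, [/\ uniq s, size s = nu & forall a, a \in s <-> A a].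
Proof.
have fA : finite_set A by exists nu.
exists (finmap.enum_fset (fset_set A)); split; first exact: finmap.fset_uniq.
  exact: card_fset_set.
move=> a; have -> : (a \in finmap.enum_fset (fset_set A)) = (a \in A).
  exact: in_fset_set fA a.
by rewrite inE.
Qed.

(** Multiplication by [b] permutes the [nu] elements of [A], and comparing their products gives
    [b ^ nu = 1]. Conversely ['X^nu - 1] has no room for further roots. *)
Let ker_expr a : A a <-> a ^+ nu = 1.
Proof.
have [s [us ss sA]] := A_seq.
have AX b : A b -> b ^+ nu = 1.
  move=> Ab; have [kb tb] := Ab; have b0 := torsion_neq0 tb.
  have perm : perm_eq [seq b * c | c <- s] s.
    apply: uniq_perm => //; first by rewrite map_inj_uniq //; exact: mulfI.
    apply/(uniq_min_size _ _ _).2 => //.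
      by rewrite map_inj_uniq //; exact: mulfI.
      move=> _ /mapP[c /sA[kc tc] ->]; apply/sA; split; last exact: torsionM.
      by rewrite /char_ker /= charM kb kc mulr1.
    by rewrite size_map.
  have e : \prod_(c <- s) (b * c) = \prod_(c <- s) c.
    by rewrite -(big_map ( *%R b) xpredT id); exact: perm_big.
  move: e; rewrite big_split /= big_const_seq count_predT ss iter_mulr_1 => e.
  apply: (mulIf (x := \prod_(c <- s) c)); last by rewrite e mul1r.
  by rewrite prodf_seq_neq0; apply/allP => c /sA[_ /torsion_neq0].
split; first exact: AX.
move=> an; apply/sA; apply: contraT => nas.
have p0 : 'X^nu - 1 != 0 :> {poly k} by rewrite -size_poly_gt0 size_XnsubC.
have : (size (a :: s) < size ('X^nu - 1 : {poly k})%R)%N.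
  apply: max_poly_roots => //; last by rewrite /= nas.
  apply/allP => b; rewrite in_cons rootE !hornerE => /orP[/eqP ->|/sA/AX ->].
    by rewrite an subrr.
  by rewrite subrr.
by rewrite size_XnsubC //= ss ltnn.
Qed.

Let root_ex (b : k) : exists c, c ^+ nu = b.
Proof.
have [c] := hk (fun i => if i == 0%N then b else 0) nu0.
case: (nu) nu0 => // n _; rewrite big_ord_recl /= mulr1 big1 ?addr0 => [|i _].
  by exists c.
by rewrite mul0r.
Qed.

Let root (b : k) : k := projT1 (cid (root_ex b)).

Let rootE b : root b ^+ nu = b.
Proof. by rewrite /root; case: cid. Qed.

Let root_eq0 b : root b = 0 <-> b = 0.
Proof.
rewrite -{2}(rootE b); split=> [->|/eqP]; first by rewrite expr0n eqn0Ngt nu0.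
by rewrite expf_eq0 => /andP[_ /eqP].
Qed.

Let chi_root b c : c ^+ nu = b -> chi (root b) = chi c.
Proof.
have [->|b0] := eqVneq b 0.
  move=> /eqP; rewrite expf_eq0 => /andP[_ /eqP ->].
  by have -> : root 0 = 0 by exact/root_eq0.
move=> cb; have c0 : c != 0 by apply: contra_neq b0 => c0; rewrite -cb c0 expr0n eqn0Ngt nu0.
rewrite -[root b](divfK c0) charM; have [-> _] : A (root b / c); last exact: mul1r.
by apply/ker_expr; rewrite expr_div_n rootE cb divff.
Qed.

Let fchar b := chi (root b).

Let fchar_eq0 b : fchar b = 0 <-> b = 0.
Proof. by rewrite /fchar char_eq0. Qed.

Let fchar1 : fchar 1 = 1.
Proof. by rewrite /fchar (@chi_root 1 1) ?expr1n ?char1. Qed.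

Let fcharM a b : fchar (a * b) = fchar a * fchar b.
Proof. by rewrite /fchar (@chi_root _ (root a * root b)) ?charM // exprMn !rootE. Qed.

(* [chi] kills exactly the [nu]-th roots of unity, so it factors through the
   [nu]-th power map. *)
Lemma frobenius_root : exists psi : character C k, torsion_inj psi /\
  char_pow psi nu = chi.
Proof.
exists (Character fchar_eq0 fchar1 fcharM); split=> [b tb|].
  rewrite /= /fchar => rb; rewrite -(rootE b); apply/ker_expr; split=> //.
  by have [n [n0 bn]] := tb; exists (nu * n)%N; rewrite muln_gt0 nu0 exprM rootE.
by apply: char_ext => b; rewrite char_powE //= /fchar -charX rootE.
Qed.

End FrobeniusRoot.

(** * Locally constant Frobenius invariant functions *)

Section Main.
Variables (R : realType) (X : scheme) (K0 : function_field X).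
Variables (K : closedFieldType) (iota : {rmorphism K0 -> K}).
Let C : numClosedFieldType := R[i].
Variable charN0 : set nat.
Let N0 := generated_monoid charN0.
Variable E : admissible_class C N0.
Hypothesis charK : forall n, (0 < n)%N -> n%:R != 0 :> K.
Hypothesis charN0_prime : forall p, charN0 p -> prime p.
Hypothesis residue_charN0 : residue_characteristics K0 `<=` charN0.
Hypothesis finite_kernel : forall (k : fieldType) (chi : character C k),
  finite_kernel_class N0 chi -> E k chi.

Variable u : nat -> K.
Hypothesis u_neq0 : forall n, u n != 0.
Hypothesis u_surj : forall a, a != 0 -> exists n, u n = a.

Variable eta : Defs.point iota.
Hypothesis eta_dense : forall V, open V -> V !=set0 -> V (base eta).
Hypothesis eta_ideal0 : forall z, sp_ideal (spec_pt eta) z -> z = 0.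
Hypothesis eta_ringT : forall z, sp_ring (spec_pt eta) z.

Let EX : set (dotX iota C) := @dotXE X K0 K iota C charN0 E.

Variable g : dotX iota C -> Prop.
Hypothesis g_locally_constant : forall d, EX d -> exists O, [/\ open O, O d &
  forall d', O d' -> EX d' -> (g d' <-> g d)].
Hypothesis g_frob : forall nu d, N0 nu -> EX d -> (g (dot_frob nu d) <-> g d).

Definition gen (chi : character C K) : dotX iota C :=
  DotX (generic_char eta_ideal0 eta_ringT chi).

Lemma genE chi z : dot_char (gen chi) (reduce (spec_pt (dot_pt (gen chi))) z) = chi z.
Proof. exact: generic_charE. Qed.

Lemma has_order1 (k : fieldType) (chi : character C k) :
  char_inj chi -> has_order_in N0 (char_ker chi).
Proof.
move=> ichi; exists 1%N; first exact: gen_one.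
have -> : char_ker chi = [set 1].
  by apply/seteqP; split=> a /= => [/ichi//|->]; exact: char1.
exact: card_set1.
Qed.

Lemma char_inj_E (x : Defs.point iota) (chi : character C (kappa x)) :
  char_inj chi -> E _ chi.
Proof.
move=> ichi; apply: finite_kernel; split; last exact: has_order1.
exact: point_residue_closed.
Qed.

Lemma gen_E chi : char_inj chi -> EX (gen chi).
Proof.
move=> ichi; apply: char_inj_E => c; have [z <-] := reduce_full_surj c.
by rewrite generic_charE => /ichi ->; exact: reduce1.
Qed.

Lemma gen_frob nu chi : (0 < nu)%N ->
  dot_frob nu (gen chi) = gen (char_pow chi nu).
Proof.
move=> nu0; rewrite /dot_frob /gen /=; congr DotX; apply: char_ext => c.
have [z <-] := reduce_full_surj c.
by rewrite char_powE // !generic_charE char_powE.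
Qed.

Lemma g_limit (T : Type) (F : set_system T) {FF : Filter F} (f : T -> dotX iota C)
    (d : dotX iota C) : EX d -> (forall t, EX (f t)) ->
  (forall U, affine_open U -> U (base (dot_pt d)) -> forall t, U (base (dot_pt (f t)))) ->
  (forall r, in_local (spec_pt (dot_pt d)) r ->
    (fun t => dot_char (f t) (reduce (spec_pt (dot_pt (f t))) r)) @ F -->
    dot_char d (reduce (spec_pt (dot_pt d)) r)) ->
  \forall t \near F, g (f t) <-> g d.
Proof.
move=> Ed Ef fU fd; have [V [oV Vd gV]] := g_locally_constant Ed.
have [U aU Ud] := scheme_affine (base (dot_pt d)).
have : \forall t \near F, V (f t).
  apply: (dot_cvg aU Ud (fU U aU Ud)) => // r nr; apply: fd; apply: in_local_ring.
  exact: stalk_normalization_ring nr.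
by apply: filterS => t Vt; exact: gV.
Qed.

Lemma g_sequence (f : nat -> dotX iota C) (d : dotX iota C) : EX d ->
  (forall n, EX (f n)) ->
  (forall U, affine_open U -> U (base (dot_pt d)) -> forall n, U (base (dot_pt (f n)))) ->
  (forall r, in_local (spec_pt (dot_pt d)) r ->
    (fun n => dot_char (f n) (reduce (spec_pt (dot_pt (f n))) r)) @ \oo -->
    dot_char d (reduce (spec_pt (dot_pt d)) r)) ->
  exists n0, forall n, (n0 <= n)%N -> (g (f n) <-> g d).
Proof.
by move=> Ed Ef fU fd; have [n0 _ n0P] := g_limit Ed Ef fU fd; exists n0.
Qed.

Lemma gen_sequence (f : nat -> character C K) (chi : character C K) :
  char_inj chi -> (forall n, char_inj (f n)) ->
  (forall r, (fun n => f n r) @ \oo --> chi r) ->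
  exists n0, forall n, (n0 <= n)%N -> (g (gen (f n)) <-> g (gen chi)).
Proof.
move=> ichi fi fchi; apply: g_sequence => [|n|//|r _]; [exact: gen_E|exact: gen_E|].
rewrite genE; apply: (@cvg_trans _ ((fun n => f n r) @ \oo)); last exact: fchi.
by apply: near_eq_cvg; apply: nearW => n; rewrite genE.
Qed.

Lemma twist_path chi L (hL : log_hom L) :
  (forall t : R, char_inj (twist chi (log_hom_scale t%:C%C hL))) ->
  forall s t : R, g (gen (twist chi (log_hom_scale s%:C%C hL))) ->
    g (gen (twist chi (log_hom_scale t%:C%C hL))).
Proof.
move=> itw; pose f (t : R) := gen (twist chi (log_hom_scale t%:C%C hL)).
have f_cvg (r : K) (t : R) : (fun s : R => chi r * cexp (s%:C%C * L r) : C) @ nbhs t -->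
    (chi r * cexp (t%:C%C * L r) : C).
  apply: cvgM; first exact: cvg_cst.
  apply: cvg_cexp.
    have e (s : R) : complex.Re (s%:C%C * L r) = s * complex.Re (L r).
      by case: (L r) => a b /=; rewrite mul0r subr0.
    rewrite e; under eq_fun do rewrite e.
    by apply: cvgM; [exact: cvg_id | exact: cvg_cst].
  have e (s : R) : complex.Im (s%:C%C * L r) = s * complex.Im (L r).
    by case: (L r) => a b /=; rewrite mul0r addr0.
  rewrite e; under eq_fun do rewrite e.
  by apply: cvgM; [exact: cvg_id | exact: cvg_cst].
have near_f t : \forall s \near nbhs t, g (f s) <-> g (f t).
  apply: (@g_limit R (nbhs t) _ f (f t)) => [|s|//|r _].
  - exact: gen_E.
  - exact: gen_E.
  rewrite genE; apply: cvg_trans (f_cvg r t).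
  by apply: near_eq_cvg; apply: nearW => s; rewrite genE.
apply: clopen_line; rewrite openE => t /= gt; rewrite /interior.
  by apply: filterS (near_f t) => s [_]; exact.
by apply: filterS (near_f t) => s [h _] /h.
Qed.

Lemma gen_torsion (chi chi' : character C K) : char_inj chi -> char_inj chi' ->
  (forall z, torsion K z -> chi z = chi' z) ->
  g (gen chi) -> g (gen chi').
Proof.
move=> ichi ichi' tchi gchi.
have phiT z : torsion K z -> char_div chi' chi z = 1.
  by move=> tz; rewrite /= tchi // divff // char_neq0 // torsion_neq0.
have approx n : exists f : character C K, [/\ char_inj f, g (gen f)
    & forall i, (i < n)%N -> exists w : C, [/\ f (u i) = chi' (u i) * cexp w,
      `|complex.Re w| < n.+1%:R^-1 & `|complex.Im w| < n.+1%:R^-1]].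
  have [L0 [hL0 L0E]] := log_lift u_neq0 u_surj n (@solve_monicpoly K) phiT.
  have n0 : 0 < n.+1%:R^-1 :> R by rewrite invr_gt0 ltr0n.
  have [L [hL [itw Lclose]]] :=
    generic_twist_path u_neq0 u_surj [seq u i | i <- seq.iota 0 n] ichi hL0 n0.
  (* The path starts at [chi] for [t = 0]; at [t = 1] it agrees with [chi'] on the first [n]
     elements up to a factor close to 1. *)
  exists (twist chi (log_hom_scale 1%:C%C hL)); split; first exact: itw.
    apply: (twist_path itw (s := 0)); congr (g (gen _)): gchi.
    by apply: char_ext => a; rewrite /= mul0r cexp0 mulr1.
  move=> i ltin; exists (L (u i) - L0 (u i)).
  have [|hR hI] := Lclose (u i); first by rewrite map_f // mem_iota.
  have e : cexp (L (u i)) = cexp (L0 (u i)) * cexp (L (u i) - L0 (u i)).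
    by rewrite -cexpD addrC subrK.
  have e' : chi' (u i) = chi (u i) * cexp (L0 (u i)).
    by rewrite L0E //= mulrC divfK // char_neq0.
  split; [|exact: hR|exact: hI].
  by rewrite e' -mulrA -e /= mul1r.
pose f n := projT1 (cid (approx n)).
have fi n : char_inj (f n) by rewrite /f; case: cid => ? [].
have gf n : g (gen (f n)) by rewrite /f; case: cid => ? [].
have [|n0 n0P] := gen_sequence ichi' fi; last exact: (n0P n0 (leqnn _)).1.
move=> r; have [->|r0] := eqVneq r 0.
  rewrite char0; apply: (@cvg_trans _ ((fun=> 0 : C) @ \oo)); last exact: cvg_cst.
  by apply: near_eq_cvg; apply: nearW => n; rewrite char0.
have [i <-] := u_surj r0.
have zP n : exists w : C, [/\ `|complex.Re w| < n.+1%:R^-1, `|complex.Im w| < n.+1%:R^-1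
    & (i < n)%N -> f n (u i) = chi' (u i) * cexp w].
  have [lt|le] := ltnP i n; last first.
    by exists 0; rewrite /= normr0 invr_gt0 ltr0n.
  rewrite /f; case: cid => ps [/= _ _ h]; have [w [wE wR wI]] := h i lt.
  by exists w.
pose w n := projT1 (cid (zP n)).
have wR n : `|complex.Re (w n)| < n.+1%:R^-1 by rewrite /w; case: cid => ? [].
have wI n : `|complex.Im (w n)| < n.+1%:R^-1 by rewrite /w; case: cid => ? [].
have wE n : (i < n)%N -> f n (u i) = chi' (u i) * cexp (w n).
  by rewrite /w; case: cid => ? [].
have : (fun n => chi' (u i) * cexp (w n) : C) @ \oo --> (chi' (u i) * cexp 0 : C).
  by apply: cvgM; [exact: cvg_cst | apply: cvg_cexp => /=; exact: cvg_small].
rewrite cexp0 mulr1; apply: cvg_trans.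
apply: near_eq_cvg; near=> n; rewrite wE //.
by near: n; exists i.+1.
Unshelve. all: by end_near. Qed.

(* Splitting off the torsion reduces the convergence of [f] on [K] to its
   convergence on the roots of unity. *)
Lemma gen_torsion_sequence (f : nat -> character C K) (chi : character C K) :
  char_inj chi -> (forall n, char_inj (f n)) ->
  (forall z, torsion K z -> exists n0, forall n, (n0 <= n)%N -> f n z = chi z) ->
  exists n0, forall n, (n0 <= n)%N -> (g (gen (f n)) <-> g (gen chi)).
Proof.
move=> ichi fi fchi.
have [w [wT w1 wM wid]] := retraction (mul_subgroup_torsion K) (@mul_divisible_torsion K).
have w0 a : a != 0 -> w a != 0 by move=> /wT; exact: torsion_neq0.
(* Equal to [f n] on roots of unity and to [chi] on a complement. At each element it is eventually
   equal to [chi], and [gen_torsion] compares it with [f n]. *)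
pose h n := char_mix (f n) chi w1 w0 wM.
have hE n a : a != 0 -> h n a = f n (w a) * chi (a / w a) by exact: char_mixE.
have hT n z : torsion K z -> h n z = f n z.
  move=> tz; have z0 := torsion_neq0 tz.
  by rewrite hE // wid // divff // char1 mulr1.
have hi n : char_inj (h n).
  move=> a; have [->|a0] := eqVneq a 0.
    by rewrite char0 => /eqP; rewrite eq_sym oner_eq0.
  move=> ha; have := ha; rewrite hE // => e.
  have [m [m0 wm]] := wT _ a0.
  have ta : torsion K a.
    exists m; split=> //; apply: (ichi).
    have : (a / w a) ^+ m = 1.
      apply: (ichi); rewrite charX; have : (f n (w a) * chi (a / w a)) ^+ m = 1.
        by rewrite e expr1n.
      by rewrite exprMn -[f n (w a) ^+ m]charX wm char1 mul1r.
    by rewrite expr_div_n wm divr1 => ->; exact: char1.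
  by apply: (fi n); rewrite -(hT n a ta).
have [|n0 n0P] := gen_sequence ichi hi.
  move=> r; have [->|r0] := eqVneq r 0.
    rewrite char0; apply: (@cvg_trans _ ((fun=> 0 : C) @ \oo)); last exact: cvg_cst.
    by apply: near_eq_cvg; apply: nearW => n; rewrite char0.
  have [n0 n0P] := fchi _ (wT _ r0).
  apply: (@cvg_trans _ ((fun=> chi r : C) @ \oo)); last exact: cvg_cst.
  apply: near_eq_cvg; exists n0 => // n nn0.
  by rewrite (hE n r r0) (n0P n nn0) -charM mulrC divfK // w0.
exists n0 => n nn0; have [h1 h2] := n0P n nn0.
have tor z : torsion K z -> f n z = h n z by move=> tz; rewrite hT.
split=> gn.
  by apply: h1; exact: gen_torsion (fi n) (hi n) tor gn.
apply: gen_torsion (hi n) (fi n) _ (h2 gn) => z tz.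
by rewrite tor.
Qed.

Lemma N0_gt0 nu : N0 nu -> (0 < nu)%N.
Proof. by apply: generated_monoid_gt0 => p /charN0_prime/prime_gt0. Qed.

Lemma generated_monoidX p e : charN0 p -> N0 (p ^ e)%N.
Proof.
move=> cp; elim: e => [|e IH]; first by rewrite expn0; exact: gen_one.
by rewrite expnS; exact: gen_mul.
Qed.

Lemma residue_prime (x : Defs.point iota) p : prime p ->
  p%:R = 0 :> kappa x -> charN0 p.
Proof.
move=> p_pr p0; apply: residue_charN0; split=> //; exists (base x).
have sO := local_ring_subring K0 (base x).
apply/(pt_over (subring_nat sO p)); rewrite rmorph_nat.
have sS := sp_subring (spec_pt x); have Sp := subring_nat sS p.
have Lp := in_local_ring Sp.
have /asboolP[a [b [pa Sb pb e]]] : in_maximal (spec_pt x) p%:R.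
  by apply/(reduce_eq0 Lp); rewrite reduce_nat.
have b0 := den_neq0 pb.
have [_ _ _ pM [_ pr]] := sp_prime (spec_pt x).
have : sp_ideal (spec_pt x) (p%:R * b) by rewrite e divfK.
by case/(pr _ _ Sp Sb).
Qed.

Lemma char_exponent_N0 (x : Defs.point iota) q e :
  char_exponent (kappa x) q -> N0 (q ^ e)%N.
Proof.
case=> [[-> _]|[q_pr q0]]; first by rewrite exp1n; exact: gen_one.
by apply: generated_monoidX; exact: residue_prime q0.
Qed.

(** Frobenius powers of [gen (psi n)] tend to [d], while [psi n] tends to [theta] on roots of unity;
    invariance of [g] removes the exponents. The values of [theta] on [q]-power roots of unity are
    not tied to [d], and this freedom drives the rest of the argument. *)
Lemma specialization (d : dotX iota C) q (theta : character C K) :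
  EX d -> char_exponent (kappa (dot_pt d)) q -> char_inj theta ->
  (forall z, coprime_torsion q z ->
    theta z = dot_char d (reduce (spec_pt (dot_pt d)) z)) ->
  (g d <-> g (gen theta)).
Proof.
move=> Ed hq itheta compat; set x := spec_pt (dot_pt d).
have [|psi [ipsi psiT psiC]] := @character_approximation R K x u u_neq0 u_surj
    (@stalk_closed X K0 K iota (base (dot_pt d))) q hq (dot_char d) theta
    (char_inj_torsion itheta).
  by move=> z N zN N_gt0 cN; apply: compat; exists N.
pose f n := dot_frob (q ^ n`!) (gen (psi n)).
have q0 n : (0 < q ^ n`!)%N by rewrite expn_gt0 (char_exponent_gt0 hq).
have N0q n : N0 (q ^ n`!)%N by exact: char_exponent_N0 hq.
have Ef n : EX (f n) by exact: (class_pow E _ (N0q n)).1 (gen_E (ipsi n)).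
have [|r Lr|n0 n0P] := g_sequence Ed Ef.
- move=> U [oU _] Ud n; apply: eta_dense => //.
  by exists (base (dot_pt d)).
- apply: cvg_trans (psiC r Lr); apply: near_eq_cvg; apply: nearW => n.
  by rewrite /f gen_frob // genE char_powE.
have [n1 n1P] := gen_torsion_sequence itheta ipsi psiT.
pose n := maxn n0 n1.
rewrite -(n0P n (leq_maxl _ _)) -(n1P n (leq_maxr _ _)).
by apply: g_frob => //; exact: gen_E.
Qed.

(** Admissibility bounds the torsion of the kernel by an order [nu] in [N0], so the character is the
    [nu]-th power of one that is injective on torsion and again in [E]. *)
Lemma torsion_inj_reduction (d : dotX iota C) : EX d -> exists d' : dotX iota C,
  [/\ EX d', torsion_inj (dot_char d') & (g d <-> g d')].
Proof.
move=> Ed; have [nu Nnu ker] := class_torsion Ed.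
have [psi [tpsi psiE]] := frobenius_root (point_residue_closed (x := dot_pt d))
  (N0_gt0 Nnu) ker.
exists (DotX psi); have E' : EX (DotX psi).
  by apply/(class_pow E psi Nnu); rewrite psiE.
split=> //; rewrite -(g_frob Nnu E').
by have -> : dot_frob nu (DotX psi) = d by rewrite /dot_frob /= psiE; case: (d).
Qed.

Lemma coprime_torsion_char_inj q (f : K -> C) :
  f 1 = 1 -> (forall z w, coprime_torsion q z -> coprime_torsion q w ->
    f (z / w) = f z / f w) ->
  (forall z, coprime_torsion q z -> f z != 0) ->
  (forall z, coprime_torsion q z -> f z = 1 -> z = 1) ->
  exists theta : character C K, char_inj theta /\
    forall z, coprime_torsion q z -> theta z = f z.
Proof.
move=> f1 fM f0 fi.
pose G : set (K * C) := [set y | exists z, coprime_torsion q z /\ y = (z, f z)].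
have [||theta [ith thG]] := @char_inj_extend R K u u_neq0 u_surj G.
- split.
  + by exists 1; rewrite f1; split=> //; exact: coprime_torsion1.
  + move=> _ _ [z [tz ->]] [w [tw ->]]; exists (z / w).
    by rewrite fM //; split=> //; exact: coprime_torsionB.
  + move=> _ [z [tz ->]]; split; last exact: f0.
    exact: torsion_neq0 (coprime_torsion_torsion tz).
  + by move=> b [z [tz [<- ->]]].
- by move=> a _ [z [tz [-> e]]]; exact: fi.
exists theta; split=> // z tz.
apply: (thG (z, f z)); first exact: coprime_torsion_torsion tz.
by exists z.
Qed.

Lemma reduce_coprime_torsion (x : Defs.point iota) q z :
  char_exponent (kappa x) q -> coprime_torsion q z ->
  reduce (spec_pt x) z = 1 -> z = 1.
Proof.
move=> hq [N [N_gt0 cN zN]].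
exact: (@reduce_torsion_inj K (spec_pt x) (@stalk_closed X K0 K iota (base x))
  q hq z N zN N_gt0 cN).
Qed.

Lemma coprime_torsion_unit (x : Defs.point iota) q z :
  coprime_torsion q z -> local_unit (spec_pt x) z.
Proof.
move=> /coprime_torsion_torsion.
exact: (@torsion_local_unit K (spec_pt x) (@stalk_closed X K0 K iota (base x))).
Qed.

Lemma reduce_coprime_torsionB (x : Defs.point iota) q z w :
  coprime_torsion q z -> coprime_torsion q w ->
  reduce (spec_pt x) (z / w) = reduce (spec_pt x) z / reduce (spec_pt x) w.
Proof.
move=> /(coprime_torsion_unit x) Uz /(coprime_torsion_unit x) Uw.
have [[Lz _] [LV _]] := (Uz, local_unitV Uw).
by rewrite (reduceM Lz LV) (reduceV Uw).
Qed.

Lemma generic_companion (d : dotX iota C) : EX d ->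
  exists theta : character C K, char_inj theta /\ (g d <-> g (gen theta)).
Proof.
move=> /torsion_inj_reduction[d' [Ed' td' gd]].
have [q hq] := char_exponent_exists (kappa (dot_pt d')).
have [||||theta [ith thE]] := @coprime_torsion_char_inj q
    (fun z => dot_char d' (reduce (spec_pt (dot_pt d')) z)).
- by rewrite reduce1 char1.
- by move=> z w tz tw; rewrite (reduce_coprime_torsionB _ tz tw) charM charV.
- by move=> z /(coprime_torsion_unit (dot_pt d'))[_ rz]; exact: char_neq0.
- move=> z tz e; apply: (reduce_coprime_torsion hq tz); apply: td' => //.
  have [N [N_gt0 _ zN]] := tz; exists N; split=> //.
  have [Lz _] := coprime_torsion_unit (dot_pt d') tz.
  by rewrite -(reduceX _ Lz) zN reduce1.
by exists theta; split=> //; rewrite gd; exact: specialization thE.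
Qed.

Lemma residue_enumeration (x : Defs.point iota) : exists v : nat -> kappa x,
  (forall n, v n != 0) /\ forall a, a != 0 -> exists n, v n = a.
Proof.
apply: enumerable_units; apply: (enumerable_image (f := reduce (spec_pt x))).
  exists (fun n => if n is m.+1 then u m else 0) => a.
  have [->|/u_surj[n <-]] := eqVneq a 0; first by exists 0%N.
  by exists n.+1.
by move=> c; have [z [_ <-]] := reduce_surj c; exists z.
Qed.

(** The point [d] is built from [theta]: over a point of residue characteristic [p], an injective
    character is chosen that induces [theta] on prime-to-[p] roots of unity. Then [d] specializes
    [theta], and its Frobenius image specializes [theta']. *)
Lemma frobenius_companion p (theta theta' : character C K) :
  residue_characteristics K0 p -> char_inj theta -> char_inj theta' ->
  (forall z, coprime_torsion p z -> theta' z = theta z ^+ p) ->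
  (g (gen theta) <-> g (gen theta')).
Proof.
move=> [p_pr [y py]] ith ith' thE.
have [x xy] := lying_over iota y; subst y.
have p0 : p%:R = 0 :> kappa x.
  have sS := sp_subring (spec_pt x).
  rewrite -(reduce_nat (spec_pt x)).
  apply/(reduce_eq0 (in_local_ring (subring_nat sS p))).
  apply: in_maximal_ideal; rewrite -(rmorph_nat iota).
  by apply/(pt_over (subring_nat (local_ring_subring K0 (base x)) p)).
have hp : char_exponent (kappa x) p by right.
have [v [v0 v_surj]] := residue_enumeration x.
pose G : set (kappa x * C) := [set b | exists z, coprime_torsion p z /\
  b = (reduce (spec_pt x) z, theta z)].
have [||chi [ichi chiG]] := @char_inj_extend R (kappa x) v v0 v_surj G.
- split.
  + by exists 1; rewrite reduce1 char1; split=> //; exact: coprime_torsion1.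
  + move=> _ _ [z [tz ->]] [w [tw ->]]; exists (z / w).
    rewrite (reduce_coprime_torsionB _ tz tw) charM charV; split=> //.
    exact: coprime_torsionB.
  + move=> _ [z [tz ->]]; have [_ rz] := coprime_torsion_unit x tz.
    split; first exact: rz.
    exact: (char_neq0 theta (torsion_neq0 (coprime_torsion_torsion tz))).
  + move=> b [z [tz [/esym rz ->]]].
    by rewrite (reduce_coprime_torsion hp tz rz) char1.
- by move=> a _ [z [tz [-> /esym/ith ->]]]; exact: reduce1.
pose d := DotX chi.
have Ed : EX d by exact: char_inj_E.
have compat z : coprime_torsion p z -> theta z = chi (reduce (spec_pt x) z).
  move=> tz; have [N [N_gt0 _ zN]] := tz.
  have [Lz _] := coprime_torsion_unit x tz.
  apply/esym; apply: (chiG (reduce (spec_pt x) z, theta z)); last by exists z.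
  by exists N; split=> //=; rewrite -(reduceX _ Lz) zN reduce1.
have Np : N0 p by have := char_exponent_N0 1 hp; rewrite expn1.
have p_gt0 := prime_gt0 p_pr.
rewrite -(@specialization d p theta Ed hp ith compat) -(g_frob Np Ed).
apply: (@specialization (dot_frob p d) p theta') => //.
  exact: (class_pow E _ Np).1 Ed.
move=> z tz; rewrite (thE z tz) (compat z tz).
exact: (esym (char_powE chi _ p_gt0)).
Qed.

Lemma frobenius_char_inj p (theta : character C K) : prime p -> char_inj theta ->
  exists theta' : character C K, char_inj theta' /\
    forall z, coprime_torsion p z -> theta' z = theta z ^+ p.
Proof.
move=> p_pr ith; apply: coprime_torsion_char_inj.
- by rewrite char1 expr1n.
- by move=> z w _ _; rewrite charM charV expr_div_n.
- move=> z tz; apply: expf_neq0; apply: char_neq0.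
  exact: torsion_neq0 (coprime_torsion_torsion tz).
- move=> z [N [N_gt0 cN zN]]; rewrite -charX => /ith zp.
  have [m mz /= /andP[mN mp]] : exists2 m, m.-primitive_root z & (m %| N)%N && (m %| p)%N.
    have [m mz mN] := prim_order_exists N_gt0 zN; exists m => //.
    by rewrite mN (prim_order_dvd mz) zp eqxx.
  have : (m %| gcdn N p)%N by rewrite dvdn_gcd mN.
  rewrite (eqP cN) dvdn1 => /eqP m1; move: (prim_expr_order mz).
  by rewrite m1 expr1.
Qed.

Variable N1 : nat.
Hypothesis N1_gt0 : (0 < N1)%N.
Hypothesis N1P : forall p, prime p -> ~~ (p %| N1)%N -> residue_characteristics K0 p.

(** The exponent is peeled off prime by prime. A prime factor of [c] is prime to [N], so it does not
    divide [N1] and is a residue characteristic. *)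
Lemma power_companion N c (theta : character C K) : (N1 %| N)%N -> (0 < N)%N ->
  (0 < c)%N -> coprime c N -> char_inj theta ->
  exists theta' : character C K, [/\ char_inj theta',
    forall z, z ^+ N = 1 -> theta' z = theta z ^+ c
    & (g (gen theta) <-> g (gen theta'))].
Proof.
move=> N1N N_gt0; elim/ltn_ind: c theta => c IH theta c_gt0 cN ith.
have [c1|c1] := eqVneq c 1%N.
  by exists theta; split=> // z _; rewrite c1 expr1.
have p_pr : prime (pdiv c) by rewrite pdiv_prime // ltn_neqAle eq_sym c1.
set p := pdiv c in p_pr; have pc : (p %| c)%N by exact: pdiv_dvd.
have [th1 [ith1 th1E]] := frobenius_char_inj p_pr ith.
have pN : coprime p N by exact: coprime_dvdl pc cN.
have gth : g (gen theta) <-> g (gen th1).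
  apply: frobenius_companion th1E => //; apply: N1P => //.
  by rewrite -prime_coprime //; exact: coprime_dvdr N1N pN.
have cp_gt0 : (0 < c %/ p)%N by rewrite divn_gt0 ?prime_gt0 // dvdn_leq.
have lt_cp : (c %/ p < c)%N by rewrite ltn_Pdiv ?prime_gt1.
have cpN : coprime (c %/ p) N.
  by apply: coprime_dvdl cN; rewrite -{2}(divnK pc) dvdn_mulr.
have [th2 [ith2 th2E gth2]] := IH _ lt_cp th1 cp_gt0 cpN ith1.
exists th2; split=> //; last by rewrite gth.
move=> z zN; rewrite th2E // th1E; last by exists N; rewrite coprime_sym.
by rewrite -exprM mulnC divnK.
Qed.

Lemma gen_constant (theta theta' : character C K) :
  char_inj theta -> char_inj theta' -> g (gen theta) -> g (gen theta').
Proof.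
move=> ith ith' gth.
(* Otherwise characters agreeing with [theta'] on more and more roots of unity would contradict
   [gen_torsion_sequence]. The factorial exhausts all orders; the factor [N1] takes care of the
   primes that may fail to be residue characteristics. *)
have [n nP] : exists n, forall th : character C K, char_inj th ->
    (forall z, z ^+ (n`! * N1) = 1 -> th z = theta' z) ->
    (g (gen th) <-> g (gen theta')).
  apply: contrapT => /forallNP no.
  have ex n : exists th : character C K, [/\ char_inj th,
      forall z, z ^+ (n`! * N1) = 1 -> th z = theta' z
      & ~ (g (gen th) <-> g (gen theta'))].
    have /existsNP[th /not_implyP[ithn /not_implyP[thn gn]]] := no n.
    by exists th.
  pose f n := projT1 (cid (ex n)).
  have fi n : char_inj (f n) by rewrite /f; case: cid => ? [].
  have fT z : torsion K z -> exists n0, forall n, (n0 <= n)%N -> f n z = theta' z.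
    move=> [m [m0 zm]]; exists m => n mn; rewrite /f; case: cid => th [/= _ h _].
    apply: h; have /dvdnP[j ->] : (m %| n`! * N1)%N.
      by apply: dvdn_mulr; apply: dvdn_fact; rewrite m0.
    by rewrite mulnC exprM zm expr1n.
  have [n0 n0P] := gen_torsion_sequence ith' fi fT.
  by move: (n0P n0 (leqnn _)); rewrite /f; case: cid => th [].
set N := (n`! * N1)%N in nP.
have N_gt0 : (0 < N)%N by rewrite muln_gt0 fact_gt0.
have [z pz] := closed_prim_root_exists (charK N_gt0).
have prim (th : character C K) : char_inj th -> N.-primitive_root (th z).
  move=> ithz; have thN : th z ^+ N = 1 by rewrite -charX (prim_expr_order pz) char1.
  have [m pm mN] := prim_order_exists N_gt0 thN.
  suff -> : N = m by [].
  apply/eqP; rewrite eqn_dvd mN andbT (prim_order_dvd pz); apply/eqP.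
  by apply: ithz; rewrite charX (prim_expr_order pm).
(* Both characters send [z] to primitive [N]-th roots of unity, so they differ by an exponent prime
   to [N]. *)
have [c cE] : exists c, theta' z = theta z ^+ c.
  by have [i ->] := prim_rootP (prim _ ith) (prim_expr_order (prim _ ith')); exists i.
have cN : coprime c N by rewrite -(prim_root_exp_coprime c (prim _ ith)) -cE; exact: prim.
have cN' : coprime (c + N) N by rewrite coprime_sym /coprime gcdnDr -/(coprime _ _) coprime_sym.
(* [c] is 0 when [N = 1]; adding [N] makes the exponent positive and does not change the power. *)
have cN_gt0 : (0 < c + N)%N by rewrite addn_gt0 N_gt0 orbT.
have [th [ithz thE gthz]] := power_companion (dvdn_mull _ (dvdnn N1)) N_gt0 cN_gt0 cN' ith.
apply/(nP th ithz); last exact/gthz.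
move=> y yN; have [i ->] := prim_rootP pz yN.
rewrite !charX cE; congr (_ ^+ i).
by rewrite thE ?(prim_expr_order pz) // exprD (prim_expr_order (prim _ ith)) mulr1.
Qed.

Lemma g_constant d d' : EX d -> EX d' -> g d -> g d'.
Proof.
move=> /generic_companion[th [ith gd]] /generic_companion[th' [ith' gd']].
by move=> /gd h; apply/gd'; exact: gen_constant h.
Qed.

End Main.

Theorem corollary9p7 (R : realType)
    (X : scheme) (K0 : function_field X)
    (K : closedFieldType) (iota : {rmorphism K0 -> K})
    (charN0 : set nat)
    (E : admissible_class R[i] (generated_monoid charN0)) :
  integral_scheme X -> normal_scheme K0 -> flat_scheme X ->
  finite_type_scheme X ->
  (forall z : K, algebraicOver iota z) ->
  (forall p, charN0 p -> prime p) ->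
  residue_characteristics K0 `<=` charN0 ->
  (forall (k : fieldType) (chi : character R[i] k),
     finite_kernel_class (generated_monoid charN0) chi -> E k chi) ->
  connected [set: suspension R (checkXE_frob iota E)] /\
  connected [set: suspension R (checkX0E_frob iota E)].
Proof.
move=> iX _ fX ftX alg primes rc fin.
apply: connected_suspensions => [p /primes/prime_gt0//|g gLC gF d d' Ed Ed' gd].
have charK n : (0 < n)%N -> n%:R != 0 :> K.
  by move=> n0; rewrite -(rmorph_nat iota) fmorph_eq0; exact: function_field_char0.
have [u [u0 u_surj]] :=
  enumerable_units (algebraic_enumerable (function_field_enumerable K0 iX ftX) alg).
have [eta [dense ideal0 ringT]] := generic_point_over iX alg.
have [N N_gt0 NP] := residue_characteristics_cofinite K0 iX fX ftX.
apply: (g_constant charK primes rc fin u0 u_surj dense ideal0 ringT gLC _ N_gt0 NP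
  Ed Ed' gd).
by move=> nu d1 Nnu; exact: (gF (SigSub (mem_set Nnu))).
Qed.
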